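(* Let $A\to M$ be a Lie algebroid, let $\nabla$ be an $A$-representation on a vector bundle $E\to M$, and let $M=U\cup V$ with $U,V$ open. Then the Mayer–Vietoris sequence $$0\to\Omega^\bullet(A,E)\xrightarrow{i^*}\Omega^\bullet(A|_U,E|_U)\oplus\Omega^\bullet(A|_V,E|_V)\xrightarrow{j_1^*-j_0^*}\Omega^\bullet(A|_{U\cap V},E|_{U\cap V})\to0$$ is exact. Let $\{\mu_U,\mu_V\}$ be a partition of unity subordinated to the cover $\{U,V\}$. The Mayer–Vietoris sequence induces a long exact sequence in Lie algebroid cohomology with values in representations $$\cdots\to\mathrm H^q_{\nabla|_{U\cap V}}(A|_{U\cap V},E|_{U\cap V})\xrightarrow{d_\nabla^*}\mathrm H^{q+1}_\nabla(A,E)\xrightarrow{i^*}\mathrm H^{q+1}_{\nabla|_U}(A|_U,E|_U)\oplus\mathrm H^{q+1}_{\nabla|_V}(A|_V,E|_V)\xrightarrow{j_1^*-j_0^*}\mathrm H^{q+1}_{\nabla|_{U\cap V}}(A|_{U\cap V},E|_{U\cap V})\xrightarrow{d_\nabla^*}\mathrm H^{q+2}_\nabla(A,E)\to\cdots$$ The coboundary operator $d_\nabla^*$ is a morphism of vector spaces, explicitly defined, for a closed form $\omega\in\Omega^\bullet(A|_{U\cap V},E|_{U\cap V})$, by $$d_\nabla^*([\omega]):=\begin{cases}[-d_\nabla(\mu_V\omega)]&\text{on }U,\\ [d_\nabla(\mu_U\omega)]&\text{on }V,\end{cases}$$ i.e. $d_\nabla^*([\omega])$ is the class of the closed form on $M$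 which restricts to $-d_\nabla(\mu_V\omega)$ on $U$ and to $d_\nabla(\mu_U\omega)$ on $V$.
   Context: All manifolds and vector bundles are smooth and real. A Lie algebroid is a vector bundle $A\to M$ with an $\mathbb R$-Lie bracket on $\Gamma(A)$ and an anchor $\rho_A\colon A\to TM$ (vector bundle morphism over $\mathrm{id}_M$) such that $[a_1,fa_2]=f[a_1,a_2]+\rho_A(a_1)(f)a_2$. $\Omega^k(A)=\Gamma(\wedge^kA^* )$ carries the differential $d_A$ given by the usual Koszul formula. An $A$-representation on $E\to M$ is an $\mathbb R$-bilinear $\nabla\colon\Gamma(A)\times\Gamma(E)\to\Gamma(E)$ with $\nabla_{fa}e=f\nabla_ae$, $\nabla_a(fe)=f\nabla_ae+\rho_A(a)(f)e$ and $[\nabla_{a_1},\nabla_{a_2}]=\nabla_{[a_1,a_2]}$. It defines $d_\nabla$ on $\Omega^\bullet(A,E)=\Gamma(\wedge^\bullet A^*\otimes E)$ by $d_\nabla e=\nabla_\cdot e$ and $d_\nabla(\omega\wedge\eta)=d_A\omega\wedge\eta+(-1)^{\deg\omega}\omega\wedge d_\nabla\eta$; $\mathrm H^\bullet_\nabla(A,E)$ is the cohomology of $(\Omega^\bullet(A,E),d_\nabla)$. For open $W\subseteq M$, $A|_W$, $E|_W$, $\nabla|_W$ denote restrictions. The inclusions are $i_0\colon U\hookrightarrow M$, $i_1\colon V\hookrightarrow M$, $i\colon U\sqcup V\to M$, $j_0\colon U\cap V\hookrightarrow U$, $j_1\colon U\cap V\hookrightarrow V$. Thus $i^*\alpha=(\alpha|_U,\alpha|_V)$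 and $(j_1^*-j_0^* )(\alpha_U,\alpha_V)=\alpha_V|_{U\cap V}-\alpha_U|_{U\cap V}$. For $\omega$ on $U\cap V$, $\mu_V\omega$ is extended by zero to $U$ and $\mu_U\omega$ is extended by zero to $V$. *)

(* Defs.v *)
From HB Require Import structures.
From mathcomp Require Import all_boot all_order fingroup perm all_algebra.
From mathcomp Require Import all_classical all_reals all_analysis.
Set Implicit Arguments.
Unset Strict Implicit.
Unset Printing Implicit Defensive.
Import Order.TTheory GRing.Theory Num.Theory.
Import numFieldNormedType.Exports.
Local Open Scope classical_set_scope.
Local Open Scope ring_scope.

Lemma near_continuous (T U : topologicalType) (f g : T -> U) (y : T) :
  (\forall z \near y, f z = g z) ->
  {for y, continuous f} -> {for y, continuous g}.
Proof.
move=> e cf A nA; have fA : nbhs (f y) A by rewrite (nbhs_singleton e).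
by apply: filterS2 e (cf A fA) => z /= ->.
Qed.

Section SmoothEuclidean.
Variables (R : realType) (n : nat).
Implicit Types (O : set 'rV[R]_n) (f g : 'rV[R]_n -> R).

(* Meaningful for open O only: 'D looks at f in a neighbourhood of y. *)
Fixpoint Ck (k : nat) O f : Prop :=
  (forall y, O y -> {for y, continuous f}) /\
  if k is k'.+1 then
    forall i : 'I_n, (forall y, O y -> derivable f y (delta_mx 0 i)) /\
                     Ck k' O (fun y => 'D_(delta_mx 0 i) f y)
  else True.

Definition smooth_Rn O f := forall k, Ck k O f.

Lemma Ck_cts k O f : Ck k O f -> forall y, O y -> {for y, continuous f}.
Proof. by case: k => [|k] []. Qed.

Lemma Ck_sub k O O' f : O' `<=` O -> Ck k O f -> Ck k O' f.
Proof.
move=> sO; elim: k f => [|k IH] f /= [cf df]; (split; first by move=> y /sO/cf).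
  by [].
move=> i; have [d1 d2] := df i; split; first by move=> y /sO/d1.
exact: IH.
Qed.

Lemma Ck_local k O f :
  (forall y, O y -> exists2 N, N y & Ck k N f) -> Ck k O f.
Proof.
elim: k f => [|k IH] f H.
  by split=> // y /H[N Ny [cf _]]; exact: cf.
split; first by move=> y /H[N Ny [cf _]]; exact: cf.
move=> i; split; first by move=> y /H[N Ny [_ /(_ i)[df _]]]; exact: df.
by apply: IH => y /H[N Ny [_ /(_ i)[_ df]]]; exists N.
Qed.

Lemma Ck_ext k O f g : open O -> (forall y, O y -> f y = g y) ->
  Ck k O f -> Ck k O g.
Proof.
move=> oO.
have nO f' g' y : (forall y, O y -> f' y = g' y) -> O y ->
    \forall z \near y, f' z = g' z.
  move=> fg Oy; have : nbhs y O by exact: open_nbhs_nbhs.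
  by apply: filterS => z; exact: fg.
elim: k f g => [|k IH] f g fg [cf df].
  by split=> // y Oy; apply: near_continuous (nO _ _ _ fg Oy) (cf _ Oy).
split.
  by move=> y Oy; apply: near_continuous (nO _ _ _ fg Oy) (cf _ Oy).
move=> i; have [d1 d2] := df i; split.
  move=> y Oy; apply: (@near_eq_derivable _ _ _ f); last exact: d1.
  exact: nO.
apply: IH d2 => y Oy; apply: near_eq_derive; exact: nO.
Qed.

Lemma Ck_pred k O f : Ck k.+1 O f -> Ck k O f.
Proof.
elim: k f => [|k IH] f [cf df]; split=> // i; have [d1 d2] := df i.
by split=> //; exact: IH.
Qed.

Lemma Ck_cst k O (c : R) : Ck k O (fun=> c).
Proof.
have cc y : {for y, continuous (fun _ : 'rV[R]_n => c)} by exact: cst_continuous.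
elim: k c cc => [|k IH] c cc; split=> // i; split.
  by move=> y _; exact: derivable_cst.
have -> : (fun y => 'D_(delta_mx 0 i) (fun _ : 'rV[R]_n => c) y) = fun=> 0.
  by apply/funext => y; exact: derive_cst.
by apply: IH => y; exact: cst_continuous.
Qed.

Lemma CkD k O f g : open O -> Ck k O f -> Ck k O g ->
  Ck k O (fun y => f y + g y).
Proof.
move=> oO; elim: k f g => [|k IH] f g [cf df] [cg dg].
  by split=> // y Oy; apply: (@continuousD _ R^o); [exact: cf|exact: cg].
split.
  by move=> y Oy; apply: (@continuousD _ R^o); [exact: cf|exact: cg].
move=> i; have [d1 d2] := df i; have [e1 e2] := dg i; split.
  by move=> y Oy; apply: derivableD; [exact: d1|exact: e1].
apply: Ck_ext (IH _ _ d2 e2) => // y Oy.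
by rewrite (deriveD (d1 _ Oy) (e1 _ Oy)).
Qed.

Lemma CkM k O f g : open O -> Ck k O f -> Ck k O g ->
  Ck k O (fun y => f y * g y).
Proof.
move=> oO; elim: k f g => [|k IH] f g Hf Hg.
  split=> // y Oy; apply: continuousM; [exact: (Ck_cts Hf)|exact: (Ck_cts Hg)].
have [cf df] := Hf; have [cg dg] := Hg; split.
  by move=> y Oy; apply: continuousM; [exact: cf|exact: cg].
move=> i; have [d1 d2] := df i; have [e1 e2] := dg i; split.
  by move=> y Oy; apply: derivableM; [exact: d1|exact: e1].
have H := CkD oO (IH _ _ (Ck_pred Hf) e2) (IH _ _ (Ck_pred Hg) d2).
apply: Ck_ext H => // y Oy.
by rewrite (deriveM (d1 _ Oy) (e1 _ Oy)).
Qed.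

End SmoothEuclidean.

Record chart (R : realType) (T : Type) (n : nat) := Chart {
  cdom : set T;
  cmap :> T -> 'rV[R]_n
}.

Section SmoothFunctions.
Variables (R : realType) (n : nat) (T : topologicalType).
Implicit Types (c : chart R T n) (atl : set (chart R T n)) (D : set T).

(* A homeomorphism from the open set [cdom c] onto an open subset of R^n;
   the values of [c] outside [cdom c] are irrelevant. *)
Definition is_chart c :=
  [/\ open (cdom c),
      {in cdom c &, injective c},
      (forall x, cdom c x -> {for x, continuous c}) &
      (forall O : set T, open O -> O `<=` cdom c -> open (c @` O))].

(* [g] below is f \o c^-1; it is determined by f on c(D), and c^-1 itself is not
   used because it would not be a total function when T is empty. *)
Definition smooth_in c D (f : T -> R) :=
  exists2 g : 'rV[R]_n -> R,
    smooth_Rn (c @` (D `&` cdom c)) g & {in D `&` cdom c, forall x, f x = g (c x)}.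

Definition smooth_on atl D (f : T -> R) := forall c, atl c -> smooth_in c D f.

Definition is_atlas atl :=
  [/\ (forall c, atl c -> is_chart c),
      (forall x, exists2 c, atl c & cdom c x) &
      (forall c, atl c -> forall j : 'I_n,
         smooth_on atl (cdom c) (fun x => c x 0 j))].

End SmoothFunctions.

Record manifold (R : realType) (n : nat) := Manifold {
  mpoint :> topologicalType;
  atlas : set (chart R mpoint n);
  mfd_hausdorff : hausdorff_space mpoint;
  mfd_second_countable : @second_countable mpoint;
  mfd_atlas : is_atlas atlas
}.

Notation smooth M D f := (smooth_on (@atlas _ _ M) D f).

Section SmoothLemmas.
Variables (R : realType) (n : nat) (M : manifold R n).
Implicit Types (D : set M) (f g : M -> R).

Lemma open_chart_image c D : atlas c -> open D -> open (c @` (D `&` cdom c)).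
Proof.
move=> Mc oD; have [/(_ _ Mc)[od _ _ oc] _ _] := mfd_atlas M.
by apply: oc => [|x []//]; exact: openI.
Qed.

Lemma smooth_sub D D' f : D' `<=` D -> smooth M D f -> smooth M D' f.
Proof.
move=> sD sf c Mc; have [g sg fg] := sf c Mc; exists g.
  by move=> k; apply: Ck_sub (sg k) => _ [x [/sD Dx dx] <-]; exists x.
by move=> x /set_mem[/sD Dx dx]; apply: fg; apply/mem_set.
Qed.

Lemma smooth_ext D f g : (forall x, D x -> f x = g x) ->
  smooth M D f -> smooth M D g.
Proof.
move=> fg sf c Mc; have [h sh fh] := sf c Mc; exists h => // x Dx.
by rewrite -fg ?fh//; have /set_mem[] := Dx.
Qed.

Lemma smooth_cst D (a : R) : smooth M D (fun=> a).
Proof. by move=> c Mc; exists (fun=> a) => // k; exact: Ck_cst. Qed.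

Lemma smoothD D f g : open D -> smooth M D f -> smooth M D g ->
  smooth M D (fun x => f x + g x).
Proof.
move=> oD sf sg c Mc; have [a sa fa] := sf c Mc; have [b sb gb] := sg c Mc.
exists (fun y => a y + b y); last by move=> x Dx; rewrite fa// gb.
by move=> k; apply: CkD => //; exact: open_chart_image.
Qed.

Lemma smoothM D f g : open D -> smooth M D f -> smooth M D g ->
  smooth M D (fun x => f x * g x).
Proof.
move=> oD sf sg c Mc; have [a sa fa] := sf c Mc; have [b sb gb] := sg c Mc.
exists (fun y => a y * b y); last by move=> x Dx; rewrite fa// gb.
by move=> k; apply: CkM => //; exact: open_chart_image.
Qed.

Lemma smooth_sum (I : Type) (r : seq I) (P : pred I) D (F : I -> M -> R) :
  open D -> (forall i, smooth M D (F i)) ->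
  smooth M D (fun x => \sum_(i <- r | P i) F i x).
Proof.
move=> oD sF; elim: r => [|i r IH].
  by apply: smooth_ext (smooth_cst D 0) => x _; rewrite big_nil.
case Pi : (P i).
  by apply: smooth_ext (smoothD oD (sF i) IH) => x _; rewrite big_cons Pi.
by apply: smooth_ext IH => x _; rewrite big_cons Pi.
Qed.

Lemma smooth_local D f : open D ->
  (forall x, D x -> exists N : set M, [/\ open N, N x & smooth M (N `&` D) f]) ->
  smooth M D f.
Proof.
move=> oD H c Mc; have [/(_ _ Mc)[od ic _ oc] _ _] := mfd_atlas M.
pose S y x := (D `&` cdom c) x /\ c x = y.
pose g y := if pselect (exists x, S y x) is left e then f (projT1 (cid e)) else 0.
have gE x : (D `&` cdom c) x -> g (c x) = f x.
  move=> Dx; rewrite /g; case: pselect => [e|[]]; last by exists x.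
  have [[_ d'] E] := projT2 (cid e).
  by congr f; apply: ic => //; apply/mem_set => //; case: Dx.
exists g; last by move=> x /set_mem Dx; rewrite gE.
move=> k; apply: Ck_local => _ [x [Dx dx] <-].
have [N [oN Nx sN]] := H x Dx; have [h sh fh] := sN c Mc.
exists (c @` ((N `&` D) `&` cdom c)); first by exists x.
apply: Ck_ext (sh k); first by apply: open_chart_image => //; exact: openI.
move=> _ [z [[Nz Dz] dz] <-]; rewrite gE// fh//.
by apply/mem_set.
Qed.

End SmoothLemmas.

Record opens (T : topologicalType) := Opens {
  oset :> set T;
  oset_open : open oset
}.

Definition opensI (T : topologicalType) (U V : opens T) : opens T :=
  Opens (openI (oset_open U) (oset_open V)).

Lemma set_val_val (T : Type) (W : set T) (x : W) : set_val x = val x.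
Proof. by case: x => x Wx; rewrite set_valE. Qed.

Section OpenSubmanifold.
Variables (R : realType) (n : nat) (M : manifold R n) (W : opens M).

Lemma val_continuous : continuous (fun x : W => val x).
Proof.
have -> : (fun x : W => val x) = set_val by apply/funext => x; rewrite set_val_val.
exact: initial_continuous.
Qed.

Lemma open_val_preimage (O : set M) : open O -> open ((fun x : W => val x) @^-1` O).
Proof. by apply: open_comp => x _; exact: val_continuous. Qed.

Lemma open_val_image (O : set W) : open O -> open ((fun x : W => val x) @` O).
Proof.
move=> [Q oQ <-]; have -> : (fun x : W => val x) @` (set_val @^-1` Q) = Q `&` W.
  apply/seteqP; split => [_ [x Ox <-]|x [Ox Wx]].
    by split; [move: Ox; rewrite /= set_val_val|exact/set_mem/(valP x)].
  by exists (exist _ x (mem_set Wx)) => //=; rewrite set_val_val.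
by apply: openI => //; exact: oset_open.
Qed.

Definition open_chart (c : chart R M n) : chart R W n :=
  Chart ((fun x : W => val x) @^-1` cdom c) (fun x => c (val x)).

Definition open_atlas := [set open_chart c | c in @atlas _ _ M].

Lemma open_hausdorff_sub : hausdorff_space W.
Proof.
have := @mfd_hausdorff _ _ M; rewrite !open_hausdorff => H x y xy.
have vxy : val x != val y by apply: contra xy => /eqP/val_inj ->.
have [[A B] [/= /set_mem Ax /set_mem By] [oA oB AB]] := H _ _ vxy.
exists ((fun x : W => val x) @^-1` A, (fun x : W => val x) @^-1` B) => /=.
  by split; apply/mem_set.
split; [exact: open_val_preimage|exact: open_val_preimage|].
by rewrite -preimage_setI (eqP AB) preimage_set0.
Qed.

Lemma open_second_countable : @second_countable W.
Proof.
have [B cB [oB bB]] := mfd_second_countable M.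
exists [set (fun x : W => val x) @^-1` A | A in B]; first exact: card_le_trans (card_image_le _ _) cB.
split=> [_ [A BA <-]|x N]; first by apply: open_val_preimage; exact: oB.
rewrite nbhsE => -[N' [[Q oQ <-] N'x] sN].
have : nbhs (val x) Q by apply: open_nbhs_nbhs; split=> //; rewrite -set_val_val.
move=> /bB[A [BA Ax] sA].
exists ((fun x : W => val x) @^-1` A); first by split=> //; exists A.
by move=> z Az; apply: sN; rewrite /= set_val_val; exact: sA.
Qed.

(* Both the inclusion of W into M and inclusions between open subsets of M are
   restrictions of charts. *)
Lemma smooth_in_pull (T : topologicalType) (h : T -> M)
    (c : chart R M n) (D : set M) (f : M -> R) :
  smooth_in c D f ->
  smooth_in (Chart (h @^-1` cdom c) (fun x => c (h x))) (h @^-1` D)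
    (fun x => f (h x)).
Proof.
move=> [g sg fg]; exists g.
  by move=> k; apply: Ck_sub (sg k) => _ [x [Dx dx] <-]; exists (h x).
by move=> x /set_mem[Dx dx]; apply: fg; apply/mem_set.
Qed.

Lemma open_is_atlas : is_atlas open_atlas.
Proof.
have [A1 A2 A3] := mfd_atlas M; split.
- move=> _ [c Mc <-]; have [od ic cc oc] := A1 c Mc; split.
  + exact: open_val_preimage.
  + move=> x y /set_mem dx /set_mem dy E; apply/val_inj.
    by apply: ic => //; apply/mem_set.
  + move=> x dx; apply: (@continuous_comp _ _ _ (fun x : W => val x) c).
      exact: val_continuous.
    exact: cc.
  + move=> O oO sO; have -> : open_chart c @` O = c @` ((fun x : W => val x) @` O).
      by rewrite image_comp.
    apply: oc; first exact: open_val_image.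
    by move=> _ [x Ox <-]; exact: sO.
- by move=> x; have [c Mc dx] := A2 (val x); exists (open_chart c) => //; exists c.
move=> _ [c Mc <-] j _ [c' Mc' <-].
exact: (@smooth_in_pull _ (fun x : W => val x) c' (cdom c) (fun x => c x 0 j) (A3 c Mc j c' Mc')).
Qed.

Definition open_mfd : manifold R n :=
  Manifold open_hausdorff_sub open_second_countable open_is_atlas.

Lemma smooth_val (D : set M) f : smooth M D f ->
  smooth open_mfd ((fun x : W => val x) @^-1` D) (fun x : W => f (val x)).
Proof. by move=> sf _ [c Mc <-]; exact: smooth_in_pull (sf c Mc). Qed.

End OpenSubmanifold.

Section Inclusion.
Variables (R : realType) (n : nat) (M : manifold R n) (W' W : opens M).
Hypothesis sW : W' `<=` W.

Definition incl (x : open_mfd W') : open_mfd W :=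
  exist _ (val x) (mem_set (sW (set_mem (valP x)))).

Lemma incl_continuous : continuous incl.
Proof.
move=> x A; rewrite nbhsE => -[_ [[Q oQ <-] Ox] sA].
rewrite nbhsE /=; exists ((fun x : W' => val x) @^-1` Q).
  split; first exact: open_val_preimage.
  by move: Ox; rewrite /= set_val_val.
by move=> z Qz; apply: sA; rewrite /= set_val_val.
Qed.

Lemma smooth_incl (D : set (open_mfd W)) f : smooth (open_mfd W) D f ->
  smooth (open_mfd W') (incl @^-1` D) (fun x => f (incl x)).
Proof.
move=> sf _ [c Mc <-].
exact: (smooth_in_pull incl (sf _ (imageP _ Mc))).
Qed.

End Inclusion.

Section SmoothRing.
Variables (R : realType) (n : nat) (M : manifold R n).

Definition smooth_pred : {pred M -> R} :=
  fun f => `[< smooth M setT f >].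

Lemma smooth_predP f : reflect (smooth M setT f) (f \in smooth_pred).
Proof. exact: asboolP. Qed.

Fact smooth_pred_subring : subring_closed smooth_pred.
Proof.
split; first by apply/smooth_predP; exact: smooth_cst.
  move=> f g /smooth_predP sf /smooth_predP sg; apply/smooth_predP.
  apply: smooth_ext (smoothD openT sf (smoothM openT (smooth_cst setT (-1)) sg)).
  by move=> x _; rewrite mulN1r.
move=> f g /smooth_predP sf /smooth_predP sg; apply/smooth_predP.
exact: smoothM openT sf sg.
Qed.
HB.instance Definition _ :=
  GRing.isSubringClosed.Build _ smooth_pred smooth_pred_subring.

Fact smooth_pred_scaler : scaler_closed smooth_pred.
Proof.
move=> a f /smooth_predP sf; apply/smooth_predP.
exact: smoothM openT (smooth_cst setT a) sf.
Qed.
HB.instance Definition _ :=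
  GRing.isScaleClosed.Build R _ smooth_pred smooth_pred_scaler.

Record smooth_fun := SmoothFun {
  smooth_fun_val :> M -> R;
  _ : smooth_fun_val \in smooth_pred
}.
HB.instance Definition _ := [isSub of smooth_fun for smooth_fun_val].
HB.instance Definition _ := [Choice of smooth_fun by <:].
HB.instance Definition _ := GRing.SubChoice_isSubComPzRing.Build (M -> R) _ smooth_fun smooth_pred_subring.
HB.instance Definition _ := [SubZmodule_isSubLmodule of smooth_fun by <:].

End SmoothRing.

Arguments smooth_pred {R n} M _.

Notation "''C^oo' ( M )" := (smooth_fun M) (format "''C^oo' ( M )").

Section DependentFunctions.
Variables (R : pzRingType) (T : Type) (E : T -> lmodType R).

Definition dfun := forall x, E x.
HB.instance Definition _ := Choice.copy dfun (forall x, E x).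

Implicit Types (s t u : dfun).

Let addA : associative (fun s t : dfun => (fun x => s x + t x) : dfun).
Proof. by move=> s t u; apply/functional_extensionality_dep => x; rewrite addrA. Qed.
Let addC : commutative (fun s t : dfun => (fun x => s x + t x) : dfun).
Proof. by move=> s t; apply/functional_extensionality_dep => x; rewrite addrC. Qed.
Let add0 : left_id ((fun x => 0) : dfun) (fun s t : dfun => (fun x => s x + t x) : dfun).
Proof. by move=> s; apply/functional_extensionality_dep => x; rewrite add0r. Qed.
Let addN : left_inverse ((fun x => 0) : dfun) (fun s : dfun => (fun x => - s x) : dfun)
  (fun s t : dfun => (fun x => s x + t x) : dfun).
Proof. by move=> s; apply/functional_extensionality_dep => x; rewrite addNr. Qed.
HB.instance Definition _ := GRing.isZmodule.Build dfun addA addC add0 addN.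

Let scale (a : R) s : dfun := fun x => a *: s x.
Let scaleA a b s : scale a (scale b s) = scale (a * b) s.
Proof. by apply/functional_extensionality_dep => x; rewrite /scale scalerA. Qed.
Let scale1 : left_id 1 scale.
Proof. by move=> s; apply/functional_extensionality_dep => x; rewrite /scale scale1r. Qed.
Let scaleDr : right_distributive scale +%R.
Proof. by move=> a s t; apply/functional_extensionality_dep => x; rewrite /scale scalerDr. Qed.
Let scaleDl s : {morph scale^~ s : a b / a + b}.
Proof. by move=> a b; apply/functional_extensionality_dep => x; rewrite /scale scalerDl. Qed.
HB.instance Definition _ :=
  GRing.Zmodule_isLmodule.Build R dfun scaleA scale1 scaleDr scaleDl.

End DependentFunctions.

Record triv (R : realType) (T : Type) (fib : T -> lmodType R) (r : nat) := Triv {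
  tdom : set T;
  tcoord : forall x, fib x -> 'rV[R]_r;
  tframe : forall x, 'rV[R]_r -> fib x
}.

Section TrivialisationAtlas.
Variables (R : realType) (n : nat) (M : manifold R n).
Variables (fib : M -> lmodType R) (r : nat).

(* Over [tdom t], [tframe t x] maps the canonical basis of R^r to the value at x
   of a local frame and [tcoord t x] gives the coordinates in that frame; the
   values outside [tdom t] are irrelevant. *)
Definition is_triv (t : triv fib r) :=
  open (tdom t) /\
  forall x, tdom t x -> [/\ linear (@tcoord _ _ _ _ t x),
    cancel (@tcoord _ _ _ _ t x) (@tframe _ _ _ _ t x) &
    cancel (@tframe _ _ _ _ t x) (@tcoord _ _ _ _ t x)].

Definition is_triv_atlas (B : set (triv fib r)) :=
  [/\ (forall t, B t -> is_triv t),
      (forall x, exists2 t, B t & tdom t x) &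
      (forall t u, B t -> B u -> forall i j : 'I_r,
        smooth M (tdom t `&` tdom u)
          (fun x => tcoord u (tframe t x (delta_mx 0 i)) 0 j))].

End TrivialisationAtlas.

(* The topology and smooth structure of the total space are those for which the
   trivialisations are diffeomorphisms. *)
Record vbundle (R : realType) (n : nat) (M : manifold R n) (r : nat) := VBundle {
  fiber :> M -> lmodType R;
  trivs : set (triv fiber r);
  vbundle_atlas : is_triv_atlas trivs
}.

Section Frames.
Variables (R : realType) (n : nat) (M : manifold R n) (r : nat) (E : vbundle M r).
Implicit Type t : triv E r.

Lemma triv_open t : trivs t -> open (tdom t).
Proof. by have [H _ _] := vbundle_atlas E => /H[]. Qed.

Lemma trivP t x : trivs t -> tdom t x -> [/\ linear (@tcoord _ _ _ _ t x),
    cancel (@tcoord _ _ _ _ t x) (@tframe _ _ _ _ t x) &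
    cancel (@tframe _ _ _ _ t x) (@tcoord _ _ _ _ t x)].
Proof. by have [H _ _] := vbundle_atlas E => /H[_]; apply. Qed.

Lemma triv_cover x : exists2 t : triv E r, trivs t & tdom t x.
Proof. by have [_ H _] := vbundle_atlas E. Qed.

Lemma frame_linear t x : trivs t -> tdom t x -> linear (@tframe _ _ _ _ t x).
Proof.
move=> Bt tx; have [lc cf fc] := trivP Bt tx => a u v.
by rewrite -[RHS]cf lc !fc.
Qed.

End Frames.

Section Sections.
Variables (R : realType) (n : nat) (M : manifold R n) (r : nat) (E : vbundle M r).

Definition is_section : {pred dfun E} := fun s =>
  `[< forall t, trivs t -> forall j : 'I_r,
        smooth M (tdom t) (fun x => tcoord t (s x) 0 j) >].

Fact is_section_submod : submod_closed is_section.
Proof.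
split.
  apply/asboolP => t Bt j; apply: smooth_ext (smooth_cst _ 0) => x tx.
  have [lc _ _] := trivP Bt tx; have := lc (-1) 0 0.
  by rewrite scaler0 addr0 scaleN1r addNr => ->; rewrite mxE.
move=> a s s' /asboolP Hs /asboolP Hs'; apply/asboolP => t Bt j.
have ot := triv_open Bt.
apply: smooth_ext (smoothD ot (smoothM ot (smooth_cst _ a) (Hs t Bt j)) (Hs' t Bt j)).
by move=> x tx; have [lc _ _] := trivP Bt tx; rewrite [RHS](congr1 (fun m : 'rV_r => m 0 j) (lc _ _ _)) !mxE.
Qed.
HB.instance Definition _ :=
  GRing.isSubmodClosed.Build R _ is_section is_section_submod.

Record Sect := MkSect {
  sect_val : dfun E;
  _ : sect_val \in is_section
}.
HB.instance Definition _ := [isSub of Sect for sect_val].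
HB.instance Definition _ := [Choice of Sect by <:].
HB.instance Definition _ := [SubChoice_isSubLmodule of Sect by <:].

Definition sect_fun (s : Sect) : forall x, E x := sect_val s.

Fact fscale_subproof (f : 'C^oo(M)) (s : Sect) :
  ((fun x => f x *: sect_fun s x) : dfun E) \in is_section.
Proof.
apply/asboolP => t Bt j; have ot := triv_open Bt.
have /smooth_predP sf := valP f; have /asboolP ss := valP s.
apply: smooth_ext (smoothM ot (smooth_sub (@subsetT _ _) sf) (ss t Bt j)).
move=> x tx; have [lc _ _] := trivP Bt tx; have l0 := lc (-1) 0 0.
rewrite -[_ *: _]addr0 lc [tcoord t 0](_ : _ = 0) ?mxE ?addr0//.
by rewrite -[0 in LHS]addr0 -[X in X + _](scaler0 _ (-1)) lc scaleN1r addNr.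
Qed.

Definition fscale (f : 'C^oo(M)) (s : Sect) : Sect := MkSect (fscale_subproof f s).

End Sections.

Arguments is_section {R n M r} E _.
Coercion sect_fun : Sect >-> Funclass.
Notation "''Gamma' ( E )" := (Sect E) (format "''Gamma' ( E )").

Section MultilinearMaps.
Variables (R : realType) (V U : lmodType R) (k : nat).
Implicit Types (v : 'I_k -> V) (F : ('I_k -> V) -> U).

Definition upd v i a : 'I_k -> V := fun j => if j == i then a else v j.

Definition multilinear F := forall v i (c : R) a b,
  F (upd v i (c *: a + b)) = c *: F (upd v i a) + F (upd v i b).

Definition alternating F := forall v i j, i != j -> v i = v j -> F v = 0.

Lemma upd_id v i : upd v i (v i) = v.
Proof. by apply/funext => j; rewrite /upd; case: eqP => [->|]. Qed.

Lemma multilinear0 F v i : multilinear F -> F (upd v i 0) = 0.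
Proof.
move=> mF; have := mF v i (-1) 0 0; rewrite scaler0 addr0 => ->.
by rewrite scaleN1r addNr.
Qed.

Lemma multilinear_sum F v i (I : Type) (s : seq I) (c : I -> R) (a : I -> V) :
  multilinear F ->
  F (upd v i (\sum_(l <- s) c l *: a l)) = \sum_(l <- s) c l *: F (upd v i (a l)).
Proof.
move=> mF; elim: s => [|l s IH]; first by rewrite !big_nil multilinear0.
by rewrite !big_cons mF IH.
Qed.

End MultilinearMaps.

Section Forms.
Variables (R : realType) (n : nat) (M : manifold R n).
Variables (rA rE : nat) (A : vbundle M rA) (E : vbundle M rE) (k : nat).

Definition form_family := dfun (fun x : M => (('I_k -> A x) -> E x) : lmodType R).

(* The fibre of /\^k A^* (x) E at x is identified with the space of alternating
   k-linear maps from A x to E x. Smoothness of a section of this bundle is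
   smoothness of its coefficients in local frames of A and E. *)
Definition smooth_form (w : form_family) :=
  forall (t : triv A rA) (u : triv E rE), trivs t -> trivs u ->
  forall (I : 'I_k -> 'I_rA) (j : 'I_rE),
  smooth M (tdom t `&` tdom u)
    (fun x => tcoord u (w x (fun i => tframe t x (delta_mx 0 (I i)))) 0 j).

Definition is_form : {pred form_family} := fun w =>
  `[< [/\ forall x, multilinear (w x), forall x, alternating (w x) & smooth_form w] >].

Lemma is_formP w : reflect
  [/\ forall x, multilinear (w x), forall x, alternating (w x) & smooth_form w]
  (w \in is_form).
Proof. exact: asboolP. Qed.

Lemma coordD (u : triv E rE) x (a : R) (y z : E x) j : trivs u -> tdom u x ->
  tcoord u (a *: y + z) 0 j = a * tcoord u y 0 j + tcoord u z 0 j.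
Proof. by move=> Bu ux; have [lc _ _] := trivP Bu ux; rewrite lc !mxE. Qed.

Lemma coord0 (u : triv E rE) x j : trivs u -> tdom u x ->
  tcoord u (0 : E x) 0 j = 0.
Proof.
move=> Bu ux; rewrite -[0 in LHS]addr0 -[X in X + _](scaler0 _ (-1)).
by rewrite coordD// mulN1r addNr.
Qed.

Lemma coord_sum (u : triv E rE) x (I : Type) (s : seq I) (c : I -> R)
    (y : I -> E x) j : trivs u -> tdom u x ->
  tcoord u (\sum_(i <- s) c i *: y i) 0 j = \sum_(i <- s) c i * tcoord u (y i) 0 j.
Proof.
move=> Bu ux; elim: s => [|i s IH]; first by rewrite !big_nil coord0.
by rewrite !big_cons coordD// IH.
Qed.

Fact is_form_submod : submod_closed is_form.
Proof.
split.
  apply/is_formP; split => [x v i c a b|x v i j _ _|t u Bt Bu I j] //.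
    by rewrite scaler0 addr0.
  by apply: smooth_ext (smooth_cst _ 0) => x [_ ux]; rewrite coord0.
move=> c w w' /is_formP[m1 a1 s1] /is_formP[m2 a2 s2]; apply/is_formP; split.
- move=> x v i d a b; have E1 z : (c *: w + w') x z = c *: w x z + w' x z by [].
  rewrite !E1 m1 m2 !scalerDr !scalerA [d * c]mulrC -!addrA; congr (_ + _).
  by rewrite addrCA.
- move=> x v i j ij vij; have E1 z : (c *: w + w') x z = c *: w x z + w' x z by [].
  by rewrite E1 (a1 _ _ _ _ ij vij) (a2 _ _ _ _ ij vij) scaler0 addr0.
move=> t u Bt Bu I j; have oD : open (tdom t `&` tdom u).
  by apply: openI; exact: triv_open.
apply: smooth_ext (smoothD oD (smoothM oD (smooth_cst _ c) (s1 t u Bt Bu I j))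
  (s2 t u Bt Bu I j)).
by move=> x [_ ux]; rewrite -coordD.
Qed.
HB.instance Definition _ :=
  GRing.isSubmodClosed.Build R _ is_form is_form_submod.

Record Form := MkForm {
  form_val : form_family;
  _ : form_val \in is_form
}.
HB.instance Definition _ := [isSub of Form for form_val].
HB.instance Definition _ := [Choice of Form by <:].
HB.instance Definition _ := [SubChoice_isSubLmodule of Form by <:].

Definition form_fun (w : Form) : forall x, ('I_k -> A x) -> E x := form_val w.

Lemma frame_decomp (x : M) (t : triv A rA) (a : A x) : trivs t -> tdom t x ->
  a = \sum_(l < rA) tcoord t a 0 l *: tframe t x (delta_mx 0 l).
Proof.
move=> Bt tx; have [_ cf _] := trivP Bt tx; rewrite -[LHS]cf.
have lf := frame_linear Bt tx.
rewrite [X in tframe t x X]row_sum_delta; elim/big_rec2: _ => [|i y z _ IH].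
  have := lf (-1) 0 0; rewrite scaler0 addr0 => ->.
  by rewrite scaleN1r addNr.
by rewrite lf IH.
Qed.

Fact contract_subproof (w : Form) (a : 'I_k -> 'Gamma(A)) :
  ((fun x => form_fun w (fun i => a i x)) : dfun E) \in is_section E.
Proof.
have /is_formP[mw aw sw] := valP w; apply/asboolP => u Bu j.
apply: smooth_local => [|x ux]; first exact: triv_open.
have [t Bt tx] := triv_cover A x; exists (tdom t); split => //.
  exact: triv_open.
set N := _ `&` _; have oN : open N by apply: openI; exact: triv_open.
pose sm (b : forall x, A x) := forall l, smooth M N (fun x => tcoord t (b x) 0 l).
suff H m (b : 'I_k -> forall x, A x) : (forall i, sm (b i)) ->
    (forall i : 'I_k, (m <= i)%N ->
       exists l, forall x, N x -> b i x = tframe t x (delta_mx 0 l)) ->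
    smooth M N (fun x => tcoord u (form_val w (fun i => b i x)) 0 j).
  apply: (H k (fun i x => a i x)) => [i l|i]; last by rewrite leqNgt ltn_ord.
  have /asboolP sa := valP (a i).
  by apply: smooth_sub (sa t Bt l); exact: subIsetl.
elim: m b => [|m IH] b sb fb.
  have fb' i := cid (fb i (leq0n _)).
  apply: smooth_ext (sw t u Bt Bu (fun i => projT1 (fb' i)) j) => y Ny.
  congr (tcoord u (form_val w _) 0 j); apply/funext => i.
  by have := projT2 (fb' i) => ->.
have [mk|km] := ltnP m k; last first.
  apply: IH => // i mi; have := leq_trans km mi.
  by rewrite leqNgt ltn_ord.
pose i0 := Ordinal mk.
pose b' (l : 'I_rA) (i : 'I_k) : forall x, A x :=
  if i == i0 then fun x => tframe t x (delta_mx 0 l) else b i.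
have sfr l : sm (fun x => tframe t x (delta_mx 0 l)).
  move=> l'; apply: smooth_ext (smooth_cst _ ((delta_mx 0 l : 'rV[R]_rA) 0 l')) => y [ty _].
  by have [_ _ ->] := trivP Bt ty.
have H l : smooth M N (fun x => tcoord u (form_val w (fun i => b' l i x)) 0 j).
  apply: IH => [i|i mi]; rewrite /b'; case: eqP => [_|ni].
  - exact: sfr.
  - exact: sb.
  - by exists l.
  apply: fb; rewrite ltn_neqAle mi andbT; apply/eqP => E'.
  by apply: ni; apply/val_inj.
have := smooth_sum (index_enum 'I_rA) xpredT oN (fun l => smoothM oN (sb i0 l) (H l)).
apply: smooth_ext => y [ty uy].
have -> : (fun i => b i y) = upd (fun i => b i y) i0
    (\sum_l tcoord t (b i0 y) 0 l *: tframe t y (delta_mx 0 l)).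
  by rewrite -frame_decomp// upd_id.
rewrite multilinear_sum// coord_sum//; apply: eq_bigr => l _.
suff -> : upd (fun i => b i y) i0 (tframe t y (delta_mx 0 l)) =
    fun i => b' l i y by [].
by apply/funext => i; rewrite /b' /upd; case: (i == i0).
Qed.

(* w(a_1, ..., a_k), for sections a_i of A. *)
Definition contract (w : Form) (a : 'I_k -> 'Gamma(A)) : 'Gamma(E) :=
  MkSect (contract_subproof w a).

End Forms.

Arguments is_form {R n M rA rE} A E k _.
Arguments form_fun {R n M rA rE A E k} w x v.
Coercion form_fun : Form >-> Funclass.
Notation "''Omega^' k ( A , E )" := (Form A E k)
  (at level 8, k at level 2, format "''Omega^' k ( A ,  E )").

Section OpenBundle.
Variables (R : realType) (n : nat) (M : manifold R n) (r : nat).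
Variables (E : vbundle M r) (W : opens M).

Let fibW (x : open_mfd W) : lmodType R := E (val x).

Definition open_triv (t : triv E r) : triv fibW r :=
  @Triv _ (open_mfd W) fibW r ((fun x : open_mfd W => val x) @^-1` tdom t)
    (fun x v => tcoord t v) (fun x v => tframe t (val x) v).

Fact open_triv_atlas : is_triv_atlas [set open_triv t | t in @trivs _ _ _ _ E].
Proof.
have [B1 B2 B3] := vbundle_atlas E; split.
- move=> _ [t Bt <-]; have [ot lt] := B1 t Bt; split.
    exact: open_val_preimage.
  by move=> x; exact: lt.
- by move=> x; have [t Bt tx] := B2 (val x); exists (open_triv t) => //; exists t.
move=> _ _ [t Bt <-] [u Bu <-] i j.
exact: (smooth_val (W := W) (B3 t u Bt Bu i j)).
Qed.

Definition open_bundle : vbundle (open_mfd W) r := VBundle open_triv_atlas.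

End OpenBundle.

Notation "E \|_ W" := (open_bundle E W) (at level 9, W at level 9, format "E \|_ W").

Section RestrictFunctionsSections.
Variables (R : realType) (n : nat) (M : manifold R n) (W : opens M).

Fact res_fun_subproof (f : 'C^oo(M)) :
  (fun x : open_mfd W => f (val x)) \in smooth_pred (open_mfd W).
Proof. by apply/smooth_predP; have /smooth_predP sf := valP f; exact: (smooth_val (W := W) sf). Qed.

Definition res_fun (f : 'C^oo(M)) : 'C^oo(open_mfd W) := SmoothFun (res_fun_subproof f).

Variables (r : nat) (E : vbundle M r).

Fact res_sect_subproof (s : 'Gamma(E)) :
  ((fun x : open_mfd W => s (val x)) : dfun (E \|_ W)) \in is_section (E \|_ W).
Proof.
apply/asboolP => _ [t Bt <-] j; have /asboolP ss := valP s.
exact: (smooth_val (W := W) (ss t Bt j)).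
Qed.

Definition res_sect (s : 'Gamma(E)) : 'Gamma(E \|_ W) := MkSect (res_sect_subproof s).

End RestrictFunctionsSections.

Section RestrictForms.
Variables (R : realType) (n : nat) (M : manifold R n).
Variables (rA rE : nat) (A : vbundle M rA) (E : vbundle M rE) (k : nat).

Section Val.
Variable W : opens M.

Fact res_form_subproof (w : 'Omega^k(A, E)) :
  ((fun (x : open_mfd W) v => w (val x) v) : form_family (A \|_ W) (E \|_ W) k)
    \in is_form (A \|_ W) (E \|_ W) k.
Proof.
have /is_formP[m a s] := valP w; apply/is_formP; split.
- by move=> x; exact: m.
- by move=> x; exact: a.
move=> _ _ [t Bt <-] [u Bu <-] I j.
exact: (smooth_val (W := W) (s t u Bt Bu I j)).
Qed.

Definition res_form (w : 'Omega^k(A, E)) : 'Omega^k(A \|_ W, E \|_ W) :=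
  MkForm (res_form_subproof w).

End Val.

Section Incl.
Variables (W' W : opens M) (sW : W' `<=` W).

Fact res_incl_subproof (w : 'Omega^k(A \|_ W, E \|_ W)) :
  ((fun (x : open_mfd W') v => w (incl sW x) v) : form_family (A \|_ W') (E \|_ W') k)
    \in is_form (A \|_ W') (E \|_ W') k.
Proof.
have /is_formP[m a s] := valP w; apply/is_formP; split.
- by move=> x; exact: (m (incl sW x)).
- by move=> x; exact: (a (incl sW x)).
move=> _ _ [t Bt <-] [u Bu <-] I j.
exact: (smooth_incl sW (s _ _ (imageP (open_triv W) Bt) (imageP (open_triv W) Bu) I j)).
Qed.

Definition res_incl (w : 'Omega^k(A \|_ W, E \|_ W)) : 'Omega^k(A \|_ W', E \|_ W') :=
  MkForm (res_incl_subproof w).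

End Incl.

Fact res_form_linear (W : opens M) : linear (res_form W).
Proof. by move=> a w w'; apply/val_inj. Qed.
HB.instance Definition _ W :=
  GRing.isLinear.Build R _ _ _ (res_form W) (res_form_linear W).

Fact res_incl_linear (W' W : opens M) (sW : W' `<=` W) : linear (res_incl sW).
Proof. by move=> a w w'; apply/val_inj. Qed.
HB.instance Definition _ (W' W : opens M) (sW : W' `<=` W) :=
  GRing.isLinear.Build R _ _ _ (res_incl sW) (res_incl_linear sW).

End RestrictForms.

Section LineBundle.
Variables (R : realType) (n : nat) (M : manifold R n).

Let lfib (x : M) : lmodType R := R^o.

Definition line_triv : triv lfib 1 :=
  @Triv _ M lfib 1 setT (fun _ (a : R^o) => const_mx a) (fun _ v => v 0 0).

Fact line_atlas : is_triv_atlas [set line_triv].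
Proof.
split => [_ ->|x|_ _ -> -> i j].
- split; first exact: openT.
  move=> x _; split => [c a b|a|v] /=.
  + by apply/matrixP => i j; rewrite !mxE.
  + by rewrite mxE.
  + by apply/matrixP => i j; rewrite !mxE !ord1.
- by exists line_triv.
apply: smooth_ext (smooth_cst _ ((delta_mx 0 i : 'rV[R]_1) 0 0)) => x _.
by rewrite /= [RHS]mxE.
Qed.

Definition line_bundle : vbundle M 1 := VBundle line_atlas.

Fact sect_smooth (s : 'Gamma(line_bundle)) : (s : M -> R) \in smooth_pred M.
Proof.
have /asboolP/(_ line_triv erefl 0) ss := valP s; apply/smooth_predP.
by apply: smooth_ext ss => x _; rewrite mxE.
Qed.

Definition sect_C (s : 'Gamma(line_bundle)) : 'C^oo(M) := SmoothFun (sect_smooth s).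

End LineBundle.

Notation "''Omega^' k ( A )" := (Form A (line_bundle _) k)
  (at level 8, k at level 2, format "''Omega^' k ( A )").

Section Wedge.
Variables (R : realType) (n : nat) (M : manifold R n).
Variables (rA rE : nat) (A : vbundle M rA) (E : vbundle M rE) (p q : nat).
Variables (w : 'Omega^p(A)) (h : 'Omega^q(A, E)).

(* No 1 / (p + q)! here: with this normalisation d_A, given by the Koszul formula
   without denominators, is a derivation. *)
Definition wedge_fun : form_family A E (p + q) := fun x v =>
  ((p`! * q`!)%:R : R)^-1 *: \sum_(s : 'S_(p + q)) (-1) ^+ s *:
    ((w x (fun i => v (s (lshift q i))) : R) *: h x (fun j => v (s (rshift p j)))).

Fact wedge_subproof : wedge_fun \in is_form A E (p + q).
Proof.
have /is_formP[mw aw sw] := valP w; have /is_formP[mh ah sh] := valP h.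
have {}mw x : multilinear (w x) := mw x; have {}mh x : multilinear (h x) := mh x.
apply/is_formP; split.
- move=> x v i c a b; rewrite /wedge_fun.
  rewrite (scalerA c) (mulrC c) -scalerA -scalerDr; congr (_ *: _).
  rewrite scaler_sumr -big_split /=; apply: eq_bigr => s _.
  rewrite (scalerA c) (mulrC c) -scalerA -scalerDr; congr (_ *: _).
  have [[l El]|[l El]] : (exists l, s (lshift q l) = i) \/ (exists l, s (rshift p l) = i).
    by case: (split_ordP ((s^-1)%g i)) => l E1; [left|right]; exists l; rewrite -E1 permKV.
  + have E1 (d : A x) : (fun j => upd v i d (s (lshift q j))) =
       upd (fun j => v (s (lshift q j))) l d.
      apply/funext => j; rewrite /upd -El (inj_eq perm_inj).
      by rewrite (inj_eq (@lshift_inj _ _)).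
    have E2 (d : A x) : (fun j => upd v i d (s (rshift p j))) =
       (fun j => v (s (rshift p j))).
      by apply/funext => j; rewrite /upd -El (inj_eq perm_inj) eq_rlshift.
    by rewrite !E1 !E2 (mw x) scalerDl scalerA.
  + have E1 (d : A x) : (fun j => upd v i d (s (rshift p j))) =
       upd (fun j => v (s (rshift p j))) l d.
      apply/funext => j; rewrite /upd -El (inj_eq perm_inj).
      by rewrite (inj_eq (@rshift_inj _ _)).
    have E2 (d : A x) : (fun j => upd v i d (s (lshift q j))) =
       (fun j => v (s (lshift q j))).
      by apply/funext => j; rewrite /upd -El (inj_eq perm_inj) eq_lrshift.
    by rewrite !E1 !E2 (mh x) scalerDr !scalerA [_ * c]mulrC.
- move=> x v i j ij vij; rewrite /wedge_fun.
  pose F (s : 'S_(p + q)) := (-1) ^+ s *: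
    ((w x (fun i => v (s (lshift q i))) : R) *: h x (fun j => v (s (rshift p j)))).
  suff F0 : \sum_(s : 'S_(p + q)) F s = 0 by rewrite -/F F0 scaler0.
  have vt l : v (tperm i j l) = v l by case: tpermP => // ->.
  have FN s : F (s * tperm i j)%g = - F s.
    rewrite /F odd_permM odd_tperm ij signr_addb mulrN1 scaleNr; congr (- (_ *: (_ *: _))).
      by congr (w x _); apply/funext => l; rewrite permM vt.
    by congr (h x _); apply/funext => l; rewrite permM vt.
  rewrite (bigID (fun s : 'S_(p + q) => odd_perm s)) /=.
  rewrite [X in _ + X](reindex_inj (mulIg (tperm i j))) /=.
  rewrite [X in _ + X](eq_bigl (fun s : 'S_(p + q) => odd_perm s)); last first.
    by move=> s; rewrite odd_permM odd_tperm ij addbT negbK.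
  by rewrite [X in _ + X](eq_bigr (fun s => - F s)) ?sumrN ?subrr.
move=> t u Bt Bu I j.
set D := _ `&` _; have oD : open D by apply: openI; exact: triv_open.
have S s : smooth M D (fun x => ((-1) ^+ odd_perm s *
    (w x (fun i => tframe t x (delta_mx 0 (I (s (lshift q i))))) : R)) *
    tcoord u (h x (fun i => tframe t x (delta_mx 0 (I (s (rshift p i)))))) 0 j).
  apply: smoothM => //; last exact: (sh t u Bt Bu (fun i => I (s (rshift p i))) j).
  apply: smoothM => //; first exact: smooth_cst.
  have := sw t (line_triv M) Bt erefl (fun i => I (s (lshift q i))) 0.
  move=> /(smooth_sub _) sD; apply: smooth_ext (sD D _) => [x _|x [tx _]//].
  by rewrite /= mxE.
apply: smooth_ext (smoothM oD (smooth_cst _ ((p`! * q`!)%:R^-1 : R))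
  (smooth_sum (index_enum 'S_(p + q)) xpredT oD S)) => x [tx ux].
rewrite /wedge_fun -[X in tcoord u X]addr0 coordD// coord0// addr0; congr (_ * _).
under [in RHS]eq_bigr do rewrite scalerA.
by rewrite coord_sum.
Qed.

Definition wedge : 'Omega^(p + q)(A, E) := MkForm wedge_subproof.

End Wedge.

Section LieAlgebroid.
Variables (R : realType) (n : nat) (M : manifold R n).

(* The tangent space at x is the space of derivations of C^oo(M) at x. *)
Definition is_tangent (x : M) (v : 'C^oo(M) -> R) :=
  (forall a f g, v (a *: f + g) = a * v f + v g) /\
  (forall f g, v (f * g) = f x * v g + g x * v f).

(* A fibrewise linear map A -> TM is smooth when it maps smooth sections to
   smooth vector fields, i.e., to vector fields mapping smooth functions to
   smooth functions. *)
Record lie_algebroid (r : nat) (A : vbundle M r) := LieAlgebroid {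
  bracket : 'Gamma(A) -> 'Gamma(A) -> 'Gamma(A);
  anchor : forall x, A x -> 'C^oo(M) -> R;
  anchor_tangent : forall x (v : A x), is_tangent x (anchor v);
  anchor_linear : forall x c (v w : A x) f,
    anchor (c *: v + w) f = c * anchor v f + anchor w f;
  anchor_smooth : forall (a : 'Gamma(A)) f,
    (fun x => anchor (a x) f) \in smooth_pred M;
  bracket_linearl : forall b, linear (bracket^~ b);
  bracket_linearr : forall a, linear (bracket a);
  bracket_alt : forall a, bracket a a = 0;
  bracket_jacobi : forall a b c,
    bracket a (bracket b c) + bracket b (bracket c a) + bracket c (bracket a b) = 0;
  bracket_leibniz : forall a b f,
    bracket a (fscale f b) =
      fscale f (bracket a b) + fscale (SmoothFun (anchor_smooth a f)) b
}.

Definition rho (r : nat) (A : vbundle M r) (L : lie_algebroid A) (a : 'Gamma(A))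
  (f : 'C^oo(M)) : 'C^oo(M) := SmoothFun (anchor_smooth L a f).

Variables (rA rE : nat) (A : vbundle M rA) (E : vbundle M rE).

Definition representation (L : lie_algebroid A)
    (nabla : 'Gamma(A) -> 'Gamma(E) -> 'Gamma(E)) : Prop :=
  [/\ (forall e, linear (nabla^~ e)) /\ (forall a, linear (nabla a)),
      (forall f a e, nabla (fscale f a) e = fscale f (nabla a e)),
      (forall a f e, nabla a (fscale f e) =
         fscale f (nabla a e) + fscale (rho L a f) e) &
      (forall a1 a2 e, nabla a1 (nabla a2 e) - nabla a2 (nabla a1 e) =
         nabla (bracket L a1 a2) e)].

Fact zero_tangent x (v : A x) : is_tangent x (fun _ : 'C^oo(M) => 0).
Proof. by split=> *; rewrite ?mulr0 addr0. Qed.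

Fact zero_anchor_smooth (a : 'Gamma(A)) (f : 'C^oo(M)) :
  (fun x : M => 0 : R) \in smooth_pred M.
Proof. exact: rpred0. Qed.

Definition zero_lie_algebroid : lie_algebroid A.
Proof.
refine (@LieAlgebroid _ A (fun _ _ => 0) (fun x _ _ => 0) zero_tangent _ zero_anchor_smooth _ _ _ _ _).
- by move=> *; rewrite mulr0 addr0.
- by move=> b c a a'; rewrite scaler0 addr0.
- by move=> b c a a'; rewrite scaler0 addr0.
- by [].
- by move=> *; rewrite !addr0.
move=> a b f; apply/val_inj/functional_extensionality_dep => x /=.
by rewrite /sect_fun /= [X in _ = X + _](scaler0) [X in _ = _ + X](scale0r) addr0.
Defined.

End LieAlgebroid.

(* Definite description: below it is only applied to predicates satisfied by
   exactly one object; the default [x0] is never reached then. *)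
Definition definite (T : Type) (x0 : T) (P : T -> Prop) : T :=
  if pselect (exists x, P x) is left e then projT1 (cid e) else x0.

Section Restriction.
Variables (R : realType) (n : nat) (M : manifold R n) (rA rE : nat).
Variables (A : vbundle M rA) (E : vbundle M rE) (L : lie_algebroid A).
Variable nabla : 'Gamma(A) -> 'Gamma(E) -> 'Gamma(E).
Variable W : opens M.

(* The Lie algebroid structure of A|_W is the one for which restriction of
   sections preserves brackets and whose anchor is that of A, a tangent vector of
   W acting on f|_W as its image under the inclusion acts on f. Brackets are local
   operators, which makes it unique. *)
Definition restricts_lie (K : lie_algebroid (A \|_ W)) :=
  (forall a b, bracket K (res_sect W a) (res_sect W b) = res_sect W (bracket L a b)) /\
  (forall (x : open_mfd W) (v : A (val x)) f,
     anchor K (x := x) v (res_fun W f) = anchor L v f).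

Definition res_lie : lie_algebroid (A \|_ W) :=
  definite (zero_lie_algebroid _) restricts_lie.

Definition restricts_rep (D : 'Gamma(A \|_ W) -> 'Gamma(E \|_ W) -> 'Gamma(E \|_ W)) :=
  representation res_lie D /\
  (forall a e, D (res_sect W a) (res_sect W e) = res_sect W (nabla a e)).

Definition res_rep : 'Gamma(A \|_ W) -> 'Gamma(E \|_ W) -> 'Gamma(E \|_ W) :=
  definite (fun _ _ => 0) restricts_rep.

End Restriction.

Arguments res_lie {R n M rA A} L W.
Arguments res_rep {R n M rA rE A E} L nabla W a e.

Section Differentials.
Variables (R : realType) (n : nat) (M : manifold R n) (rA rE : nat).
Variables (A : vbundle M rA) (E : vbundle M rE) (L : lie_algebroid A).

(* The arguments [a_i, a_j], a_0, .., a_k with a_i and a_j left out (i < j). *)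
Definition koszul_args k (a : 'I_k.+1 -> 'Gamma(A)) (i j : 'I_k.+1) : 'I_k -> 'Gamma(A) :=
  fun l => if (l : nat) is l'.+1 then a (inord (bump j (bump i l')))
           else bracket L (a i) (a j).

Definition is_koszul k (w : 'Omega^k(A)) (dw : 'Omega^k.+1(A)) :=
  forall (a : 'I_k.+1 -> 'Gamma(A)) (x : M),
    (dw x (fun i => a i x) : R) =
      \sum_(i < k.+1) (-1) ^+ i *
         rho L (a i) (sect_C (contract w (fun l => a (lift i l)))) x +
      \sum_(i < k.+1) \sum_(j < k.+1 | (i < j)%N) (-1) ^+ (i + j) *
         contract w (koszul_args a i j) x.

Definition d_A k (w : 'Omega^k(A)) : 'Omega^k.+1(A) := definite 0 (is_koszul w).

Variable nabla : 'Gamma(A) -> 'Gamma(E) -> 'Gamma(E).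

(* A 0-form has no argument to be evaluated at. *)
Definition section_of_form0 (e : 'Omega^0(A, E)) : 'Gamma(E) := contract e (fun=> 0).

(* The cast identifies degree p + q.+1 with (p + q).+1. *)
Definition is_d_nabla (D : forall k, {linear 'Omega^k(A, E) -> 'Omega^k.+1(A, E)}) :=
  (forall (e : 'Omega^0(A, E)) (a : 'Gamma(A)) (x : M),
     D 0%N e x (fun=> a x) = nabla a (section_of_form0 e) x) /\
  (forall p q (w : 'Omega^p(A)) (h : 'Omega^q(A, E)) x v,
     D (p + q)%N (wedge w h) x v =
       wedge (d_A w) h x v +
       (-1) ^+ p *: wedge w (D q h) x (fun i => v (cast_ord (addnS p q) i))).

Definition d_nabla : forall k, {linear 'Omega^k(A, E) -> 'Omega^k.+1(A, E)} :=
  definite (fun k => \0 : {linear _ -> _}) is_d_nabla.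

End Differentials.

(* d \o d = 0 is not required: the coboundaries that are quotiented out are the
   cocycles that lie in the image of d. *)
Section Cohomology.
Variables (R : pzRingType) (C : nat -> lmodType R).
Variable d : forall k, {linear C k -> C k.+1}.

Definition cocycle k : {pred C k} := fun x => d k x == 0.

Fact cocycle_submod k : submod_closed (@cocycle k).
Proof.
split; first by rewrite unfold_in /cocycle linear0.
by move=> a x y /eqP dx /eqP dy; rewrite unfold_in /cocycle linearP dx dy scaler0 addr0.
Qed.
HB.instance Definition _ k := GRing.isSubmodClosed.Build R _ (@cocycle k) (cocycle_submod k).

Record Cocycle k := MkCocycle {
  cocycle_val : C k;
  _ : cocycle_val \in @cocycle k
}.
HB.instance Definition _ k := [isSub of Cocycle k for @cocycle_val k].
HB.instance Definition _ k := [Choice of Cocycle k by <:].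
HB.instance Definition _ k := [SubChoice_isSubLmodule of Cocycle k by <:].

(* There is no coboundary but 0 in degree 0. *)
Definition coboundary k : {pred Cocycle k} :=
  if k is k'.+1 return {pred Cocycle k}
  then fun z => `[< exists y, d k' y = val z >]
  else fun z => z == 0.

Fact coboundary_submod k : submod_closed (@coboundary k).
Proof.
case: k => [|k]; split; rewrite ?unfold_in //=.
- by move=> a x y /eqP-> /eqP->; rewrite unfold_in scaler0 addr0.
- by apply/asboolP; exists 0; rewrite linear0.
move=> a x y /asboolP[u du] /asboolP[v dv]; apply/asboolP.
by exists (a *: u + v); rewrite linearP du dv.
Qed.
HB.instance Definition _ k :=
  GRing.isSubmodClosed.Build R _ (@coboundary k) (coboundary_submod k).

Definition cohomology k := Quotient.quot (@coboundary k).
HB.instance Definition _ k := GRing.Zmodule.on (cohomology k).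

Definition cls k (z : Cocycle k) : cohomology k := \pi_(Quotient.quot (@coboundary k))%qT z.

Fact clsP k (y z : Cocycle k) : (cls y = cls z) <-> (y - z \in @coboundary k).
Proof. by rewrite Quotient.idealrBE; split => [/eqP|/eqP]. Qed.

Let clsD k (y z : Cocycle k) : cls (y + z) = cls y + cls z.
Proof. exact: raddfD. Qed.

Let scale k (a : R) (y : cohomology k) : cohomology k :=
  cls (a *: (generic_quotient.repr y : Cocycle k)).

Let cls_repr k (y : cohomology k) : cls (generic_quotient.repr y) = y.
Proof. exact: reprK. Qed.

Let cls_scale k a (z : Cocycle k) : cls (a *: z) = scale a (cls z).
Proof.
apply/clsP; rewrite -scalerBr; apply: rpredZ.
by apply/clsP; rewrite cls_repr.
Qed.

Let scaleA k a b (y : cohomology k) : scale a (scale b y) = scale (a * b) y.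
Proof. by rewrite -[y]cls_repr -!cls_scale scalerA. Qed.
Let scale1 k : left_id 1 (@scale k).
Proof. by move=> y; rewrite -[y in LHS]cls_repr -cls_scale scale1r cls_repr. Qed.
Let scaleDr k : right_distributive (@scale k) +%R.
Proof.
by move=> a y z; rewrite -[y]cls_repr -[z]cls_repr -clsD -!cls_scale -clsD scalerDr.
Qed.
Let scaleDl k (y : cohomology k) : {morph (@scale k)^~ y : a b / a + b}.
Proof. by move=> a b; rewrite -[y]cls_repr -!cls_scale -clsD scalerDl. Qed.
HB.instance Definition _ k :=
  GRing.Zmodule_isLmodule.Build R (cohomology k) (@scaleA k) (@scale1 k) (@scaleDr k) (@scaleDl k).

Lemma cls_linear k : linear (@cls k).
Proof. by move=> a y z; rewrite clsD cls_scale. Qed.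

End Cohomology.

Section MayerVietoris.
Variables (R : realType) (n : nat) (M : manifold R n) (rA rE : nat).
Variables (A : vbundle M rA) (E : vbundle M rE).

Definition d_on (L : lie_algebroid A) (nabla : 'Gamma(A) -> 'Gamma(E) -> 'Gamma(E))
    (W : opens M) : forall k, {linear 'Omega^k(A \|_ W, E \|_ W) ->
                                      'Omega^k.+1(A \|_ W, E \|_ W)} :=
  d_nabla (res_lie L W) (res_rep L nabla W).

Variables U V : opens M.

Definition j0 : opensI U V `<=` U := @subIsetl _ U V.
Definition j1 : opensI U V `<=` V := @subIsetr _ U V.

Variable k : nat.

(* i^* *)
Definition mv_i (w : 'Omega^k(A, E)) :
    ('Omega^k(A \|_ U, E \|_ U) * 'Omega^k(A \|_ V, E \|_ V))%type :=
  (res_form U w, res_form V w).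

(* j_1^* - j_0^* *)
Definition mv_j (w : 'Omega^k(A \|_ U, E \|_ U) * 'Omega^k(A \|_ V, E \|_ V)) :
    'Omega^k(A \|_ (opensI U V), E \|_ (opensI U V)) :=
  res_incl j1 w.2 - res_incl j0 w.1.

Fact mv_i_linear : linear mv_i.
Proof. by move=> a w w'; rewrite /mv_i !linearP. Qed.
HB.instance Definition _ := GRing.isLinear.Build R _ _ _ mv_i mv_i_linear.

Fact mv_j_linear : linear mv_j.
Proof.
move=> a [w1 w2] [w1' w2']; rewrite /mv_j /= !linearP /= scalerBr.
by rewrite scalerN addrACA.
Qed.
HB.instance Definition _ := GRing.isLinear.Build R _ _ _ mv_j mv_j_linear.

End MayerVietoris.

Arguments mv_i {R n M rA rE} A E U V k w.
Arguments mv_j {R n M rA rE} A E U V k w.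

Definition exact_pair (X Y Z : zmodType) (f : X -> Y) (g : Y -> Z) :=
  forall y, g y = 0 <-> exists x, f x = y.

Section PartitionOfUnity.
Variables (R : realType) (n : nat) (M : manifold R n).

Definition support (f : M -> R) : set M := closure [set x | f x != 0].

Definition partition_of_unity (U V : opens M) (muU muV : 'C^oo(M)) :=
  [/\ forall x, 0 <= muU x, forall x, 0 <= muV x,
      forall x, muU x + muV x = 1,
      support muU `<=` U & support muV `<=` V].

(* [h] is [mu w], defined on W', extended by zero to W. *)
Definition zero_extension (rA rE : nat) (A : vbundle M rA) (E : vbundle M rE) k
    (W' W : opens M) (sW : W' `<=` W) (mu : 'C^oo(M))
    (w : 'Omega^k(A \|_ W', E \|_ W')) (h : 'Omega^k(A \|_ W, E \|_ W)) :=
  (forall (x : open_mfd W') v, h (incl sW x) v = mu (val x) *: w x v) /\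
  (forall (x : open_mfd W) v, ~ oset W' (val x) -> h x v = 0).

End PartitionOfUnity.

(* Main.v *)
Require Import Defs.
From HB Require Import structures.
From mathcomp Require Import all_boot all_order fingroup perm all_algebra.
From mathcomp Require Import all_classical all_reals all_analysis.
From mathcomp Require Import ring lra.
Set Implicit Arguments.
Unset Strict Implicit.
Unset Printing Implicit Defensive.
Import Order.TTheory GRing.Theory Num.Theory.
Import numFieldNormedType.Exports.
Import Defs.
Local Open Scope classical_set_scope.
Local Open Scope ring_scope.

(* Sections of A and E form a Lie-Rinehart pair over C^oo(M), and forms are the alternating
   C^oo(M)-multilinear maps on sections: bump functions extend germs and vectors to global
   sections, which makes such maps tensorial. On these maps the differential is defined by
   Cartan's formula iota_a d = L_a - d iota_a, and by induction on the degree, contracting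
   with one section at a time, this formula yields the Leibniz rule, d o d = 0 and the
   Koszul formula. A solution of the equations characterising d_nabla is unique because
   forms are locally sums of products of scalar forms and sections, and it is local, so it
   commutes with restrictions. A partition of unity, which exists since M is second
   countable, makes j_1^* - j_0^* surjective, and the rest is the snake lemma. *)

(** The operators [d_A], [d_nabla], [res_lie] and [res_rep] are definite descriptions, so nothing is
    known about them before an object with the describing property has been built. For [d_nabla]
    uniqueness is needed as well: its description fixes the values on 0-forms and on wedge products
    only, and must be shown to force the Koszul differential on every form. The descriptions of
    [res_lie] and [res_rep] fix values on restrictions of global objects, while a section over an
    open [W] need not be such a restriction, since it may blow up at the boundary. Arguments over
    [W] therefore pass through germs: near a given point a section, function or form agrees with a
    global one, and all the operators are local. *)

Section AbelianGroupReflection.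
Variable V : zmodType.

Inductive zexp := ZVar of nat | ZZero | ZAdd of zexp & zexp | ZOpp of zexp.

Fixpoint zeval (env : seq V) e : V :=
  match e with
  | ZVar i => env`_i
  | ZZero => 0
  | ZAdd a b => zeval env a + zeval env b
  | ZOpp a => - zeval env a
  end.

Fixpoint zcoef e (i : nat) : int :=
  match e with
  | ZVar j => (i == j)%:R
  | ZZero => 0
  | ZAdd a b => zcoef a i + zcoef b i
  | ZOpp a => - zcoef a i
  end.

Lemma zevalE env e : zeval env e = \sum_(i < size env) env`_i *~ zcoef e i.
Proof.
elim: e => [j||a IHa b IHb|a IH] /=.
- have [js|js] := ltnP j (size env).
    rewrite (bigD1 (Ordinal js)) //= eqxx mulr1z big1 ?addr0 // => i /negPf ij.
    by rewrite (_ : (i == j :> nat) = false) ?mulr0z // -ij.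
  rewrite nth_default // big1 // => i _.
  by rewrite (_ : (i == j :> nat) = false) ?mulr0z // ltn_eqF // (leq_trans _ js).
- by rewrite big1 // => i _; rewrite mulr0z.
- by rewrite IHa IHb -big_split; apply: eq_bigr => i _; rewrite mulrzDr.
- by rewrite IH -sumrN; apply: eq_bigr => i _; rewrite mulrNz.
Qed.

(** An index beyond the end of [env] evaluates to 0, so only the coefficients below [size env]
    count. For reified terms the hypothesis is a closed boolean that computes to [true]. *)
Lemma zeval_eq env e f :
  [seq zcoef e i | i <- iota 0 (size env)] == [seq zcoef f i | i <- iota 0 (size env)] ->
  zeval env e = zeval env f.
Proof.
move=> /eqP /eq_in_map E; rewrite !zevalE; apply: eq_bigr => i _.
by rewrite E // mem_iota /= add0n.
Qed.

End AbelianGroupReflection.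

(** Atoms are compared by [unify], that is, up to conversion: [iota_l a F s] and [F (a :: s)] are
    one atom. *)
Ltac zindex x env :=
  match env with
  | ?y :: _ => let _ := match goal with _ => unify x y end in constr:(0%N)
  | _ :: ?t => let i := zindex x t in constr:(S i)
  end.

Ltac zinsert x env :=
  match env with
  | nil => constr:(x :: env)
  | ?y :: _ => let _ := match goal with _ => unify x y end in env
  | ?y :: ?t => let t := zinsert x t in constr:(y :: t)
  end.

Ltac zatoms t env :=
  lazymatch t with
  | 0 => env
  | ?a + ?b => let env := zatoms a env in zatoms b env
  | - ?a => zatoms a env
  | _ => zinsert t env
  end.

Ltac zreify t env :=
  lazymatch t with
  | 0 => constr:(ZZero)
  | ?a + ?b => let a := zreify a env in let b := zreify b env in constr:(ZAdd a b)
  | - ?a => let a := zreify a env in constr:(ZOpp a)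
  | _ => let i := zindex t env in constr:(ZVar i)
  end.

Ltac zmod :=
  lazymatch goal with
  | |- @eq ?T ?a ?b =>
    let env := zatoms a (@nil T) in
    let env := zatoms b env in
    let e := zreify a env in
    let f := zreify b env in
    exact: (@zeval_eq _ env e f isT)
  end.

(** * Cartan calculus for functions on lists *)

(* A form of degree p is a function on lists of vectors that vanishes off the lists of
   length p ([supp_l p]); keeping degrees out of the types avoids all casts. *)
Section ListForms.
Variables (C : comPzRingType) (G N : lmodType C).
Implicit Types (F H : seq G -> N) (s : seq G).

Definition iota_l (T : Type) (a : G) (F : seq G -> T) : seq G -> T := fun s => F (a :: s).

(** The degree involution, multiplication by (-1)^p on forms of degree p. Reading the sign off the
    length of the argument keeps p out of the definition. *)
Definition sgn_l F : seq G -> N := fun s => (-1) ^+ size s *: F s.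

Definition mlin F := forall s1 s2 f a b,
  F (s1 ++ (f *: a + b) :: s2) = f *: F (s1 ++ a :: s2) + F (s1 ++ b :: s2).

(** Adjacent equal entries are what inductions on lists meet; [altl_args] recovers arbitrary
    positions. *)
Definition altl F := forall s1 s2 a, F (s1 ++ a :: a :: s2) = 0.

Definition supp_l (p : nat) F := forall s, size s != p -> F s = 0.

Lemma mlin_iota a F : mlin F -> mlin (iota_l a F).
Proof. by move=> mF s1 s2 f b c; exact: (mF (a :: s1)). Qed.

Lemma altl_iota a F : altl F -> altl (iota_l a F).
Proof. by move=> mF s1 s2 b; exact: (mF (a :: s1)). Qed.

Lemma supp_iota p a F : supp_l p.+1 F -> supp_l p (iota_l a F).
Proof. by move=> sF s ps; apply: sF. Qed.

Lemma supp0_iota a F : supp_l 0 F -> iota_l a F = fun=> 0.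
Proof. by move=> sF; apply/funext => s; apply: sF. Qed.

Lemma mlinD F s1 s2 a b : mlin F ->
  F (s1 ++ (a + b) :: s2) = F (s1 ++ a :: s2) + F (s1 ++ b :: s2).
Proof. by move=> mF; have := mF s1 s2 1 a b; rewrite !scale1r. Qed.

Lemma mlin0 F s1 s2 : mlin F -> F (s1 ++ 0 :: s2) = 0.
Proof.
move=> mF; have := mF s1 s2 (-1) 0 0; rewrite scaler0 addr0 => ->.
by rewrite scaleN1r addNr.
Qed.

Lemma mlinZ F s1 s2 f a : mlin F ->
  F (s1 ++ f *: a :: s2) = f *: F (s1 ++ a :: s2).
Proof. by move=> mF; have := mF s1 s2 f a 0; rewrite addr0 (mlin0 _ _ mF) addr0. Qed.

Lemma mlinN F s1 s2 a : mlin F -> F (s1 ++ - a :: s2) = - F (s1 ++ a :: s2).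
Proof. by move=> mF; rewrite -scaleN1r (mlinZ _ _ _ _ mF) scaleN1r. Qed.

(** Polarisation: expand the value at the repeated entry [a + b]. *)
Lemma altl_swap F s1 s2 a b : mlin F -> altl F ->
  F (s1 ++ a :: b :: s2) = - F (s1 ++ b :: a :: s2).
Proof.
move=> mF aF; have := aF s1 s2 (a + b).
rewrite (mlinD s1 ((a + b) :: s2) _ _ mF) -!(cat_rcons _ s1).
rewrite !(mlinD _ _ _ _ mF) !cat_rcons !aF add0r addr0.
by move/eqP; rewrite addr_eq0 => /eqP.
Qed.

Lemma altl_front F s1 s2 a : mlin F -> altl F ->
  F (s1 ++ a :: s2) = (-1) ^+ size s1 *: F (a :: s1 ++ s2).
Proof.
move=> mF aF; elim/last_ind: s1 s2 => [|s1 b IH] s2; first by rewrite scale1r.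
rewrite cat_rcons (altl_swap _ _ _ _ mF aF) IH -(cat_rcons b) size_rcons exprS mulN1r scaleNr.
by rewrite cat_rcons.
Qed.

Lemma sgnK F : sgn_l (sgn_l F) = F.
Proof.
by apply/funext => s; rewrite /sgn_l scalerA -signr_odd -signr_addb addbb scale1r.
Qed.

Lemma iota_sgn a F s : iota_l a (sgn_l F) s = - sgn_l (iota_l a F) s.
Proof. by rewrite /iota_l /sgn_l /= exprS mulN1r scaleNr. Qed.

End ListForms.

Section LieAndDifferential.
Variables (C : comPzRingType) (G N : lmodType C).
Variables (br : G -> G -> G) (rho : G -> C -> C) (nabla : G -> N -> N).
Implicit Types (F H : seq G -> N) (s : seq G).

(** The Lie derivative: the commutation rule [[L_a, iota_b] = iota_[a,b]] read as a recursion on the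
    first argument. *)
Fixpoint lie a F s : N :=
  if s is b :: s' then lie a (iota_l b F) s' - F (br a b :: s') else nabla a (F [::]).

(* Cartan's formula [iota_a d = L_a - d iota_a] taken as a definition. *)
Fixpoint koszul_d F s : N :=
  if s is a :: s' then lie a F s' - koszul_d (iota_l a F) s' else 0.

(* [df /\ F] *)
Fixpoint dfw (f : C) F s : N :=
  if s is b :: s' then rho b f *: F s' - dfw f (iota_l b F) s' else 0.

Hypothesis nablaB : forall a e e', nabla a (e - e') = nabla a e - nabla a e'.
Hypothesis nablaM : forall a f e, nabla a (f *: e) = f *: nabla a e + rho a f *: e.
Hypothesis nablal : forall f a b e, nabla (f *: a + b) e = f *: nabla a e + nabla b e.
Hypothesis brD : forall a b c, br a (b + c) = br a b + br a c.
Hypothesis brM : forall a f b, br a (f *: b) = f *: br a b + rho a f *: b.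
Hypothesis brC : forall a b, br a b = - br b a.
Hypothesis br_alt : forall a, br a a = 0.

Lemma nabla0 a : nabla a 0 = 0.
Proof. by rewrite -(subrr 0) nablaB !subrr. Qed.

Lemma lieB a F H s : lie a (fun t => F t - H t) s = lie a F s - lie a H s.
Proof.
elim: s F H => [|b s IH] F H /=; first exact: nablaB.
by rewrite IH; zmod.
Qed.

Lemma lie0 a s : lie a (fun=> 0) s = 0.
Proof. by have := lieB a (fun=> 0) (fun=> 0) s; rewrite subrr => ->; rewrite subrr. Qed.

Lemma lieN a F s : lie a (fun t => - F t) s = - lie a F s.
Proof.
rewrite -[RHS]sub0r -(lie0 a s) -lieB; congr (lie _ _ _).
by apply/funext => t; rewrite sub0r.
Qed.

Lemma lieD a F H s : lie a (fun t => F t + H t) s = lie a F s + lie a H s.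
Proof.
rewrite -[X in _ = _ + X]opprK -lieN -lieB; congr (lie _ _ _).
by apply/funext => t; rewrite opprK.
Qed.

Lemma lieZ a f F s : lie a (fun t => f *: F t) s = f *: lie a F s + rho a f *: F s.
Proof.
elim: s F => [|b s IH] F /=; first exact: nablaM.
by rewrite IH addrAC -scalerBr.
Qed.

Lemma lie_sgn a F : lie a (sgn_l F) = sgn_l (lie a F).
Proof.
apply/funext => s; elim: s F => [|b s IH] F /=.
  by rewrite /sgn_l /= !scale1r.
rewrite (_ : iota_l b (sgn_l F) = fun t => - sgn_l (iota_l b F) t); last first.
  by apply/funext => t; rewrite iota_sgn.
rewrite lieN IH /sgn_l /= exprS mulN1r !scaleNr scalerBr opprB opprK addrC.
by [].
Qed.

Lemma koszul_dB F H s : koszul_d (fun t => F t - H t) s = koszul_d F s - koszul_d H s.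
Proof.
elim: s F H => [|a s IH] F H /=; first by rewrite subr0.
by rewrite lieB IH; zmod.
Qed.

Lemma koszul_d0 s : koszul_d (fun=> 0) s = 0.
Proof. by have := koszul_dB (fun=> 0) (fun=> 0) s; rewrite subrr => ->; rewrite subrr. Qed.

Lemma koszul_dN F s : koszul_d (fun t => - F t) s = - koszul_d F s.
Proof.
rewrite -[RHS]sub0r -(koszul_d0 s) -koszul_dB; congr (koszul_d _ _).
by apply/funext => t; rewrite sub0r.
Qed.

Lemma koszul_dD F H s : koszul_d (fun t => F t + H t) s = koszul_d F s + koszul_d H s.
Proof.
rewrite -[X in _ = _ + X]opprK -koszul_dN -koszul_dB; congr (koszul_d _ _).
by apply/funext => t; rewrite opprK.
Qed.

Lemma koszul_d_sgn F : koszul_d (sgn_l F) = fun s => - sgn_l (koszul_d F) s.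
Proof.
apply/funext => s; elim: s F => [|a s IH] F /=.
  by rewrite /sgn_l /= scaler0 oppr0.
rewrite (_ : iota_l a (sgn_l F) = fun t => - sgn_l (iota_l a F) t); last first.
  by apply/funext => t; rewrite iota_sgn.
rewrite koszul_dN IH lie_sgn opprK /sgn_l /= exprS mulN1r scaleNr opprK scalerBr.
by [].
Qed.

Lemma dfwN f F s : dfw f (fun t => - F t) s = - dfw f F s.
Proof.
elim: s F => [|b s IH] F /=; first by rewrite oppr0.
by rewrite IH scalerN opprK opprB addrC.
Qed.

Lemma koszul_dZ f F s : koszul_d (fun t => f *: F t) s = f *: koszul_d F s + dfw f F s.
Proof.
elim: s F => [|b s IH] F /=; first by rewrite scaler0 addr0.
by rewrite lieZ IH scalerBr opprD addrACA.
Qed.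

(** The correction [df /\ iota_a F] comes from the anchor term of [[f a, c] = f [a, c] - rho(c)(f)
    a]. It cancels the one in [koszul_dZ], which makes [koszul_d F] linear over [C] in its first
    argument. *)
Lemma lieZl f a b F s : mlin F -> altl F ->
  lie (f *: a + b) F s = f *: lie a F s + lie b F s + dfw f (iota_l a F) s.
Proof.
elim: s F => [|c s IH] F mF aF /=; first by rewrite nablal addr0.
have E : br (f *: a + b) c = f *: br a c + (- rho c f *: a + br b c).
  rewrite brC brD brM opprD opprD -brC -scalerN -brC scaleNr addrA.
  by [].
rewrite IH; [|exact: mlin_iota|exact: altl_iota].
rewrite E (mF [::]) (mF [::]) /=.
have -> : dfw f (iota_l a (iota_l c F)) s = - dfw f (iota_l c (iota_l a F)) s.
  rewrite -dfwN; congr (dfw _ _ _); apply/funext => t.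
  exact: (altl_swap [::]).
by rewrite scalerBr scaleNr /iota_l; zmod.
Qed.

(** The derivative [rho a f] occurs twice with opposite signs: once from [lieZ] and once from the
    Leibniz rule of the bracket. *)
Lemma lie_mlin a F : mlin F -> mlin (lie a F).
Proof.
move=> mF s1 s2 f x y; elim: s1 F mF => [|c s1 IH] F mF /=.
  rewrite (_ : iota_l _ F = fun t => f *: iota_l x F t + iota_l y F t); last first.
    by apply/funext => t; exact: (mF [::]).
  rewrite lieD lieZ brD brM -[in F _]addrA (mF [::]) (mlinD [::] _ _ _ mF) (mlinZ [::] _ _ _ mF) /=.
  by rewrite /iota_l scalerBr; zmod.
rewrite IH; last exact: mlin_iota.
rewrite (mF (br a c :: s1)) /= opprD scalerBr.
by rewrite addrACA.
Qed.

Lemma lie_altl a F : mlin F -> altl F -> altl (lie a F).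
Proof.
move=> mF aF s1 s2 b; elim: s1 F mF aF => [|c s1 IH] F mF aF /=.
  rewrite (_ : iota_l b (iota_l b F) = fun=> 0); last first.
    by apply/funext => t; exact: (aF [::]).
  by rewrite lie0 sub0r /iota_l (altl_swap [::] _ _ _ mF aF) opprK subrr.
rewrite IH; [|exact: mlin_iota|exact: altl_iota].
by rewrite (aF (_ :: _)) subrr.
Qed.

Lemma koszul_d_mlin F : mlin F -> altl F -> mlin (koszul_d F).
Proof.
move=> mF aF s1 s2 f x y; elim: s1 F mF aF => [|c s1 IH] F mF aF /=.
  rewrite (_ : iota_l (f *: x + y) F = fun t => f *: iota_l x F t + iota_l y F t); last first.
    by apply/funext => t; exact: (mF [::]).
  by rewrite koszul_dD koszul_dZ lieZl // scalerBr; zmod.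
rewrite IH; [|exact: mlin_iota|exact: altl_iota].
by rewrite lie_mlin // scalerBr; zmod.
Qed.

Lemma koszul_d_altl F : mlin F -> altl F -> altl (koszul_d F).
Proof.
move=> mF aF s1 s2 b; elim: s1 F mF aF => [|c s1 IH] F mF aF /=.
  rewrite (_ : iota_l b (iota_l b F) = fun=> 0); last first.
    by apply/funext => t; exact: (aF [::]).
  rewrite koszul_d0 subr0 br_alt (mlin0 [::] _ mF) subr0 subrr.
  by [].
rewrite IH; [|exact: mlin_iota|exact: altl_iota].
by rewrite lie_altl // subrr.
Qed.

Lemma lie_supp p a F : supp_l p F -> supp_l p (lie a F).
Proof.
move=> sF s; elim: s p F sF => [|b s IH] p F sF /= sp.
  by rewrite sF // nabla0.
rewrite sF // subr0; case: p sF sp => [|p] sF sp.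
  by rewrite supp0_iota // lie0.
by apply: (IH p); [exact: supp_iota|].
Qed.

Lemma koszul_d_supp p F : supp_l p F -> supp_l p.+1 (koszul_d F).
Proof.
move=> sF s; elim: s p F sF => [|b s IH] p F sF //= sp.
rewrite (lie_supp _ sF) //; case: p sF sp => [|p] sF sp.
  by rewrite supp0_iota // koszul_d0 subrr.
by rewrite (IH p) ?subrr//; exact: supp_iota.
Qed.

Hypothesis jacobi : forall a b c, br a (br b c) - br b (br a c) = br (br a b) c.
Hypothesis flat : forall a b e, nabla a (nabla b e) - nabla b (nabla a e) = nabla (br a b) e.

Lemma lie_br a b F s : mlin F ->
  lie a (lie b F) s - lie b (lie a F) s = lie (br a b) F s.
Proof.
elim: s F => [|c s IH] F mF /=; first exact: flat.
have E (x : G) : iota_l c (lie x F) = fun t => lie x (iota_l c F) t - iota_l (br x c) F t by [].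
rewrite !E !lieB -IH; last exact: mlin_iota.
rewrite -jacobi (mlinD [::] _ _ _ mF) (mlinN [::] _ _ mF) /= !opprD !opprK.
by zmod.
Qed.

(** Cartan's formula on both sides leaves a commutator of Lie derivatives, which is [lie_br], and
    the same statement for the contracted form. *)
Lemma koszul_d_lie a F s : mlin F -> koszul_d (lie a F) s = lie a (koszul_d F) s.
Proof.
elim: s F => [|b s IH] F mF /=; first by rewrite nabla0.
have E (x c : G) : iota_l c (lie x F) = fun t => lie x (iota_l c F) t - iota_l (br x c) F t by [].
have E' (c : G) : iota_l c (koszul_d F) = fun t => lie c F t - koszul_d (iota_l c F) t by [].
rewrite !E !E' lieB koszul_dB IH; last exact: mlin_iota.
by rewrite -lie_br //; zmod.
Qed.

(** Cartan's formula used twice gives [iota_a d d = L_a d - d L_a + d d iota_a]; the difference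
    vanishes by [koszul_d_lie] and the last term by induction. *)
Lemma koszul_d_dK F s : mlin F -> koszul_d (koszul_d F) s = 0.
Proof.
elim: s F => [|a s IH] F mF //=.
have E' (c : G) : iota_l c (koszul_d F) = fun t => lie c F t - koszul_d (iota_l c F) t by [].
rewrite E' koszul_dB koszul_d_lie // IH; last exact: mlin_iota.
by rewrite subr0 subrr.
Qed.

End LieAndDifferential.

(** * The wedge product on lists and its Leibniz rules *)

Section Shuffle.
Variables (C : comPzRingType) (G N : lmodType C).
Implicit Types (F : seq G -> C^o) (H : seq G -> N) (s : seq G).

(* The sum over all ways of splitting s, of whatever sizes: the degrees of F and H select
   the relevant splittings. *)
Fixpoint shuffle F H s : N :=
  if s is a :: s' then shuffle (iota_l a F) H s' + shuffle (sgn_l F) (iota_l a H) s'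
  else (F [::] : C) *: H [::].

Lemma shuffleBl F F' H s :
  shuffle (fun t => F t - F' t) H s = shuffle F H s - shuffle F' H s.
Proof.
elim: s F F' H => [|a s IH] F F' H /=; first by rewrite scalerBl.
rewrite IH (_ : sgn_l _ = fun t => sgn_l F t - sgn_l F' t).
  by rewrite IH; zmod.
by apply/funext => t; rewrite /sgn_l scalerBr.
Qed.

Lemma shuffleBr F H H' s :
  shuffle F (fun t => H t - H' t) s = shuffle F H s - shuffle F H' s.
Proof.
elim: s F H H' => [|a s IH] F H H' /=; first by rewrite scalerBr.
by rewrite !IH; zmod.
Qed.

Lemma shuffle0l H s : shuffle (fun=> 0) H s = 0.
Proof.
by have := shuffleBl (fun=> 0) (fun=> 0) H s; rewrite subrr => ->; rewrite subrr.
Qed.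

Lemma shuffleNl F H s : shuffle (fun t => - F t) H s = - shuffle F H s.
Proof.
rewrite -[RHS]sub0r -(shuffle0l H s) -shuffleBl; congr (shuffle _ _ _).
by apply/funext => t; rewrite sub0r.
Qed.

Lemma shuffleZl c F H s : shuffle (fun t => c *: F t) H s = c *: shuffle F H s.
Proof.
elim: s F H => [|a s IH] F H /=; first by rewrite scalerA.
rewrite scalerDr -!IH; congr (_ + shuffle _ _ _); apply/funext => t.
by rewrite /sgn_l !scalerA mulrC.
Qed.

Lemma shuffle_small p F H s : supp_l p F -> (size s < p)%N -> shuffle F H s = 0.
Proof.
elim: s p F H => [|a s IH] [|p] F H sF //= sp; first by rewrite sF // scale0r.
rewrite (IH p) //; last exact: supp_iota.
rewrite (IH p.+1) ?addr0 //; first by move=> t tp; rewrite /sgn_l sF // scaler0.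
exact: ltnW.
Qed.

Lemma shuffle0r F s : shuffle F (fun=> 0) s = 0.
Proof.
by have := shuffleBr F (fun=> 0) (fun=> 0) s; rewrite subrr => ->; rewrite subrr.
Qed.

Lemma supp_sgn p F : supp_l p F -> supp_l p (sgn_l F).
Proof. by move=> sF t tp; rewrite /sgn_l sF // scaler0. Qed.

Lemma shuffle_supp p q F H : supp_l p F -> supp_l q H -> supp_l (p + q) (shuffle F H).
Proof.
move=> sF sH s; elim: s p q F H sF sH => [|a s IH] p q F H sF sH /= spq.
  case: p q sF sH spq => [|p] [|q] sF sH //= _; try by rewrite sF // scale0r.
  by rewrite sH // scaler0.
rewrite [X in X + _](_ : _ = 0) ?add0r.
  case: q sH spq => [|q] sH spq; first by rewrite (supp0_iota _ sH) shuffle0r.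
  apply: (IH p q); [exact: supp_sgn|exact: supp_iota|].
  by rewrite addnS in spq.
case: p sF spq => [|p] sF spq; first by rewrite (supp0_iota _ sF) shuffle0l.
by apply: (IH p q) => //; exact: supp_iota.
Qed.

Lemma shuffle_supp0r F H s : supp_l 0 H -> shuffle F H s = (F s : C) *: H [::].
Proof.
move=> sH; elim: s F => [|a s IH] F //=.
by rewrite IH (supp0_iota _ sH) shuffle0r addr0.
Qed.

Lemma shuffle_supp0l F H s : supp_l 0 F -> shuffle F H s = (F [::] : C) *: H s.
Proof.
move=> sF; elim: s F H sF => [|a s IH] F H sF //=.
by rewrite (supp0_iota _ sF) shuffle0l add0r IH /sgn_l ?expr0 ?scale1r //; exact: supp_sgn.
Qed.

Lemma sgn_supp p F : supp_l p F -> sgn_l F = fun t => (-1) ^+ p *: F t.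
Proof.
move=> sF; apply/funext => t; rewrite /sgn_l.
by have [->//|tp] := eqVneq (size t) p; rewrite sF // !scaler0.
Qed.

Variables (br : G -> G -> G) (rho : G -> C -> C) (nabla : G -> N -> N).
Hypothesis nablaB : forall a e e', nabla a (e - e') = nabla a e - nabla a e'.
Hypothesis nablaM : forall a f e, nabla a (f *: e) = f *: nabla a e + rho a f *: e.
Hypothesis rhoB : forall a f g, rho a (f - g) = rho a f - rho a g.
Hypothesis rhoM : forall a f g, rho a (f * g) = f * rho a g + rho a f * g.

Local Notation lieC := (lie (N := C^o) br rho).
Local Notation dC := (koszul_d (N := C^o) br rho).
Local Notation lieN := (lie br nabla).
Local Notation dN := (koszul_d br nabla).

Lemma lie_shuffle a F H s :
  lieN a (shuffle F H) s = shuffle (lieC a F) H s + shuffle F (lieN a H) s.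
Proof.
elim: s F H => [|b s IH] F H /=.
  by rewrite nablaM addrC.
rewrite (_ : iota_l b _ =
    fun t => shuffle (iota_l b F) H t + shuffle (sgn_l F) (iota_l b H) t) //.
rewrite (lieD _ nablaB) !IH (lie_sgn (N := C^o) _ rhoB).
rewrite (_ : iota_l b (lieC a F) =
    fun t => lieC a (iota_l b F) t - iota_l (br a b) F t) // shuffleBl.
rewrite (_ : iota_l b (lieN a H) =
    fun t => lieN a (iota_l b H) t - iota_l (br a b) H t) // shuffleBr.
by zmod.
Qed.

(** By its definition [shuffle] makes [iota_a] a graded derivation, and [L_a] is a derivation by
    [lie_shuffle]. Hence so is [d], by Cartan's formula and induction; the mixed terms match because
    both [iota_a] and [d] anticommute with [sgn_l]. *)
Lemma koszul_d_shuffle F H s :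
  dN (shuffle F H) s = shuffle (dC F) H s + shuffle (sgn_l F) (dN H) s.
Proof.
elim: s F H => [|a s IH] F H /=; first by rewrite scale0r scaler0 addr0.
rewrite (_ : iota_l a _ =
    fun t => shuffle (iota_l a F) H t + shuffle (sgn_l F) (iota_l a H) t) //.
rewrite (koszul_dD _ nablaB) !IH lie_shuffle.
rewrite (koszul_d_sgn (N := C^o) _ rhoB) sgnK shuffleNl.
rewrite (_ : iota_l a (sgn_l F) = fun t => - sgn_l (iota_l a F) t); last first.
  by apply/funext => t; rewrite iota_sgn.
rewrite shuffleNl (_ : iota_l a (dC F) = fun t => lieC a F t - dC (iota_l a F) t) //.
rewrite (_ : iota_l a (dN H) = fun t => lieN a H t - dN (iota_l a H) t) //.
by rewrite shuffleBl shuffleBr; zmod.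
Qed.

End Shuffle.

(** * Families indexed by ordinals as lists *)

Definition args (T : Type) k (a : 'I_k -> T) : seq T := [seq a i | i <- enum 'I_k].

Section Args.
Variable T : Type.

Lemma argsS k (a : 'I_k.+1 -> T) : args a = a ord0 :: args (fun i => a (lift ord0 i)).
Proof. by rewrite /args enum_ordSl /= -map_comp. Qed.

Lemma size_args k (a : 'I_k -> T) : size (args a) = k.
Proof. by rewrite size_map size_enum_ord. Qed.

Lemma nth_args (x0 : T) k (a : 'I_k -> T) (i : 'I_k) : nth x0 (args a) i = a i.
Proof. by rewrite (nth_map i) ?size_enum_ord // nth_ord_enum. Qed.

Lemma argsK (x0 : T) k (s : seq T) : size s = k -> args (fun i : 'I_k => nth x0 s i) = s.
Proof.
move=> sk; apply: (@eq_from_nth _ x0); first by rewrite size_args.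
by rewrite size_args => i ik; rewrite -[i]/(val (Ordinal ik)) nth_args.
Qed.

Lemma args_lift (x0 : T) k (a : 'I_k.+1 -> T) (i : 'I_k.+1) :
  args (fun l => a (lift i l)) = take i (args a) ++ drop i.+1 (args a).
Proof.
have ik : (i <= k)%N by rewrite -ltnS.
apply: (@eq_from_nth _ x0) => [|j].
  rewrite size_cat size_take size_drop !size_args ltn_ord.
  by rewrite subSS subnKC.
rewrite size_args => jk; rewrite -[j in LHS]/(val (Ordinal jk)) nth_args.
rewrite nth_cat size_take size_args ltn_ord.
rewrite -(nth_args x0) /= /bump leqNgt; case: ltnP => ij.
  by rewrite nth_take.
by rewrite nth_drop addSn subnKC.
Qed.

Lemma args_lift_front k (a : 'I_k.+1 -> T) (i : 'I_k.+1) :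
  args a = take i (args (fun l => a (lift i l))) ++
    a i :: drop i (args (fun l => a (lift i l))).
Proof.
have ik : (i <= k)%N by rewrite -ltnS.
have si : size (take i (args a)) = i by rewrite size_take size_args ltn_ord.
rewrite (args_lift (a i)) take_cat drop_cat si ltnn subnn take0 drop0 cats0.
rewrite -[LHS](cat_take_drop i) (drop_nth (a i)) ?size_args ?ltn_ord //.
by rewrite nth_args.
Qed.

Lemma args_cat p q (a : 'I_(p + q) -> T) :
  args a = args (fun i => a (lshift q i)) ++ args (fun i => a (rshift p i)).
Proof.
elim: p a => [|p IH] a /=.
  rewrite [X in X ++ _](size0nil (size_args _)) /=.
  by congr args; apply/funext => i; congr a; exact/val_inj.
rewrite (argsS (a : 'I_(p + q).+1 -> T)) [in RHS]argsS /= IH.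
congr (_ :: (_ ++ _)).
- by congr a; exact: val_inj.
- by congr args; apply/funext => i; congr a; exact/val_inj.
by congr args; apply/funext => i; congr a; exact/val_inj.
Qed.

End Args.

(** Both equal entries are moved to the front, where they become adjacent. *)
Lemma altl_args (C : comPzRingType) (G N : lmodType C) (F : seq G -> N) k (s : 'I_k -> G) i j :
  mlin F -> altl F -> i != j -> s i = s j -> F (args s) = 0.
Proof.
move=> mF aF; case: k s i j => [|[|k]] s i j ij sij; first by case: i ij sij.
  by move: ij; rewrite [i]ord1 [j]ord1.
rewrite (args_lift_front s i) (altl_front _ _ _ mF aF) cat_take_drop.
have [j' jE|jE] := unliftP i j; last by rewrite jE eqxx in ij.
rewrite (args_lift_front _ j') (altl_front (s i :: _) _ _ mF aF).
by rewrite /= cat_take_drop -jE sij (aF [::]) !scaler0.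
Qed.

(** * Comparison of the shuffle product with the sum over all permutations *)

Section ShufflePermutations.
Variables (C : comPzRingType) (G N : lmodType C).
Implicit Types (F : seq G -> C^o) (H : seq G -> N).

Definition perm_sum m p F H (v : 'I_m -> G) : N :=
  \sum_(s : 'S_m) (-1) ^+ s *:
    ((F (take p (args (fun i => v (s i)))) : C) *: H (drop p (args (fun i => v (s i))))).

(** Permutations are sorted by the place i that they send to 0; [lift_perm i ord0] parametrises
    those with a given i. *)
Lemma sum_perm_lift m (f : 'S_m.+1 -> N) :
  \sum_(s : 'S_m.+1) f s = \sum_(i < m.+1) \sum_(t : 'S_m) f (lift_perm i ord0 t).
Proof.
rewrite (partition_big (fun s : 'S_m.+1 => (s^-1)%g ord0) xpredT) //=.
apply: eq_bigr => i _.
rewrite (reindex (lift_perm i ord0)) /=; last first.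
  (* Deleting j from the source and [s j] from the target inverts [lift_perm]. *)
  pose ulsf j (s : 'S_m.+1) k := odflt k (unlift (s j) (s (lift j k))).
  have ulsfK j (s : 'S_m.+1) k : lift (s j) (ulsf j s k) = s (lift j k).
    rewrite /ulsf; have:= neq_lift j k.
    by rewrite -(can_eq (permK s)) => /unlift_some[] ? ? ->.
  have inj_ulsf : injective (ulsf i _).
    move=> s; apply: can_inj (ulsf (s i) s^-1%g) _ => k'.
    by rewrite {1}/ulsf ulsfK !permK liftK.
  exists (fun s => perm (inj_ulsf s)) => [s _ | s].
    apply/permP=> k'; rewrite permE /ulsf lift_perm_lift lift_perm_id.
    by rewrite liftK.
  move/eqP => si; apply/permP => k.
  have E : s i = ord0 by rewrite -si permKV.
  case: (unliftP i k) => [k'|] ->; last by rewrite lift_perm_id.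
  by rewrite lift_perm_lift -E permE ulsfK.
apply: eq_bigl => t; apply/eqP.
by apply: (@perm_inj _ (lift_perm i ord0 t)); rewrite permKV lift_perm_id.
Qed.

(** Induction on m, according to the place i where the first vector is inserted. For i < p it is an
    argument of [F], and moving it to the front cancels the sign of [lift_perm]; otherwise it is an
    argument of [H] and the sign (-1)^p remains. In degree m + 1 there are p places of the first
    kind and m + 1 - p of the second, and these numbers complete the factorials given by the
    induction hypothesis. *)
Lemma perm_sum_shuffle m p F H (v : 'I_m -> G) : mlin F -> altl F -> mlin H -> altl H ->
  supp_l p F -> (p <= m)%N ->
  perm_sum p F H v = (p`! * (m - p)`!)%:R *: shuffle F H (args v).
Proof.
elim: m p F H v => [|m IH] p F H v mF aF mH aH sF pm.
  have -> : p = 0%N by case: p pm {sF}.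
  rewrite /perm_sum (bigD1 1%g) //= big1 => [|s]; last first.
    by move=> /negP[]; apply/eqP/permP => -[].
  have E (u : 'I_0 -> G) : args u = [::] by apply: size0nil; rewrite size_args.
  by rewrite !E odd_perm1 expr0 !scale1r addr0.
rewrite /perm_sum sum_perm_lift argsS /=.
set v' := fun i : 'I_m => v (lift ord0 i).
have T (i : 'I_m.+1) (t : 'S_m) :
    args (fun j => v (lift_perm i ord0 t j)) =
    take i (args (fun j => v' (t j))) ++ v ord0 :: drop i (args (fun j => v' (t j))).
  rewrite (args_lift_front _ i) lift_perm_id.
  rewrite (_ : (fun l => v (lift_perm i ord0 t (lift i l))) = fun j => v' (t j)) //.
  by apply/funext => j; rewrite lift_perm_lift.
have sz (i : 'I_m.+1) (t : 'S_m) : size (take i (args (fun j => v' (t j)))) = i.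
  by rewrite size_takel // size_args -ltnS.
have Hl (i : 'I_m.+1) : (i < p)%N -> \sum_(t : 'S_m) (-1) ^+ lift_perm i ord0 t *:
    ((F (take p (args (fun j => v (lift_perm i ord0 t j)))) : C) *:
      H (drop p (args (fun j => v (lift_perm i ord0 t j))))) =
    perm_sum p.-1 (iota_l (v ord0) F) H v'.
  move=> ip; apply: eq_bigr => t _; rewrite T; set u := args _.
  have su : size (take i u) = i := sz i t.
  rewrite take_cat drop_cat su [(p < i)%N]ltnNge (ltnW ip) /=.
  have -> : (p - i = (p.-1 - i).+1)%N by case: p ip {pm sF} => // p; rewrite ltnS => /subSn.
  rewrite /= altl_front // su odd_lift_perm addbF signr_addb -!scalerA.
  rewrite signr_odd [LHS]scalerA [LHS]scalerA mulrAC -expr2 sqrr_sign mul1r drop_drop.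
  by rewrite subnK -?takeD ?subnKC // -ltnS prednK // (leq_ltn_trans _ ip).
have Hr (i : 'I_m.+1) : ~~ (i < p)%N -> \sum_(t : 'S_m) (-1) ^+ lift_perm i ord0 t *:
    ((F (take p (args (fun j => v (lift_perm i ord0 t j)))) : C) *:
      H (drop p (args (fun j => v (lift_perm i ord0 t j))))) =
    (-1) ^+ p *: perm_sum p F (iota_l (v ord0) H) v'.
  rewrite -leqNgt => ip; rewrite scaler_sumr; apply: eq_bigr => t _; rewrite T.
  set u := args _.
  have su : size (take i u) = i := sz i t.
  have sp : size (take p u) = p.
    by rewrite size_takel // size_args (leq_trans ip) // -ltnS.
  pose w := drop p (take i u).
  have sw : size w = (i - p)%N by rewrite size_drop su.
  have tw : take i u = take p u ++ w.
    by rewrite -[LHS](cat_take_drop p) take_takel.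
  have dw : drop p u = w ++ drop i u.
    by rewrite -[u in LHS](cat_take_drop i) tw -catA drop_size_cat.
  rewrite tw -catA take_size_cat // drop_size_cat // altl_front // sw -dw.
  rewrite odd_lift_perm addbF signr_addb signr_odd !scalerA; congr (_ *: _).
  rewrite [LHS]mulrAC; congr (_ * _); rewrite mulrAC; congr (_ * _).
  rewrite -{1}(subnKC ip) exprD -mulrA -expr2 sqrr_sign mulr1.
  by [].
rewrite (bigID (fun i : 'I_m.+1 => i < p)%N) /= (eq_bigr _ Hl) [X in _ + X](eq_bigr _ Hr).
set A := perm_sum _ _ _ _; set B := _ *: perm_sum _ _ _ _.
have cA (x : N) : \sum_(i < m.+1 | (i < p)%N) x = x *+ p.
  by rewrite big_ord_narrow // sumr_const card_ord.
have cB (x : N) : \sum_(i < m.+1 | ~~ (i < p)%N) x = x *+ (m.+1 - p).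
  apply: (@addrI _ (x *+ p)); rewrite -mulrnDr subnKC // -{1}cA.
  have := sumr_const 'I_m.+1 x; rewrite card_ord => <-.
  by rewrite [in RHS](bigID (fun i : 'I_m.+1 => i < p)%N).
rewrite cA cB (sgn_supp sF) shuffleZl scalerDr; congr (_ + _).
  case: p sF pm {Hl Hr cA cB B} @A => [|p] sF pm A.
    by rewrite mulr0n supp0_iota // shuffle0l scaler0.
  rewrite /A /= IH //; [|exact: mlin_iota|exact: altl_iota|exact: supp_iota].
  by rewrite -scaler_nat scalerA -natrM factS subSS mulnA.
(* For [p = m.+1] every argument goes to [F]: the induction hypothesis does not cover this case, and
   both sides vanish. *)
have [Ep|pm'] := eqVneq p m.+1.
  by rewrite (shuffle_small _ sF) ?size_args ?Ep // !scaler0 subnn mulr0n.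
have {}pm : (p <= m)%N by rewrite -ltnS ltn_neqAle pm'.
rewrite /B IH //; [|exact: mlin_iota|exact: altl_iota].
rewrite -scaler_nat !scalerA mulrAC -natrM subSn // factS.
by rewrite mulnCA.
Qed.

End ShufflePermutations.

(** * The Koszul formula *)

Section KoszulFormula.
Variables (C : comPzRingType) (G N : lmodType C).
Variables (br : G -> G -> G) (nabla : G -> N -> N).
Implicit Types (F : seq G -> N).

Lemma lie_args a F k (v : 'I_k -> G) : mlin F -> altl F ->
  lie br nabla a F (args v) = nabla a (F (args v)) -
    \sum_(j < k) (-1) ^+ j *: F (br a (v j) :: args (fun l => v (lift j l))).
Proof.
elim: k F v => [|k IH] F v mF aF.
  by rewrite (size0nil (size_args v)) /= big_ord0 subr0.
rewrite argsS /= IH; [|exact: mlin_iota|exact: altl_iota].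
rewrite big_ord_recl /= expr0 scale1r opprD [- F _ - _]addrC addrA; congr (_ - _ - _).
apply: eq_bigr => j _; rewrite /bump /= add1n exprS mulN1r scaleNr.
case: k v {IH} j => [|k] v j; first by case: j.
rewrite [in RHS]argsS /= (altl_swap [::] _ _ _ mF aF) /= scalerN opprK /iota_l; congr (_ *: _).
congr (F [:: _, _ & _]); first by congr v; exact/val_inj.
by congr args; apply/funext => l; congr v; apply/val_inj; rewrite /= bumpS.
Qed.

Definition kargs k (a : 'I_k.+1 -> G) (i j : 'I_k.+1) : 'I_k -> G :=
  fun l => if (l : nat) is l'.+1 then a (inord (bump j (bump i l')))
           else br (a i) (a j).

(** Induction on k along Cartan's formula: the Lie derivative along [a ord0] gives the terms with i
    = 0 in both sums, by [lie_args], and the differential of the contraction gives all others. There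
    the indices shift by one, which accounts for the minus sign; in the bracket terms two indices
    shift, and moving the bracket past [a ord0] restores the sign. *)
Lemma koszul_d_koszul k F (a : 'I_k.+1 -> G) : mlin F -> altl F ->
  koszul_d br nabla F (args a) =
    \sum_(i < k.+1) (-1) ^+ i *: nabla (a i) (F (args (fun l => a (lift i l)))) +
    \sum_(i < k.+1) \sum_(j < k.+1 | (i < j)%N) (-1) ^+ (i + j) *: F (args (kargs a i j)).
Proof.
elim: k F a => [|k IH] F a mF aF.
  have E (v : 'I_0 -> G) : args v = [::] by exact: (size0nil (size_args v)).
  rewrite argsS !E /= subr0 !big_ord1 /= expr0 scale1r E.
  by rewrite big_pred0 ?addr0 // => j; rewrite ord1.
rewrite argsS /= IH; [|exact: mlin_iota|exact: altl_iota].
set a' := fun i => a (lift ord0 i).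
rewrite lie_args // [in RHS]big_ord_recl [X in _ = _ + X]big_ord_recl /= expr0 scale1r -!addrA.
congr (_ + _).
rewrite opprD addrCA; congr (_ + _).
  rewrite -sumrN; apply: eq_bigr => i _.
  rewrite /bump /= add1n exprS mulN1r scaleNr; congr (- (_ *: nabla _ _)).
  rewrite [in RHS]argsS /iota_l; congr (F (_ :: _)); first by congr a; exact/val_inj.
  by congr args; apply/funext => l; congr a; apply/val_inj; rewrite /= bumpS.
congr (_ + _).
  rewrite [RHS]big_mkcond [in RHS]big_ord_recl /= add0r -sumrN; apply: eq_bigr => j _.
  rewrite /bump /= add1n add0n exprS mulN1r scaleNr; congr (- (_ *: F _)).
  rewrite argsS; congr (_ :: _); congr args.
  apply/funext => l; rewrite /kargs /=; congr a; apply/val_inj.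
  rewrite /= inordK; last first.
    have : (bump j l < k.+1)%N by exact: (ltn_ord (lift j l)).
    by rewrite /bump /= !add1n ltnS addnS.
  by rewrite /bump /= !add1n addnS.
rewrite -sumrN; apply: eq_bigr => i _.
rewrite [RHS]big_mkcond [in RHS]big_ord_recl /= add0r big_mkcond -sumrN /=.
apply: eq_bigr => j _; rewrite /bump /= !add1n ltnS.
case: ifP => ij; last by rewrite oppr0.
rewrite addnS addSn !exprS !mulN1r opprK -scalerN; congr (_ *: _).
rewrite {}/a'; case: k a i j ij {IH} => [|k] a i j ij; first by move: ij; rewrite !ord1.
rewrite /iota_l argsS [in RHS]argsS [in X in _ = F (_ :: X)]argsS.
rewrite (altl_swap [::] _ _ _ mF aF) /= opprK; congr F; congr [:: _, _ & _].
  rewrite /kargs /= /bump /=; congr a; apply/val_inj.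
  by rewrite /= inordK.
congr args; apply/funext => l; rewrite /kargs /=; congr a; apply/val_inj.
(* The indices passed to [inord] must be in range, where it does not return its default. *)
have B x y : (bump x y <= y.+1)%N by rewrite /bump; case: (x <= y)%N.
have bl : (bump j (bump i l) < k.+2)%N.
  by apply: leq_ltn_trans (B _ _) _; rewrite ltnS (leq_ltn_trans (B _ _)) // ltnS ltn_ord.
by rewrite !add0n /= -/(bump 0 _) !bumpS !inordK ?bumpS /bump /= ?add1n ?ltnS -?/(bump _ _).
Qed.

End KoszulFormula.

(** * Naturality of the differential *)

Section Naturality.
Variables (C C' : comPzRingType) (G N : lmodType C) (G' N' : lmodType C').
Variables (br : G -> G -> G) (nabla : G -> N -> N).
Variables (br' : G' -> G' -> G') (nabla' : G' -> N' -> N').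
Variables (g : G -> G') (h : N -> N').
Hypothesis hB : forall x y, h (x - y) = h x - h y.
Hypothesis gbr : forall x y, br' (g x) (g y) = g (br x y).
Hypothesis hnabla : forall x y, nabla' (g x) (h y) = h (nabla x y).

(** The case of interest is restriction to an open subset, which changes the ring of functions and
    is not surjective on sections; hence the comparison is made on lists of images only. *)
Lemma lie_natural F F' a s : (forall t, F' (map g t) = h (F t)) ->
  lie br' nabla' (g a) F' (map g s) = h (lie br nabla a F s).
Proof.
elim: s F F' => [|b s IH] F F' E /=.
  by rewrite -hnabla -E.
rewrite (IH (iota_l b F)); last by move=> t; rewrite /iota_l -E.
by rewrite hB gbr -E.
Qed.

Lemma koszul_d_natural F F' s : (forall t, F' (map g t) = h (F t)) ->
  koszul_d br' nabla' F' (map g s) = h (koszul_d br nabla F s).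
Proof.
elim: s F F' => [|a s IH] F F' E /=; first by have := hB 0 0; rewrite !subrr.
rewrite (IH (iota_l a F)); last by move=> t; rewrite /iota_l -E.
by rewrite (lie_natural (F := F)).
Qed.

End Naturality.

(** * Smooth bump functions and partitions of unity *)

Section SmoothUnivariate.
Variable R : realType.

(** A smooth function of one variable together with its derivatives: with all [h m] treated at once,
    [Ck_comp] is an induction on k. *)
Definition derivative_tower (h : nat -> R -> R) :=
  forall m t, is_derive t (1 : R) (h m) (h m.+1 t).

Lemma derivative_tower_continuous h m : derivative_tower h -> continuous (h m).
Proof.
move=> Hh t; have [d _] := Hh m t.
exact/differentiable_continuous/derivable1_diffP.
Qed.

(** A directional derivative is an ordinary derivative along a line, to which the one-variable chain
    rule applies. *)
Lemma is_derive_lineP (V : normedModType R) (f : V -> R) (y v : V) (a : R) :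
  is_derive y v f a <-> is_derive (0 : R) (1 : R) (fun t => f (t *: v + y)) a.
Proof.
have E : (fun h : R => h^-1 *: ((f \o shift y) (h *: v) - f y)) =
   (fun h : R => h^-1 *: (((fun t => f (t *: v + y)) \o shift (0 : R)) (h *: (1 : R)) -
     f ((0 : R) *: v + y))).
  by apply/funext => h /=; rewrite scale0r add0r addr0 [h *: 1]mulr1.
by split => -[d e]; apply: DeriveDef; move: d e; rewrite /derivable /derive ?E // -E.
Qed.

Lemma is_derive_comp_line (V : normedModType R) (f : V -> R) (g : R -> R) (y v : V) (a b : R) :
  is_derive (f y) (1 : R) g a -> is_derive y v f b ->
  is_derive y v (fun z => g (f z)) (a * b).
Proof.
move=> dg /is_derive_lineP df; apply/is_derive_lineP.
apply: (@is_derive1_comp _ g (fun t => f (t *: v + y))) => //.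
by rewrite scale0r add0r.
Qed.

Lemma Ck_comp n (O : set 'rV[R]_n) (f : 'rV[R]_n -> R) h k m : open O -> derivative_tower h ->
  Ck k O f -> Ck k O (fun y => h m (f y)).
Proof.
move=> oO Hh; have ch p y : {for y, continuous f} -> {for y, continuous (fun y => h p (f y))}.
  by move=> cf; apply: continuous_comp => //; exact: derivative_tower_continuous.
elim: k f ch m => [|k IH] f ch m [cf df]; split=> //; try by move=> y Oy; apply: ch; exact: cf.
move=> i; have [d1 d2] := df i.
have D y : O y -> is_derive y (delta_mx 0 i) (fun y => h m (f y))
    (h m.+1 (f y) * 'D_(delta_mx 0 i) f y).
  by move=> Oy; apply: is_derive_comp_line; [exact: Hh|apply: derivableP; exact: d1].
split=> [y /D[]//|].
have := CkM oO (IH f ch m.+1 (Ck_pred (conj cf df))) d2.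
by apply: Ck_ext => // y /D[_ ->].
Qed.

Lemma CkV n (O : set 'rV[R]_n) (f : 'rV[R]_n -> R) k : open O -> (forall y, O y -> f y != 0) ->
  Ck k O f -> Ck k O (fun y => (f y)^-1).
Proof.
move=> oO f0; elim: k => [|k IH] [cf df]; split=> //;
  try by move=> y Oy; apply: (@continuousV R^o) => //; [exact: f0|exact: cf].
move=> i; have [d1 d2] := df i; split.
  by move=> y Oy; apply: derivableV; [exact: f0|exact: d1].
have I := IH (Ck_pred (conj cf df)).
have := CkM oO (CkM oO (CkM oO I I) d2) (Ck_cst k O (-1)).
apply: Ck_ext => // y Oy; rewrite (deriveV (f0 _ Oy) (d1 _ Oy)).
by rewrite mulrN1 scaleNr -exprVn expr2.
Qed.

(** Each monomial is bounded by [s^m <= m! exp s]. The summand 1 in the constant keeps it positive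
    when p is 0. *)
Lemma poly_le_expR (p : {poly R}) :
  exists2 c : R, 0 < c & forall s, 0 <= s -> `|p.[s]| <= c * expR s.
Proof.
exists (1 + \sum_(i < size p) `|p`_i| * (i`!)%:R).
  by rewrite ltr_pwDl // sumr_ge0 // => i _; rewrite mulr_ge0.
move=> s s0; rewrite horner_coef mulrDl mul1r.
apply: (le_trans (ler_norm_sum _ _ _)); apply: ler_wpDl; first exact: expR_ge0.
rewrite mulr_suml; apply: ler_sum => i _; rewrite normrM -mulrA ler_wpM2l //.
rewrite normrX (ger0_norm s0).
case: (i : nat) => [|m]; first by rewrite fact0 expr0 mul1r (le_trans _ (expR_ge1Dx s)) // lerDl.
rewrite mulrC -ler_pdivrMr ?ltr0n ?fact_gt0 //.
by apply: le_trans (expR_ge1Dxn m s0); rewrite lerDr.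
Qed.

(* The functions p(1/t) exp(-1/t) on t > 0, extended by 0, are closed under derivation. *)
Definition flat_exp (p : {poly R}) (t : R) : R :=
  if 0 < t then p.[t^-1] * expR (- t^-1) else 0.

(** This is the exponential bound for [p * 'X^2] at 1/t. The square makes the difference quotient at
    the origin tend to 0. *)
Lemma flat_exp_le (p : {poly R}) : exists2 c : R, 0 < c & forall t, `|flat_exp p t| <= c * t ^+ 2.
Proof.
have [c c0 Hc] := poly_le_expR (p * 'X^2); exists c => // t.
rewrite /flat_exp; case: ltP => t0; last by rewrite normr0 mulr_ge0 ?sqr_ge0 // ltW.
have {Hc} : `|(p * 'X^2).[t^-1]| <= c * expR t^-1 by apply: Hc; rewrite invr_ge0 ltW.
rewrite hornerM hornerXn exprVn [`|_ / _|]normrM [`|_ * expR _|]normrM (ger0_norm (expR_ge0 _)).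
rewrite (ger0_norm (_ : 0 <= t ^- 2)); last by rewrite invr_ge0 sqr_ge0.
by rewrite ler_pdivrMr ?exprn_gt0 // expRN ler_pdivrMr ?expR_gt0 // mulrAC.
Qed.

(** For t > 0 the derivative of p(1/t) exp(-1/t) is (p - p')(1/t) t^-2 exp(-1/t), whence the factor
    ['X^2]. Only t = 0 needs an estimate. *)
Lemma is_derive_flat_exp p t :
  is_derive t (1 : R) (flat_exp p) (flat_exp ((p - p^`()) * 'X^2) t).
Proof.
have [t0|t0|<-] := ltgtP 0 t.
- have : is_derive t (1 : R) (fun s => p.[s^-1] * expR (- s^-1))
      (flat_exp ((p - p^`()) * 'X^2) t).
    have di : is_derive t (1 : R) (fun s => s^-1) (- t ^- 2).
      have := @is_deriveV R id t 1 1 (lt0r_neq0 t0) (is_derive_id _ _).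
      by rewrite [_ *: 1]mulr1.
    have d1 := @is_derive1_comp R (horner p) _ t _ _ (is_derive_poly p _) di.
    have d2 := @is_derive1_comp R expR _ t _ _ (is_derive_expR _) (is_deriveN di).
    apply: is_derive_eq (is_deriveM d1 d2) _.
    rewrite /flat_exp t0 hornerM hornerXn hornerD hornerN exprVn /GRing.scale /=.
    rewrite (_ : (- [eta GRing.inv]) t = - t^-1) //.
    by ring.
  apply: near_eq_is_derive; near=> s; rewrite /flat_exp ifT //.
  by near: s; exact: lt_nbhsr.
- have : is_derive t (1 : R) (fun=> 0 : R) (flat_exp ((p - p^`()) * 'X^2) t).
    rewrite /flat_exp ltNge (ltW t0) /=; exact: is_derive_cst.
  apply: near_eq_is_derive; near=> s; rewrite /flat_exp ltNge ifF //.
  apply/negbF/ltW; near: s; exact: lt_nbhsl.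
rewrite [flat_exp _ 0]/flat_exp ltxx.
suff H : (fun h : R => h^-1 *:
    ((flat_exp p \o shift (0 : R)) (h *: (1 : R)) - flat_exp p 0)) @ 0^' --> (0 : R).
  by apply: DeriveDef; [apply/cvg_ex; exists 0|exact: cvg_lim H].
have [c c0 Hc] := flat_exp_le p.
apply/cvgrPdist_le => e e0; near=> h.
rewrite /= addr0 [h *: 1]mulr1 {2}/flat_exp ltxx subr0 sub0r normrN normrM normfV.
have h0 : h != 0 by near: h; exact: nbhs_dnbhs_neq.
rewrite mulrC ler_pdivrMr ?normr_gt0 //; apply: (le_trans (Hc h)).
rewrite -[h ^+ 2]real_normK ?num_real // expr2 mulrA ler_wpM2r //.
rewrite mulrC -ler_pdivlMr //; near: h.
by apply: dnbhs0_le; rewrite divr_gt0.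
Unshelve. all: by end_near.
Qed.

Lemma flat_exp_tower p :
  derivative_tower (fun m => flat_exp (iter m (fun q => (q - q^`()) * 'X^2) p)).
Proof. by move=> m t; exact: is_derive_flat_exp. Qed.

Lemma flat_exp1_gt0 t : (0 < flat_exp 1 t) = (0 < t).
Proof. by rewrite /flat_exp; case: ifP; rewrite ?ltxx // hornerE mul1r expR_gt0. Qed.

Lemma flat_exp1_ge0 t : 0 <= flat_exp 1 t.
Proof. by rewrite /flat_exp; case: ifP => //; rewrite hornerE mul1r expR_ge0. Qed.

End SmoothUnivariate.

Section SmoothStep.
Variable R : realType.
Implicit Types t : R.

Definition smooth_step t := flat_exp 1 t / (flat_exp 1 t + flat_exp 1 (1 - t)).

Lemma smooth_step_den t : 0 < flat_exp 1 t + flat_exp 1 (1 - t).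
Proof.
have [t0|t0] := ltP 0 t.
  by rewrite ltr_pwDl ?flat_exp1_ge0 // flat_exp1_gt0.
by rewrite ltr_wpDl ?flat_exp1_ge0 // flat_exp1_gt0; lra.
Qed.

Lemma smooth_step_le0 t : t <= 0 -> smooth_step t = 0.
Proof. by move=> t0; rewrite /smooth_step /flat_exp ltNge t0 mul0r. Qed.

Lemma smooth_step_ge1 t : 1 <= t -> smooth_step t = 1.
Proof.
move=> t1; have := smooth_step_den t; rewrite /smooth_step.
rewrite [X in _ + X](_ : _ = 0) ?addr0; first by move=> /lt0r_neq0/divff.
by rewrite /flat_exp ifF //; apply/negbTE; rewrite -leNgt; lra.
Qed.

Lemma smooth_step01 t : 0 <= smooth_step t <= 1.
Proof.
have d := smooth_step_den t; apply/andP; split.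
  by rewrite divr_ge0 ?flat_exp1_ge0 // ltW.
by rewrite ler_pdivrMr // mul1r lerDl flat_exp1_ge0.
Qed.

Definition bump1 t := smooth_step (2 - t) * smooth_step (2 + t).

Lemma bump1_id t : `|t| <= 1 -> bump1 t = 1.
Proof. by rewrite ler_norml => /andP[? ?]; rewrite /bump1 !smooth_step_ge1 ?mulr1; lra. Qed.

Lemma bump1_eq0 t : 2 <= `|t| -> bump1 t = 0.
Proof.
rewrite /bump1; have [t0|t0] := ler0P t => ?.
  by rewrite [X in _ * X]smooth_step_le0 ?mulr0; lra.
by rewrite smooth_step_le0 ?mul0r; lra.
Qed.

Lemma bump1_01 t : 0 <= bump1 t <= 1.
Proof.
have /andP[a0 a1] := smooth_step01 (2 - t); have /andP[b0 b1] := smooth_step01 (2 + t).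
by rewrite /bump1 mulr_ge0 //= mulr_ile1.
Qed.

End SmoothStep.

(** * Bump functions on a manifold *)

Section Bumps.
Variables (R : realType) (n : nat) (M : manifold R n).
Implicit Types (D W : set M) (f : M -> R).

Lemma smooth_comp D f h m : open D -> derivative_tower h -> smooth M D f ->
  smooth M D (fun x => h m (f x)).
Proof.
move=> oD Hh sf c Mc; have [g sg fg] := sf c Mc; exists (fun y => h m (g y)).
  by move=> k; apply: Ck_comp => //; exact: open_chart_image.
by move=> x Dx; rewrite fg.
Qed.

Lemma smoothV D f : open D -> (forall x, D x -> f x != 0) -> smooth M D f ->
  smooth M D (fun x => (f x)^-1).
Proof.
move=> oD f0 sf c Mc; have [g sg fg] := sf c Mc; exists (fun y => (g y)^-1).
  move=> k; apply: CkV => //; first exact: open_chart_image.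
  by move=> _ [x [Dx dx] <-]; rewrite -fg ?f0 //; apply/mem_set.
by move=> x Dx; rewrite fg.
Qed.

Lemma smooth_smooth_step D f : open D -> smooth M D f ->
  smooth M D (fun x => smooth_step (f x)).
Proof.
move=> oD sf; have sB g : smooth M D g -> smooth M D (fun x => flat_exp 1 (g x)).
  exact: smooth_comp 0%N oD (flat_exp_tower 1).
have s1 := sB _ sf.
have s2 : smooth M D (fun x => flat_exp 1 (1 - f x)).
  apply: sB; apply: smooth_ext (smoothD oD (smooth_cst D 1)
    (smoothM oD (smooth_cst D (-1)) sf)) => x _.
  by rewrite mulN1r.
apply: smoothM => //; apply: smoothV => //; last exact: smoothD.
by move=> x _; rewrite gt_eqF // smooth_step_den.
Qed.

Lemma smooth_bump1 D f : open D -> smooth M D f -> smooth M D (fun x => bump1 (f x)).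
Proof.
move=> oD sf; apply: smoothM => //; apply: smooth_smooth_step => //.
  apply: smooth_ext (smoothD oD (smooth_cst D 2)
    (smoothM oD (smooth_cst D (-1)) sf)) => x _.
  by rewrite mulN1r.
exact: smoothD (smooth_cst D 2) sf.
Qed.

Lemma smooth_prod (I : Type) (r : seq I) (F : I -> M -> R) D :
  open D -> (forall i, smooth M D (F i)) ->
  smooth M D (fun x => \prod_(i <- r) F i x).
Proof.
move=> oD sF; elim: r => [|i r IH].
  by apply: smooth_ext (smooth_cst D 1) => x _; rewrite big_nil.
by apply: smooth_ext (smoothM oD (sF i) IH) => x _; rewrite big_cons.
Qed.

(* The preimage is compact, hence closed since M is a Hausdorff space. *)
Lemma closed_chart_preimage c W (K : set 'rV[R]_n) : atlas c -> open W -> compact K ->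
  K `<=` c @` (W `&` cdom c) -> closed [set x | (W `&` cdom c) x /\ K (c x)].
Proof.
move=> Mc oW cK KO; have [/(_ _ Mc)[od ic cc oc] _ _] := mfd_atlas M.
(* A point of [K] yields a default value for the inverse [g] of the chart; without one the preimage
   is empty. *)
have [[y0 Ky0]|K0] := pselect (K !=set0); last first.
  rewrite (_ : mkset _ = set0); first exact: closed0.
  by apply/seteqP; split=> // x [_ Kx]; apply: K0; exists (c x).
have [x0 _ _] := KO _ Ky0.
pose g y := if pselect (exists2 x, (W `&` cdom c) x & c x = y) is left e
            then projT1 (cid2 e) else x0.
have gK x : (W `&` cdom c) x -> g (c x) = x.
  move=> Wx; rewrite /g; case: pselect => [e|[]]; last by exists x.
  have [[Wz dz] E] := projT2 (cid2 e).
  by apply: ic => //; apply/mem_set => //; case: Wx.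
apply: compact_closed; first exact: mfd_hausdorff.
rewrite (_ : mkset _ = g @` K); last first.
  apply/seteqP; split=> [x [Wx Kx]|_ [y Ky <-]]; first by exists (c x) => //; exact: gK.
  by have [x Wx E] := KO _ Ky; rewrite -E gK //; split=> //; rewrite E.
apply: continuous_compact => //; apply: continuous_in_subspaceT => y /set_mem Ky A.
rewrite nbhsE => -[B [oB Bgy] BA].
have [x [Wx dx] E] := KO _ Ky.
have : nbhs y (c @` (B `&` (W `&` cdom c))).
  apply: open_nbhs_nbhs; split.
    by apply: oc => [|z [_ []]//]; apply: openI => //; exact: openI.
  by exists x => //; split=> //; rewrite -(gK x) // E.
by apply: filterS => _ [z [Bz Wz] <-]; rewrite /= gK //; exact: BA.
Qed.

(** In a chart, take the product of one-variable bumps in the coordinates, supported in a closed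
    cube inside the image of the chart, and extend it by zero. *)
Lemma bump_exists (x0 : M) W : open W -> W x0 ->
  exists chi : 'C^oo(M), [/\ forall x, 0 <= chi x <= 1,
    \forall x \near x0, chi x = 1 & support chi `<=` W].
Proof.
move=> oW Wx0; have [Hc cov cs] := mfd_atlas M; have [c Mc dx0] := cov x0.
have [od ic cc oc] := Hc c Mc.
have oO : open (c @` (W `&` cdom c)) by exact: open_chart_image.
have /nbhs_ballP[e /= e0 eO] : nbhs (c x0) (c @` (W `&` cdom c)).
  by apply: open_nbhs_nbhs; split=> //; exists x0.
(* The product is 1 within distance r and 0 outside the cube of half-side 2r, which lies in the ball
   of radius e = 3r. *)
pose r := e / 3; have r0 : 0 < r by rewrite divr_gt0.
have ri0 : 0 <= r^-1 by rewrite invr_ge0 ltW.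
have er : e = 3 * r by rewrite /r; field.
pose K := [set v : 'rV[R]_n | forall i, `[c x0 0 i - 2 * r, c x0 0 i + 2 * r]%classic (v ord0 i)].
have cK : compact K.
  apply: (@rV_compact _ _ (fun i => `[c x0 0 i - 2 * r, c x0 0 i + 2 * r]%classic)) => i.
  exact: segment_compact.
have KO : K `<=` c @` (W `&` cdom c).
  move=> v Kv; apply: eO; split=> // i j; rewrite ord1; have := Kv j.
  rewrite /= in_itv /= => /andP[? ?]; rewrite /ball /= ltr_norml.
  by apply/andP; split; lra.
have cS := closed_chart_preimage Mc oW cK KO.
set S := mkset _ in cS.
pose b x := \prod_(j < n) bump1 ((c x 0 j - c x0 0 j) * r^-1).
pose f x := if `[< (W `&` cdom c) x >] then b x else 0.
have fS x : f x != 0 -> S x.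
  rewrite /f; case: asboolP => [Wx bx|]; last by rewrite eqxx.
  split=> // i; rewrite /= in_itv /=; apply/andP.
  have : `|(c x 0 i - c x0 0 i) * r^-1| < 2.
    rewrite ltNge; apply/negP => /bump1_eq0 b0; move: bx; rewrite /b (bigD1 i) //=.
    by rewrite b0 mul0r eqxx.
  rewrite normrM (ger0_norm ri0) ltr_pdivrMr //.
  by rewrite ltr_norml => /andP[? ?]; split; lra.
have oWd : open (W `&` cdom c) by exact: openI.
have sb : smooth M (W `&` cdom c) b.
  apply: smooth_prod => // j; apply: smooth_bump1 => //.
  apply: smoothM => //; last exact: smooth_cst.
  apply: smoothD => //; last exact: (smooth_cst _ (- c x0 0 j)).
  by apply: smooth_sub (cs c Mc j); exact: subIsetr.
(* Since [S] is closed, [W] intersected with the chart domain and the complement of [S] form an open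
   cover; on the second set [f] is 0. *)
have sf : smooth M setT f.
  apply: smooth_local => [|x _]; first exact: openT.
  have [Sx|Sx] := pselect (S x).
    exists (W `&` cdom c); split=> //; first by case: Sx.
    rewrite setIT; apply: smooth_ext sb => y Wy.
    by rewrite /f; case: asboolP.
  exists (~` S); split=> //; first exact: closed_openC.
  rewrite setIT; apply: smooth_ext (smooth_cst _ 0) => y Sy; apply/esym/eqP/negPn/negP.
  by move/fS.
exists (SmoothFun (asboolT sf)); split => /=.
- move=> x; rewrite /f; case: asboolP => _; last by rewrite lexx ler01.
  apply/andP; split.
    by apply: prodr_ge0 => j _; have /andP[] := bump1_01 ((c x 0 j - c x0 0 j) * r^-1).
  by apply: prodr_ile1 => j _; exact: bump1_01.
- have : \forall x \near x0, ball (c x0) r (c x).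
    by apply: (cc _ dx0); exact: nbhsx_ballx.
  have : \forall x \near x0, (W `&` cdom c) x by exact: open_nbhs_nbhs.
  apply: filterS2 => x Wx [_ bx]; rewrite /= /f asboolT //.
  rewrite /b big1 // => j _; apply: bump1_id.
  rewrite normrM (ger0_norm ri0) ler_pdivrMr // mul1r.
  by have := bx 0 j; rewrite /ball /= distrC => /ltW.
apply: (@subset_trans _ S); last by move=> x [[]].
have /closure_id -> := cS.
by apply: closureS => x /fS.
Qed.

End Bumps.

(** * Partitions of unity subordinated to two open sets *)

Section PartitionOfUnity.
Variables (R : realType) (n : nat) (M : manifold R n).

(* If each point has a neighbourhood on which some phi_i is 1, then the functions
   phi_i * prod_(j < i) (1 - phi_j) are locally finite and add up to 1. *)
Section Telescope.
Variable phi : nat -> M -> R.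

Definition tele i x := phi i x * \prod_(j < i) (1 - phi j x).

Definition tele_sum (P : pred nat) m x := \sum_(i < m | P i) tele i x.

Lemma tele_sum_stable P i m x : phi i x = 1 -> (i < m)%N ->
  tele_sum P m x = tele_sum P i.+1 x.
Proof.
move=> pi im; rewrite /tele_sum (big_ord_widen_cond _ P (fun j => tele j x) im).
rewrite (bigID (fun j : 'I_m => j < i.+1)%N) /= [X in _ + X]big1 ?addr0 //.
move=> j /andP[_]; rewrite -leqNgt => ij.
by rewrite /tele (bigD1 (Ordinal ij)) //= pi subrr mul0r mulr0.
Qed.

Lemma tele_sumT m x :
  \sum_(i < m) tele i x = 1 - \prod_(j < m) (1 - phi j x).
Proof.
elim: m => [|m IH]; first by rewrite !big_ord0 subrr.
rewrite big_ord_recr IH /= [in RHS]big_ord_recr /= /tele.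
by ring.
Qed.

Lemma smooth_tele_sum P m : (forall i, smooth M setT (phi i)) ->
  smooth M setT (tele_sum P m).
Proof.
move=> sp; apply: smooth_sum => [|i]; first exact: openT.
apply: smoothM; [exact: openT|exact: sp|].
apply: smooth_prod => [|j]; first exact: openT.
apply: smooth_ext (smoothD openT (smooth_cst setT 1)
    (smoothM openT (smooth_cst setT (-1)) (sp j))) => x _.
by rewrite mulN1r.
Qed.

Lemma tele_ge0 i x : (forall j, 0 <= phi j x <= 1) -> 0 <= tele i x.
Proof.
move=> p01; rewrite mulr_ge0 //; first by have /andP[] := p01 i.
by apply: prodr_ge0 => j _; rewrite subr_ge0; have /andP[] := p01 j.
Qed.

End Telescope.

Lemma support_out (f : M -> R) (x : M) W : support f `<=` W -> ~ W x ->
  \forall y \near x, f y = 0.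
Proof.
move=> sW Wx; have : nbhs x (~` support f).
  apply: open_nbhs_nbhs; split; last by move=> /sW.
  by apply: closed_openC; exact: closed_closure.
apply: filterS => y /= sy; apply/eqP/negPn/negP => fy; apply: sy.
exact: subset_closure.
Qed.

(** A countable basis reduces the bumps supported in U or in V to a sequence to which the
    telescoping construction applies. A term counts towards [muU] if the support of its bump lies in
    U, and towards [muV] otherwise. *)
Lemma partition_of_unity_exists (U V : opens M) : U `|` V = [set: M] ->
  exists muU muV, partition_of_unity U V muU muV.
Proof.
move=> UV; have [B cB [oB bB]] := mfd_second_countable M.
have /countable_injP[f fi] := cB.
pose good (phi : 'C^oo(M)) := (forall x, 0 <= phi x <= 1) /\
  (support phi `<=` U \/ support phi `<=` V).
(* The index [i] is the code under [f] of a basic open set on which the bump is 1. *)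
pose P i (phi : 'C^oo(M)) := good phi /\
  exists A, [/\ B A, f A = i & forall x, A x -> phi x = 1].
pose phi i : 'C^oo(M) := if pselect (exists phi, P i phi) is left e then projT1 (cid e) else 0.
have goodphi i : good (phi i).
  rewrite /phi; case: pselect => [e|_]; first by have [] := projT2 (cid e).
  split=> [x|]; first by rewrite lexx ler01.
  left; rewrite /support (_ : mkset _ = set0) ?closure0 //.
  by apply/seteqP; split=> // x /=; rewrite eqxx.
have cover (x : M) : exists i, \forall y \near x, phi i y = 1.
  have [W [oW Wx WUV]] : exists W : set M, [/\ open W, W x & W `<=` U \/ W `<=` V].
    have : (U `|` V) x by rewrite UV.
    move=> [Ux|Vx]; [exists U|exists V]; (split=> //; first exact: oset_open).
      by left.
    by right.
  have [chi [chi01 chi1 suppchi]] := bump_exists oW Wx.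
  have [A [BA Ax] Achi] := bB x _ chi1.
  exists (f A); have : nbhs x A by apply: open_nbhs_nbhs; split=> //; exact: oB.
  apply: filterS => y Ay; rewrite /phi; case: pselect => [e|[]]; last first.
    exists chi; split; last by exists A; split.
    by split=> //; case: WUV => WW; [left|right]; exact: subset_trans WW.
  have [_ [A' [BA' fA' A'1]]] := projT2 (cid e); apply: A'1.
  by rewrite (fi A' A) //; exact/mem_set.
have p01 (x : M) j : 0 <= phi j x <= 1 by have [] := goodphi j.
pose idx (x : M) := projT1 (cid (cover x)).
have idxP (x : M) : \forall y \near x, phi (idx x) y = 1 := projT2 (cid (cover x)).
pose PU i := `[< support (phi i) `<=` U >].
(* The cut-off index varies with the point, but by [tele_sum_stable] [S Q] agrees near each point
   with one finite sum. *)
pose S Q (x : M) := tele_sum phi Q (idx x).+1 x.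
have SE Q (x : M) : \forall y \near x, S Q y = tele_sum phi Q (idx x).+1 y.
  apply: filterS (idxP x) => y xy; have yy := nbhs_singleton (idxP y).
  pose m := maxn (idx x).+1 (idx y).+1.
  by rewrite /S -(tele_sum_stable Q yy (leq_maxr _ _ : (_ <= m)%N))
    -(tele_sum_stable Q xy (leq_maxl _ _ : (_ <= m)%N)).
have sphi i : smooth M setT (phi i) by apply/smooth_predP; exact: valP.
have Ssm Q : smooth M setT (S Q).
  apply: smooth_local => [|x _]; first exact: openT.
  have : nbhs x [set y | S Q y = tele_sum phi Q (idx x).+1 y] by exact: SE.
  rewrite nbhsE => -[N [oN Nx] NS]; exists N; split=> //.
  rewrite setIT; apply: smooth_ext (smooth_sub (@subsetT _ _) (smooth_tele_sum Q (idx x).+1 sphi)).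
  by move=> y /NS.
have supp (Q : pred nat) (W : opens M) :
    (forall i, Q i -> support (phi i) `<=` W) -> support (S Q) `<=` W.
  move=> QW x; apply: contraPP => Wx; rewrite /support => xS.
  (* Finitely many terms matter near [x], so the neighbourhoods on which they vanish have an open
     intersection. *)
  have : \forall y \near x, forall i : 'I_(idx x).+1, Q i -> phi i y = 0.
    apply: filter_forall => i; case Qi : (Q i); last by near=> y.
    by apply: filterS (support_out (QW i Qi) Wx).
  move=> /(filterI (SE Q x))/xS[y [/= Sy [SE' py]]]; move: Sy; rewrite SE'.
  by rewrite /tele_sum big1 ?eqxx // => i Qi; rewrite /tele py // mul0r.
exists (SmoothFun (asboolT (Ssm PU))), (SmoothFun (asboolT (Ssm (predC PU)))); split => /=.
- by move=> x; apply: sumr_ge0 => i _; exact: tele_ge0.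
- by move=> x; apply: sumr_ge0 => i _; exact: tele_ge0.
- move=> x; rewrite /S /tele_sum -[LHS](bigID (fun i : 'I_(idx x).+1 => PU i) xpredT) /=.
  rewrite tele_sumT (bigD1 ord_max) //= (nbhs_singleton (idxP x)).
  by rewrite subrr mul0r subr0.
- by apply: supp => i /asboolP.
apply: supp => i /= /asboolP Ui; have [_ [|]] := goodphi i => //.
Unshelve. all: by end_near.
Qed.

End PartitionOfUnity.

(** * Sections and forms over open subsets *)

Section SectionModule.
Variables (R : realType) (n : nat) (M : manifold R n) (r : nat) (E : vbundle M r).

(* An alias, because [Sect E] is already a module over R. *)
Definition Csect := Sect E.
HB.instance Definition _ := GRing.Zmodule.copy Csect (Sect E).

Lemma sectP (s s' : 'Gamma(E)) : (forall x, s x = s' x) -> s = s'.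
Proof. by move=> e; apply/val_inj/functional_extensionality_dep => x; exact: e. Qed.

Lemma sectD (s s' : 'Gamma(E)) x : (s + s') x = s x + s' x.
Proof. by []. Qed.

Lemma sectN (s : 'Gamma(E)) x : (- s) x = - s x.
Proof. by []. Qed.

Lemma sectB (s s' : 'Gamma(E)) x : (s - s') x = s x - s' x.
Proof. by []. Qed.

Lemma sectZ c (s : 'Gamma(E)) x : (c *: s) x = c *: s x.
Proof. by []. Qed.

Lemma fscaleE f (s : 'Gamma(E)) x : fscale f s x = f x *: s x.
Proof. by []. Qed.

Fact fscaleA f g (s : Csect) : fscale f (fscale g s) = fscale (f * g) s.
Proof. by apply: sectP => x; rewrite !fscaleE scalerA. Qed.
Fact fscale1 : left_id (1 : 'C^oo(M)) (fun f (s : Csect) => (fscale f s : Csect)).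
Proof. by move=> s; apply: sectP => x; rewrite !fscaleE scale1r. Qed.
Fact fscaleDr : right_distributive (fun f (s : Csect) => (fscale f s : Csect)) +%R.
Proof. by move=> f s s'; apply: sectP => x; rewrite !(fscaleE, sectD) scalerDr. Qed.
Fact fscaleDl (s : Csect) : {morph (fun f => (fscale f s : Csect)) : f g / f + g}.
Proof. by move=> f g; apply: sectP => x; rewrite !(fscaleE, sectD) scalerDl. Qed.
HB.instance Definition _ :=
  GRing.Zmodule_isLmodule.Build 'C^oo(M) Csect fscaleA fscale1 fscaleDr fscaleDl.

Lemma CsectZ (f : 'C^oo(M)) (s : Csect) : f *: s = fscale f s.
Proof. by []. Qed.

Lemma sect_sum (I : Type) (q : seq I) (P : pred I) (F : I -> Csect) x :
  (\sum_(i <- q | P i) F i : Csect) x = \sum_(i <- q | P i) F i x.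
Proof. by elim/big_rec2: _ => // i y z _ <-. Qed.

Lemma CsectZE (f : 'C^oo(M)) (s : Csect) x : sect_fun (f *: s) x = f x *: sect_fun s x.
Proof. by []. Qed.

End SectionModule.

Section SmoothFunctionValues.
Variables (R : realType) (n : nat) (M : manifold R n).
Implicit Types f g : 'C^oo(M).

Lemma cfunP f g : (forall x, f x = g x) -> f = g.
Proof. by move=> e; apply/val_inj/funext. Qed.

Lemma cfunD f g x : (f + g) x = f x + g x. Proof. by []. Qed.
Lemma cfunN f x : (- f) x = - f x. Proof. by []. Qed.
Lemma cfunM f g x : (f * g) x = f x * g x. Proof. by []. Qed.
Lemma cfun1 x : (1 : 'C^oo(M)) x = 1. Proof. by []. Qed.
Lemma cfunZ c f x : (c *: f) x = c * f x. Proof. by []. Qed.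
Lemma cfunX f m x : (f ^+ m) x = f x ^+ m.
Proof. by elim: m => [|m IH]; rewrite ?expr0 // !exprS cfunM IH. Qed.
Lemma cfun_nat m x : (m%:R : 'C^oo(M)) x = m%:R.
Proof. by elim: m => [|m IH]; rewrite ?mulr0n // !mulrS cfunD IH. Qed.

Lemma smoothC f D : smooth M D f.
Proof. by apply: smooth_sub (@subsetT _ _) _; apply/smooth_predP; exact: valP. Qed.

End SmoothFunctionValues.

(** * Cutting off and extending by zero *)

Section PartialSmoothness.
Variables (R : realType) (n : nat) (M : manifold R n).
Implicit Types (D : set M) (f h : M -> R).

Lemma smooth_unval (W : opens M) D f :
  smooth (open_mfd W) ((fun x : W => val x) @^-1` D) (fun x : open_mfd W => f (val x)) ->
  smooth M (D `&` W) f.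
Proof.
move=> sf c Mc; have [g sg fg] := sf _ (imageP _ Mc); exists g.
  move=> k; apply: Ck_sub (sg k) => _ [x [[Dx Wx] dx] <-].
  by exists (exist _ x (mem_set Wx) : W).
move=> x /set_mem[[Dx Wx] dx].
by apply: (fg (exist _ x (mem_set Wx) : W)); apply/mem_set.
Qed.

Lemma smooth_val_sub (W : opens M) D f : smooth M (D `&` W) f ->
  smooth (open_mfd W) ((fun x : W => val x) @^-1` D) (fun x : open_mfd W => f (val x)).
Proof.
move=> sf; apply: smooth_sub (smooth_val (W := W) sf).
by move=> x Dx; split=> //; exact: set_mem (valP x).
Qed.

(** On [W] the function is a product of smooth functions; at a point outside [W] it vanishes nearby,
    because [mu] is 0 on a whole neighbourhood and not merely at that point. *)
Lemma smooth_cut (W : opens M) (mu : 'C^oo(M)) D f h : open D ->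
  (forall x, D x -> ~ oset W x -> \forall y \near x, mu y = 0) ->
  smooth M (D `&` W) f -> (forall x, D x -> oset W x -> h x = mu x * f x) ->
  (forall x, D x -> ~ oset W x -> h x = 0) -> smooth M D h.
Proof.
move=> oD mu0 sf hW hN; apply: smooth_local => // x Dx.
have [Wx|Wx] := pselect (oset W x).
  have oW : open (D `&` W) by apply: openI => //; exact: oset_open.
  exists (D `&` W); split=> //; apply: (@smooth_sub _ _ _ (D `&` W)); first by move=> ? [].
  apply: smooth_ext (smoothM oW (smoothC mu _) sf) => y [Dy Wy].
  by rewrite hW.
have : nbhs x [set y | mu y = 0] by exact: mu0.
rewrite nbhsE => -[N [oN Nx] NS]; exists N; split=> //.
apply: smooth_ext (smooth_cst _ 0) => y [Ny Dy].
by have [Wy|Wy] := pselect (oset W y); [rewrite hW // NS // mul0r|rewrite hN].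
Qed.

Lemma near_val (W : opens M) (x : open_mfd W) (P : M -> Prop) :
  (\forall y \near x, P (val y)) -> \forall z \near val x, P z.
Proof.
move=> H; have : nbhs x [set y : open_mfd W | P (val y)] by exact: H.
rewrite nbhsE => -[N [oN Nx] NP].
have : nbhs (val x) ((fun x : W => val x) @` N).
  by apply: open_nbhs_nbhs; split; [exact: open_val_image|exists x].
by apply: filterS => _ [y Ny <-]; exact: NP.
Qed.

Lemma near_unval (W : opens M) (x : open_mfd W) (P : M -> Prop) :
  (\forall z \near val x, P z) -> \forall y \near x, P (val y).
Proof. by move=> h; exact: (@val_continuous _ _ _ W x _ h). Qed.

End PartialSmoothness.

Section Extension.
Variables (R : realType) (n : nat) (M : manifold R n).

(** The family [F] is left open so that functions, sections and forms share one extension by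
    zero. *)
Definition ext0 (F : M -> lmodType R) (W : opens M)
    (s : forall x : open_mfd W, F (val x)) x : F x :=
  if pselect (oset W x) is left Wx then s (exist _ x (mem_set Wx)) else 0.

Lemma ext0_in (F : M -> lmodType R) (W : opens M)
    (s : forall x : open_mfd W, F (val x)) (x : open_mfd W) :
  ext0 s (val x) = s x.
Proof.
rewrite /ext0; case: pselect => [Wx|[]]; last exact: set_mem (valP x).
case: x Wx => x Wx Wx' /=; by rewrite (Prop_irrelevance (mem_set Wx') Wx).
Qed.

Lemma ext0_out (F : M -> lmodType R) (W : opens M) (s : forall x : open_mfd W, F (val x)) x :
  ~ oset W x -> ext0 s x = 0.
Proof. by rewrite /ext0; case: pselect. Qed.

End Extension.

Section PartialSections.
Variables (R : realType) (n : nat) (M : manifold R n) (r : nat) (E : vbundle M r).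

Lemma tcoordD (u : triv E r) x (a : R) (y z : E x) j : trivs u -> tdom u x ->
  tcoord u (a *: y + z) 0 j = a * tcoord u y 0 j + tcoord u z 0 j.
Proof. by move=> Bu ux; have [lc _ _] := trivP Bu ux; rewrite lc !mxE. Qed.

Lemma tcoord0 (u : triv E r) x j : trivs u -> tdom u x -> tcoord u (0 : E x) 0 j = 0.
Proof.
move=> Bu ux; rewrite -[0 in LHS]addr0 -[X in X + _](scaler0 _ (-1)).
by rewrite tcoordD // mulN1r addNr.
Qed.

Lemma tcoordZ (u : triv E r) x (a : R) (y : E x) j : trivs u -> tdom u x ->
  tcoord u (a *: y) 0 j = a * tcoord u y 0 j.
Proof. by move=> Bu ux; rewrite -[a *: y]addr0 tcoordD // tcoord0 // addr0. Qed.

Lemma frame_decomposition x (t : triv E r) (a : E x) : trivs t -> tdom t x ->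
  a = \sum_(l < r) tcoord t a 0 l *: tframe t x (delta_mx 0 l).
Proof. exact: frame_decomp. Qed.

(** The family lives over all of M and is smooth over [W] only: partial sections can be cut off and
    compared without changing the base manifold. *)
Definition sect_on (W : set M) (s : dfun E) := forall t, trivs t -> forall j : 'I_r,
  smooth M (tdom t `&` W) (fun x => tcoord t (s x) 0 j).

Lemma sect_onT s : sect_on setT s -> exists h : 'Gamma(E), forall x, h x = s x.
Proof.
move=> Hs; suff H : s \in is_section E by exists (MkSect H).
by apply/asboolP => t Bt j; have := Hs t Bt j; rewrite setIT.
Qed.

Lemma sect_on_ext0 (W : opens M) (s : 'Gamma(E \|_ W)) : sect_on W (ext0 (F := E) s).
Proof.
move=> t Bt j; apply: smooth_unval; have /asboolP ss := valP s.
apply: smooth_ext (ss _ (imageP (open_triv W) Bt) j) => x _.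
by rewrite (ext0_in (F := E)).
Qed.

Lemma sect_on_cut (W' W : opens M) (mu : 'C^oo(M)) (s : dfun E) : W' `<=` W ->
  (forall x, oset W x -> ~ oset W' x -> \forall y \near x, mu y = 0) ->
  sect_on W' s -> (forall x, ~ oset W' x -> s x = 0) -> sect_on W (fun x => mu x *: s x).
Proof.
move=> sW mu0 Hs s0 t Bt j.
apply: (@smooth_cut _ _ _ W' mu _ (fun x => tcoord t (s x) 0 j)).
- by apply: openI; [exact: triv_open|exact: oset_open].
- by move=> x [_ Wx]; exact: mu0.
- by apply: smooth_sub (Hs t Bt j) => x [[tx _] ?].
- by move=> x [tx _] _; rewrite tcoordZ.
by move=> x [tx _] Wx; rewrite s0 // scaler0 tcoord0.
Qed.

End PartialSections.

Section PartialForms.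
Variables (R : realType) (n : nat) (M : manifold R n).
Variables (rA rE : nat) (A : vbundle M rA) (E : vbundle M rE) (k : nat).
Local Notation fam := (form_family A E k).

(** All maps, alternating or not: this is the module in which [ext0] takes the values of a form. *)
Definition alt_fiber (x : M) : lmodType R := (('I_k -> A x) -> E x).

Definition form_on (W : set M) (w : fam) :=
  [/\ forall x, W x -> multilinear (w x), forall x, W x -> alternating (w x) &
   forall t u, trivs t -> trivs u -> forall (I : 'I_k -> 'I_rA) (j : 'I_rE),
     smooth M ((tdom t `&` tdom u) `&` W)
       (fun x => tcoord u (w x (fun i => tframe t x (delta_mx 0 (I i)))) 0 j)].

Lemma formP (w h : 'Omega^k(A, E)) : (forall x v, w x v = h x v) -> w = h.
Proof.
move=> e; apply/val_inj/functional_extensionality_dep => x; apply/funext => v.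
exact: e.
Qed.

Lemma form_onT w : form_on setT w -> exists h : 'Omega^k(A, E), forall x v, h x v = w x v.
Proof.
move=> [mw aw sw]; suff H : w \in is_form A E k by exists (MkForm H).
apply/is_formP; split=> [x|x|t u Bt Bu I j]; [exact: mw|exact: aw|].
by have := sw t u Bt Bu I j; rewrite setIT.
Qed.

Lemma form_on_res (W : opens M) w : form_on W w ->
  exists h : 'Omega^k(A \|_ W, E \|_ W), forall (x : open_mfd W) v, h x v = w (val x) v.
Proof.
move=> [mw aw sw].
suff H : (fun x : open_mfd W => w (val x)) \in is_form (A \|_ W) (E \|_ W) k by exists (MkForm H).
have Wv (x : open_mfd W) : oset W (val x) := set_mem (valP x).
apply/is_formP; split=> [x|x|_ _ [t Bt <-] [u Bu <-] I j]; [exact: mw|exact: aw|].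
exact: (smooth_val_sub (sw t u Bt Bu I j)).
Qed.

Lemma form_on_ext0 (W : opens M) (w : 'Omega^k(A \|_ W, E \|_ W)) :
  form_on W (ext0 (F := alt_fiber) (form_fun w)).
Proof.
have /is_formP[mw aw sw] := valP w; split.
- move=> x Wx; have := ext0_in (F := alt_fiber) (form_fun w) (exist _ x (mem_set Wx)).
  by move=> /= ->; exact: (mw (exist _ x (mem_set Wx))).
- move=> x Wx; have := ext0_in (F := alt_fiber) (form_fun w) (exist _ x (mem_set Wx)).
  by move=> /= ->; exact: (aw (exist _ x (mem_set Wx))).
move=> t u Bt Bu I j; apply: smooth_unval.
apply: smooth_ext (sw _ _ (imageP (open_triv W) Bt) (imageP (open_triv W) Bu) I j) => x _.
by rewrite (ext0_in (F := alt_fiber) (form_fun w)).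
Qed.

Lemma form_on_cut (W' W : opens M) (mu : 'C^oo(M)) (w : fam) : W' `<=` W ->
  (forall x, oset W x -> ~ oset W' x -> \forall y \near x, mu y = 0) ->
  form_on W' w -> (forall x v, ~ oset W' x -> w x v = 0) ->
  form_on W (fun x v => mu x *: w x v).
Proof.
move=> sW mu0 [mw aw sw] w0; split.
- move=> x Wx v i c a b; have [Wx'|Wx'] := pselect (oset W' x).
    by rewrite mw // scalerDr !scalerA mulrC.
  by rewrite !w0 // !scaler0 addr0.
- move=> x Wx v i j ij vij; have [Wx'|Wx'] := pselect (oset W' x).
    by rewrite (aw _ _ _ _ _ ij vij) // scaler0.
  by rewrite w0 // scaler0.
move=> t u Bt Bu I j.
apply: (@smooth_cut _ _ _ W' mu _
  (fun x => tcoord u (w x (fun i => tframe t x (delta_mx 0 (I i)))) 0 j)).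
- by apply: openI; [apply: openI; exact: triv_open|exact: oset_open].
- by move=> x [_ Wx]; exact: mu0.
- by apply: smooth_sub (sw t u Bt Bu I j) => x [[tx _] ?].
- by move=> x [[_ ux] _] _; rewrite tcoordZ.
by move=> x [[_ ux] _] Wx; rewrite w0 // scaler0 tcoord0.
Qed.

Lemma form_on_glue (U V : opens M) w : form_on U w -> form_on V w -> form_on (U `|` V) w.
Proof.
move=> [mU aU sU] [mV aV sV]; split.
- by move=> x [Ux|Vx]; [exact: mU|exact: mV].
- by move=> x [Ux|Vx]; [exact: aU|exact: aV].
move=> t u Bt Bu I j.
apply: smooth_local.
  by apply: openI; [apply: openI; exact: triv_open|apply: openU; exact: oset_open].
move=> x [tx [Wx|Wx]].
  exists U; split=> //; first exact: oset_open.
  by apply: smooth_sub (sU t u Bt Bu I j) => y [? []].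
exists V; split=> //; first exact: oset_open.
by apply: smooth_sub (sV t u Bt Bu I j) => y [? []].
Qed.

Lemma form_on_eq (W : set M) w w' : (forall x v, W x -> w x v = w' x v) ->
  form_on W w -> form_on W w'.
Proof.
move=> e [mw aw sw]; have E' x : W x -> w x = w' x by move=> Wx; apply/funext => v; exact: e.
split; [by move=> x Wx; rewrite -E' //; exact: mw|by move=> x Wx; rewrite -E' //; exact: aw|].
move=> t u Bt Bu I j; apply: smooth_ext (sw t u Bt Bu I j) => x [_ Wx].
by rewrite E'.
Qed.

End PartialForms.

(** * Global representatives of germs and vectors *)

Section Extensions.
Variables (R : realType) (n : nat) (M : manifold R n).

Definition opensT : opens M := Opens openT.

Lemma cutoff_exists (W : opens M) (x0 : M) : oset W x0 ->
  exists chi : 'C^oo(M), [/\ \forall x \near x0, chi x = 1,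
    (forall x, ~ oset W x -> chi x = 0) &
    forall x, ~ oset W x -> \forall y \near x, chi y = 0].
Proof.
move=> Wx; have [chi [_ chi1 chiW]] := bump_exists (oset_open W) Wx.
have H x : ~ oset W x -> \forall y \near x, chi y = 0 by exact: support_out.
by exists chi; split=> // x /H /nbhs_singleton.
Qed.

(** Multiply by a cutoff that is 1 near the point and extend by zero; the two lemmas that follow do
    the same for sections and forms. *)
Lemma cfun_extend (W : opens M) (x : open_mfd W) (f : 'C^oo(open_mfd W)) :
  exists g : 'C^oo(M), \forall y \near x, res_fun W g y = f y.
Proof.
have [chi [chi1 _ chi0]] := cutoff_exists (set_mem (valP x) : oset W (val x)).
pose g z := chi z * ext0 (F := fun=> R^o) f z.
have sg : smooth M setT g.
  apply: (@smooth_cut _ _ _ W chi _ (ext0 (F := fun=> R^o) f)) => //.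
  - exact: openT.
  - by move=> z _; exact: chi0.
  - apply: smooth_unval; apply: smooth_ext (smoothC f _) => z _.
    by rewrite (ext0_in (F := fun=> R^o)).
  by move=> z _ Wz; rewrite /g (ext0_out (F := fun=> R^o)) // mulr0.
exists (SmoothFun (asboolT sg)); apply: filterS (near_unval chi1) => y /= c1.
by rewrite /g c1 mul1r (ext0_in (F := fun=> R^o)).
Qed.

Lemma sect_extend r (E : vbundle M r) (W : opens M) (x : open_mfd W) (s : 'Gamma(E \|_ W)) :
  exists g : 'Gamma(E), \forall y \near x, res_sect W g y = s y.
Proof.
have [chi [chi1 _ chi0]] := cutoff_exists (set_mem (valP x) : oset W (val x)).
have := @sect_on_cut _ _ _ _ E W opensT chi (ext0 (F := E) s) (@subsetT _ _).
case/(_ _ (sect_on_ext0 s) _)/sect_onT => [z _||g gE].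
- exact: chi0.
- by move=> z Wz; exact: (ext0_out (F := E)).
exists g; apply: filterS (near_unval chi1) => y c1.
by rewrite /= [LHS]gE c1 scale1r (ext0_in (F := E)).
Qed.

Lemma form_extend rA rE (A : vbundle M rA) (E : vbundle M rE) k (W : opens M)
    (x : open_mfd W) (w : 'Omega^k(A \|_ W, E \|_ W)) :
  exists g : 'Omega^k(A, E), \forall y \near x, forall v, res_form W g y v = w y v.
Proof.
have [chi [chi1 _ chi0]] := cutoff_exists (set_mem (valP x) : oset W (val x)).
have := @form_on_cut _ _ _ _ _ A E k W opensT chi (ext0 (F := alt_fiber A E k) (form_fun w))
  (@subsetT _ _).
case/(_ _ (form_on_ext0 w) _)/form_onT => [z _||g gE].
- exact: chi0.
- by move=> z v Wz; rewrite (ext0_out (F := alt_fiber A E k)).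
exists g; apply: filterS (near_unval chi1) => y c1 v.
by rewrite /= [LHS]gE c1 scale1r (ext0_in (F := alt_fiber A E k)).
Qed.

Section LocalFrame.
Variables (r : nat) (E : vbundle M r).

(** To become global, the frame and the coordinate functions each take up one factor [chi]; hence
    [chi * chi] in the decomposition. The coordinates are linear over smooth functions, so they can
    be composed with forms. *)
Lemma local_frame (t : triv E r) (x0 : M) : trivs t -> tdom t x0 ->
  exists (chi : 'C^oo(M)) (e : 'I_r -> 'Gamma(E))
    (f : 'I_r -> 'Gamma(E) -> 'C^oo(M)),
  [/\ (\forall x \near x0, chi x = 1) /\
      (\forall x \near x0, forall l, e l x = tframe t x (delta_mx 0 l)),
      forall l g s s', f l (fscale g s + s') = g * f l s + f l s',
      forall s, fscale (chi * chi) s = \sum_l fscale (f l s) (e l) &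
      forall l s, f l s x0 = tcoord t (s x0) 0 l].
Proof.
move=> Bt tx0; pose W := Opens (triv_open Bt).
have [chi [chi1 chiW chi0]] := @cutoff_exists W x0 tx0.
pose fr l : dfun E := fun x => if `[< tdom t x >] then tframe t x (delta_mx 0 l) else 0.
have sfr l : sect_on W (fr l).
  move=> u Bu j; have [_ _ H] := vbundle_atlas E.
  apply: smooth_ext (smooth_sub _ (H t u Bt Bu l j)); last by move=> y [].
  by move=> y [_ ty]; rewrite /fr asboolT.
have He l : exists e : 'Gamma(E), forall x, e x = chi x *: fr l x.
  have := @sect_on_cut _ _ _ _ E W opensT chi (fr l) (@subsetT _ _).
  case/(_ _ (sfr l) _)/sect_onT => [z _||e eE]; [exact: chi0| |by exists e].
  by move=> z Wz; rewrite /fr asboolF.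
pose e l := projT1 (cid (He l)); have eE l x : e l x = chi x *: fr l x := projT2 (cid (He l)) x.
pose cf l (s : 'Gamma(E)) x := if `[< tdom t x >] then chi x * tcoord t (s x) 0 l else 0.
have scf l s : smooth M setT (cf l s).
  apply: (@smooth_cut _ _ _ W chi _ (fun x => tcoord t (s x) 0 l)).
  - exact: openT.
  - by move=> z _; exact: chi0.
  - by rewrite setTI; have /asboolP ss := valP s; exact: ss.
  - by move=> x _ tx; rewrite /cf asboolT.
  by move=> x _ tx; rewrite /cf asboolF.
exists chi, e, (fun l s => SmoothFun (asboolT (scf l s))); split => //.
- split=> //; have : nbhs x0 (tdom t) by apply: open_nbhs_nbhs; split=> //; exact: triv_open.
  by apply: filterS2 chi1 => x c1 tx l; rewrite eE c1 scale1r /fr asboolT.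
- move=> l g s s'; apply: cfunP => x; rewrite cfunD cfunM /= /cf.
  case: asboolP => tx; last by rewrite mulr0 addr0.
  by rewrite tcoordD // mulrDr mulrCA.
- move=> s; apply: sectP => x; rewrite fscaleE cfunM [RHS]sect_sum.
  have [tx|tx] := pselect (tdom t x); last first.
    rewrite chiW // mulr0 scale0r big1 // => l _; rewrite fscaleE /= /cf asboolF //.
    by rewrite scale0r.
  rewrite [in LHS](frame_decomposition (s x) Bt tx) scaler_sumr; apply: eq_bigr => l _.
  by rewrite fscaleE /= /cf eE /fr !asboolT // !scalerA mulrAC.
by move=> l s; rewrite /= /cf asboolT // (nbhs_singleton chi1) mul1r.
Qed.

Lemma sect_through (x : M) (v : E x) : exists s : 'Gamma(E), s x = v.
Proof.
have [t Bt tx] := triv_cover E x.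
have [chi [e [f [[_ He] _ _ _]]]] := local_frame Bt tx.
exists (\sum_l (tcoord t v 0 l) *: (e l : Csect E)) .
rewrite [LHS]sect_sum [RHS](frame_decomposition v Bt tx); apply: eq_bigr => l _.
by rewrite [LHS]sectZ (nbhs_singleton He).
Qed.

(** As [chi x = 1], multiplying [s] by [chi * chi] does not change the value of [phi]. Expanded in
    the global frame, the product has coefficients that vanish at [x] along with [s]. *)
Lemma tensorial (X : lmodType R) (x : M) (phi : 'Gamma(E) -> X) :
  (forall g s s', phi (fscale g s + s') = g x *: phi s + phi s') ->
  forall s : 'Gamma(E), s x = 0 -> phi s = 0.
Proof.
move=> lphi s sx; have [t Bt tx] := triv_cover E x.
have [chi [e [f [[c1 _] _ fe fx]]]] := local_frame Bt tx.
have phi0 : phi 0 = 0.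
  have := lphi (-1) 0 0; rewrite addr0.
  rewrite (_ : fscale (-1) 0 = 0); last by apply: sectP => y; rewrite fscaleE scaler0.
  by rewrite cfunN cfun1 scaleN1r addNr.
have phiZ g s' : phi (fscale g s') = g x *: phi s'.
  by have := lphi g s' 0; rewrite !addr0 phi0 addr0.
have : phi (fscale (chi * chi) s) = phi s.
  by rewrite phiZ cfunM (nbhs_singleton c1) mulr1 scale1r.
move=> <-; rewrite fe; elim/big_rec: _ => // l y _ IH.
by rewrite lphi IH fx sx tcoord0 // scale0r addr0.
Qed.

(** This is the form in which a Leibniz rule proves locality: one factor and the section itself both
    vanish at [x]. *)
Lemma locally_zero (x : M) (s : 'Gamma(E)) : (\forall y \near x, s y = 0) ->
  exists2 g : 'C^oo(M), g x = 0 & s = fscale g s.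
Proof.
rewrite /prop_near1 nbhsE => -[N [oN Nx] s0].
have [chi [c1 cN _]] := @cutoff_exists (Opens oN) x Nx.
exists (1 - chi); first by rewrite cfunD cfunN cfun1 (nbhs_singleton c1) subrr.
apply: sectP => y; rewrite fscaleE; have [Ny|Ny] := pselect (N y).
  by rewrite s0 // scaler0.
by rewrite cfunD cfunN cfun1 cN // subr0 scale1r.
Qed.

Lemma is_section_local (s : dfun E) :
  (forall x : M, exists s' : 'Gamma(E), \forall y \near x, s' y = s y) ->
  exists h : 'Gamma(E), forall x, h x = s x.
Proof.
move=> H; apply: sect_onT => t Bt j; apply: smooth_local.
  by apply: openI; [exact: triv_open|exact: openT].
move=> x _; have [s'] := H x; rewrite /prop_near1 nbhsE => -[N [oN Nx] ss'].
exists N; split=> //; have /asboolP/(_ t Bt j) hs := valP s'.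
apply: smooth_ext (smooth_sub (D' := N `&` (tdom t `&` setT)) _ hs); last by move=> y [_ []].
by move=> y [/ss' <-].
Qed.

End LocalFrame.

Lemma cfun_locally_zero (x : M) (f : 'C^oo(M)) : (\forall y \near x, f y = 0) ->
  exists2 g : 'C^oo(M), g x = 0 & f = g * f.
Proof.
rewrite /prop_near1 nbhsE => -[N [oN Nx] s0].
have [chi [c1 cN _]] := @cutoff_exists (Opens oN) x Nx.
exists (1 - chi); first by rewrite cfunD cfunN cfun1 (nbhs_singleton c1) subrr.
apply: cfunP => y; rewrite cfunM; have [Ny|Ny] := pselect (N y).
  by rewrite s0 // mulr0.
by rewrite cfunD cfunN cfun1 cN // subr0 mul1r.
Qed.

Lemma cfun_local (f : M -> R) :
  (forall x : M, exists f' : 'C^oo(M), \forall y \near x, f' y = f y) ->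
  f \in smooth_pred M.
Proof.
move=> H; apply/smooth_predP; apply: smooth_local => [|x _]; first exact: openT.
have [f'] := H x; rewrite /prop_near1 nbhsE => -[N [oN Nx] ff'].
exists N; split=> //; apply: smooth_ext (smoothC f' _) => y [Ny _].
exact: ff'.
Qed.

End Extensions.

(** * Forms as alternating multilinear maps on sections *)

Section ListOfForm.
Variables (R : realType) (n : nat) (M : manifold R n).
Variables (rA rE : nat) (A : vbundle M rA) (E : vbundle M rE).

Section Degree.
Variable k : nat.
Implicit Types w : 'Omega^k(A, E).

Definition lform w : seq (Csect A) -> Csect E := fun s =>
  if size s == k then contract w (fun i => nth 0 s i) else 0.

Lemma lform_args w (a : 'I_k -> 'Gamma(A)) : lform w (args a) = contract w a.
Proof.
rewrite /lform size_args eqxx; congr (contract w _); apply/funext => i.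
by rewrite nth_args.
Qed.

Lemma lform_argsE w (a : 'I_k -> 'Gamma(A)) x :
  sect_fun (lform w (args a)) x = w x (fun i => a i x).
Proof. by rewrite lform_args. Qed.

Lemma lform_supp w : supp_l k (lform w).
Proof. by move=> s /negPf sk; rewrite /lform sk. Qed.

Lemma form_multilinear w x : multilinear (w x).
Proof. by have /is_formP[+ _ _] := valP w; apply. Qed.

Lemma form_alternating w x : alternating (w x).
Proof. by have /is_formP[_ + _] := valP w; apply. Qed.

Lemma lform_mlin w : mlin (lform w).
Proof.
move=> s1 s2 f a b; rewrite /lform !size_cat /=.
case: eqP => [sk|]; last by rewrite scaler0 addr0.
have ik : (size s1 < k)%N by rewrite -sk addnS ltnS leq_addr.
apply: sectP => x.
have H c : (fun i : 'I_k => sect_fun (nth 0 (s1 ++ c :: s2) i) x) =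
    upd (fun i => sect_fun (nth 0 (s1 ++ 0 :: s2) i) x) (Ordinal ik) (sect_fun c x).
  apply/funext => i; rewrite /upd -(inj_eq val_inj) !nth_cat /=.
  have [->|ne] := eqVneq (nat_of_ord i) (size s1); first by rewrite ltnn subnn.
  case: ifP => //; rewrite ltnNge => /negbFE; rewrite leq_eqVlt eq_sym (negPf ne) /=.
  by rewrite -subn_gt0; case: (i - size s1)%N.
have K c := congr1 (w x) (H c).
apply: etrans (K _) _.
apply: etrans (@form_multilinear w x _ _ (f x) (sect_fun a x) (sect_fun b x)) _.
transitivity (f x *: sect_fun (contract w (fun i => nth 0 (s1 ++ a :: s2) i)) x +
  sect_fun (contract w (fun i => nth 0 (s1 ++ b :: s2) i)) x); last by [].
by congr (_ *: _ + _); rewrite -K.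
Qed.

Lemma lform_altl w : altl (lform w).
Proof.
move=> s1 s2 a; rewrite /lform size_cat /=.
case: eqP => // sk.
have ik : (size s1 < k)%N by rewrite -sk addnS ltnS leq_addr.
have jk : ((size s1).+1 < k)%N by rewrite -sk !addnS !ltnS leq_addr.
apply: sectP => x; apply: (@form_alternating w x _ (Ordinal ik) (Ordinal jk)).
  by rewrite -(inj_eq val_inj) /= ltn_eqF.
by rewrite /= !nth_cat ltnn subnn ltnNge leqnSn /= subSnn.
Qed.

Lemma form_eq w w' :
  (forall a x, w x (fun i : 'I_k => sect_fun (a i) x) = w' x (fun i => sect_fun (a i) x)) ->
  w = w'.
Proof.
move=> e; apply: formP => x v.
have H i := cid (sect_through (v i)).
have -> : v = fun i => projT1 (H i) x by apply/funext => i; rewrite (projT2 (H i)).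
exact: e.
Qed.

Lemma lform_inj : injective lform.
Proof.
move=> w w' e; apply: form_eq => a x.
by rewrite -!lform_argsE e.
Qed.

End Degree.

Section FormOfList.
Variables (k : nat) (F : seq (Csect A) -> Csect E).
Hypotheses (mF : mlin F) (aF : altl F) (sF : supp_l k F).

(** The entries are replaced one at a time, each by [tensorial] applied to a difference. *)
Lemma mlin_tensorial x s1 s s' : size s = size s' ->
  (forall i, sect_fun (nth 0 s i) x = sect_fun (nth 0 s' i) x) ->
  sect_fun (F (s1 ++ s)) x = sect_fun (F (s1 ++ s')) x.
Proof.
elim: s s' s1 => [|a s IH] [|b s'] s1 //= [ss] e.
transitivity (sect_fun (F (s1 ++ b :: s)) x).
  apply/eqP; rewrite -subr_eq0; apply/eqP.
  rewrite -sectB -[X in sect_fun X x](_ : F (s1 ++ (a - b) :: s) = _); last first.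
    by rewrite (mlinD _ _ _ _ mF) (mlinN _ _ _ mF).
  apply: (@tensorial _ _ _ _ A _ x (fun c => sect_fun (F (s1 ++ (c : Csect A) :: s)) x)).
    by move=> g c c'; rewrite -CsectZ mF.
  by rewrite sectB (e 0%N) subrr.
by rewrite -!cat_rcons; apply: IH => // i; exact: (e i.+1).
Qed.

Lemma mlin_args_tensorial x (a b : 'I_k -> Csect A) :
  (forall i, sect_fun (a i) x = sect_fun (b i) x) ->
  sect_fun (F (args a)) x = sect_fun (F (args b)) x.
Proof.
move=> e; apply: (mlin_tensorial [::]); first by rewrite !size_args.
move=> i; have [ik|ik] := ltnP i k; last by rewrite !nth_default ?size_args.
by rewrite -[i]/(val (Ordinal ik)) !nth_args.
Qed.

Lemma args_upd (a : 'I_k -> Csect A) i c :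
  args (fun j => if j == i then c else a j) = take i (args a) ++ c :: drop i.+1 (args a).
Proof.
have ik := ltn_ord i.
apply: (@eq_from_nth _ 0).
  by rewrite size_cat /= size_take size_drop !size_args ik addnS -addSn subnKC.
rewrite size_args => j jk; rewrite -[j in LHS]/(val (Ordinal jk)) nth_args.
rewrite nth_cat size_take size_args ik -(inj_eq val_inj) /=.
have [->|ne] := eqVneq j (nat_of_ord i); first by rewrite ltnn subnn.
case: ifP => ji; first by rewrite nth_take // -(nth_args 0).
have ij : (i < j)%N.
  by move/negbT: ji; rewrite -leqNgt leq_eqVlt eq_sym (negPf ne).
by rewrite -(nth_args 0) /= -(subnSK ij) /= nth_drop subnKC.
Qed.

Definition extend_vectors (x : M) (v : 'I_k -> A x) (i : 'I_k) : Csect A :=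
  projT1 (cid (sect_through (v i))).

Lemma extend_vectorsE (x : M) (v : 'I_k -> A x) i : sect_fun (extend_vectors v i) x = v i.
Proof. exact: projT2 (cid (sect_through (v i))). Qed.

(** Vectors are extended to chosen global sections; by [evE] any other extensions give the same
    value. *)
Let ev : form_family A E k := fun x v => sect_fun (F (args (extend_vectors v))) x.

Lemma evE x (a : 'I_k -> Csect A) : ev (fun i => sect_fun (a i) x) = sect_fun (F (args a)) x.
Proof. by apply: mlin_args_tensorial => i; rewrite extend_vectorsE. Qed.

(** Linearity and alternation are checked on global sections through the given vectors. For
    smoothness, the local frame is replaced near each point by global sections that agree with it
    there. *)
Lemma form_of_list : exists w : 'Omega^k(A, E), lform w = F.
Proof.
have [w wE] : exists w : 'Omega^k(A, E), forall x v, w x v = ev v.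
  apply: form_onT; split.
  - move=> x _ v i c a b; pose s := extend_vectors v.
    have [sa saE] := sect_through a; have [sb sbE] := sect_through b.
    have H d (sd : Csect A) : sect_fun sd x = d -> ev (upd v i d) =
        sect_fun (F (take i (args s) ++ sd :: drop i.+1 (args s))) x.
      move=> <-; rewrite -args_upd -evE; congr ev; apply/funext => j; rewrite /upd.
      by case: eqP => // _; rewrite extend_vectorsE.
    pose cc : 'C^oo(M) := SmoothFun (asboolT (smooth_cst setT c)).
    rewrite (H a sa) // (H b sb) // (H (c *: a + b) (cc *: (sa : Csect A) + sb)); last first.
      by rewrite sectD CsectZE saE sbE.
    by rewrite mF.
  - move=> x _ v i j ij vij; rewrite /ev.
    (* The chosen extension of a vector depends on that vector alone, so equal vectors have equal
       extensions. *)
    pose s := extend_vectors v; have sij : s i = s j by rewrite /s /extend_vectors vij.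
    rewrite -/s.
    by rewrite (altl_args mF aF ij sij).
  move=> t u Bt Bu I j; apply: smooth_local.
    by apply: openI; [apply: openI; exact: triv_open|exact: openT].
  move=> x0 [[tx ux] _].
  have He l : exists e : 'Gamma(A), \forall x \near x0, e x = tframe t x (delta_mx 0 l).
    have [chi [e [_ [[_ He] _ _ _]]]] := local_frame Bt tx.
    by exists (e l); apply: filterS He => x; apply.
  pose e l := projT1 (cid (He l)).
  have : \forall x \near x0, forall i, e (I i) x = tframe t x (delta_mx 0 (I i)).
    by apply: filter_forall => i; exact: projT2 (cid (He (I i))).
  rewrite /prop_near1 nbhsE => -[N [oN Nx] eN]; exists N; split=> //.
  have /asboolP/(_ u Bu j) := valP (F (args (fun i => e (I i))) : 'Gamma(E)).
  move=> /(smooth_sub (D' := N `&` ((tdom t `&` tdom u) `&` setT))) => /(_ _)Hs.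
  apply: smooth_ext (Hs _) => [x [Nx' _]|x [_ [[]]]//].
  congr (tcoord u _ 0 j); rewrite -[LHS]evE; congr (ev _).
  by apply/funext => i; rewrite eN.
exists w; apply/funext => s; have [sk|sk] := eqVneq (size s) k; last first.
  by rewrite lform_supp // sF.
rewrite -(argsK 0 sk); apply: sectP => x; rewrite lform_argsE wE.
exact: evE.
Qed.

End FormOfList.

End ListOfForm.

Lemma definiteP (T : Type) (x0 : T) (P : T -> Prop) : (exists x, P x) -> P (definite x0 P).
Proof. by rewrite /definite; case: pselect => // e _; exact: projT2 (cid e). Qed.

Section CfunSums.
Variables (R : realType) (n : nat) (M : manifold R n).

Lemma cfun_sum (I : Type) (q : seq I) (P : pred I) (F : I -> 'C^oo(M)) x :
  (\sum_(i <- q | P i) F i) x = \sum_(i <- q | P i) F i x.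
Proof. by elim/big_rec2: _ => // i y z _ <-. Qed.

Lemma cfun_sign m x : ((-1) ^+ m : 'C^oo(M)) x = (-1) ^+ m.
Proof. by rewrite cfunX cfunN cfun1. Qed.

End CfunSums.

(** * The Lie-Rinehart pair of a Lie algebroid and its locality *)

Section LieRinehart.
Variables (R : realType) (n : nat) (M : manifold R n) (rA : nat) (A : vbundle M rA).
Variable L : lie_algebroid A.
Local Notation G := (Csect A).
Implicit Types (a b c : G) (f g : 'C^oo(M)).

Definition lbr : G -> G -> G := bracket L.
Definition lrho : G -> 'C^oo(M) -> 'C^oo(M) := rho L.

Lemma lbrD a b c : lbr a (b + c) = lbr a b + lbr a c.
Proof. by have := bracket_linearr L a 1 b c; rewrite !scale1r. Qed.

Lemma lbrDl a b c : lbr (a + b) c = lbr a c + lbr b c.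
Proof. by have := bracket_linearl L c 1 a b; rewrite !scale1r. Qed.

Lemma lbr_alt a : lbr a a = 0.
Proof. exact: bracket_alt. Qed.

Lemma lbrC a b : lbr a b = - lbr b a.
Proof.
have := lbr_alt (a + b); rewrite lbrD !lbrDl !lbr_alt add0r addr0.
by rewrite addrC => /eqP; rewrite addr_eq0 => /eqP.
Qed.

Lemma lbrM a f b : lbr a (f *: b) = f *: lbr a b + lrho a f *: b.
Proof. exact: bracket_leibniz. Qed.

Lemma lbrN a b : lbr a (- b) = - lbr a b.
Proof.
have lbr0 : lbr a 0 = 0 by apply: (@addrI _ (lbr a 0)); rewrite -lbrD !addr0.
by apply/eqP; rewrite -addr_eq0 -lbrD addNr lbr0.
Qed.

Lemma lbr_jacobi a b c : lbr a (lbr b c) - lbr b (lbr a c) = lbr (lbr a b) c.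
Proof.
have : lbr a (lbr b c) + lbr b (lbr c a) + lbr c (lbr a b) = 0 := bracket_jacobi L a b c.
rewrite [lbr c a]lbrC lbrN [lbr c _]lbrC => /eqP.
by rewrite subr_eq0 => /eqP.
Qed.

Lemma lrhoD a f g : lrho a (f + g) = lrho a f + lrho a g.
Proof.
apply: cfunP => x; have [lin _] := anchor_tangent L (a x).
by have := lin 1 f g; rewrite scale1r mul1r.
Qed.

Lemma lrhoB a f g : lrho a (f - g) = lrho a f - lrho a g.
Proof. by apply/eqP; rewrite eq_sym subr_eq -lrhoD subrK. Qed.

Lemma lrhoM a f g : lrho a (f * g) = f * lrho a g + lrho a f * g.
Proof.
apply: cfunP => x; have [_ der] := anchor_tangent L (a x).
by rewrite cfunD !cfunM [in RHS]mulrC [_ * g x]mulrC [_ * f x]mulrC; exact: der.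
Qed.

Lemma lrhol f a b g : lrho (f *: a + b) g = f *: (lrho a g : 'C^oo(M)^o) + lrho b g.
Proof. by apply: cfunP => x; exact: anchor_linear. Qed.

(** Write [f - g = h * (f - g)] with [h x = 0]: a derivation at [x] kills a product of two functions
    vanishing there. *)
Lemma anchor_local x (v : A x) f g : (\forall y \near x, f y = g y) ->
  anchor L v f = anchor L v g.
Proof.
move=> fg; have [lin der] := anchor_tangent L v.
have z0 : anchor L v 0 = 0 by have := lin (-1) 0 0; rewrite scaler0 addr0 mulN1r addNr.
have [h hx h0] : exists2 h : 'C^oo(M), h x = 0 & f - g = h * (f - g).
  by apply: cfun_locally_zero; apply: filterS fg => y; rewrite cfunD cfunN => ->; rewrite subrr.
have : anchor L v (f - g) = 0.
  rewrite h0 der hx mul0r add0r cfunD cfunN (nbhs_singleton fg) subrr mul0r.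
  by [].
move=> fg0; have := lin 1 (f - g) g; rewrite scale1r subrK => ->.
by rewrite mul1r fg0 add0r.
Qed.

Lemma bracket_localr x (a b : 'Gamma(A)) : (\forall y \near x, b y = 0) ->
  bracket L a b x = 0.
Proof.
move=> b0; have [g gx ->] := locally_zero b0.
rewrite bracket_leibniz sectD !fscaleE gx scale0r add0r.
by rewrite (nbhs_singleton b0) scaler0.
Qed.

(** The Leibniz rule gives locality in the second argument, and antisymmetry transfers it to the
    first. *)
Lemma bracket_local x (a a' b b' : 'Gamma(A)) :
  (\forall y \near x, a y = a' y) -> (\forall y \near x, b y = b' y) ->
  bracket L a b x = bracket L a' b' x.
Proof.
have H (c d e : 'Gamma(A)) : (\forall y \near x, d y = e y) ->
    bracket L c d x = bracket L c e x.
  move=> de; apply/eqP; rewrite -subr_eq0 -sectB.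
  have -> : bracket L c d - bracket L c e = bracket L c (d - e).
    by have := bracket_linearr L c 1 (d - e) e; rewrite !scale1r subrK => ->; rewrite addrK.
  apply/eqP/bracket_localr; apply: filterS de => y; rewrite sectB => ->; exact: subrr.
move=> aa' bb'; rewrite (H a _ _ bb') -[bracket L a b']/(lbr a b') lbrC.
by rewrite -[bracket L a' b']/(lbr a' b') [in RHS]lbrC !sectN; congr (- _); exact: H.
Qed.

Section Representation.
Variables (rE : nat) (E : vbundle M rE) (nabla : 'Gamma(A) -> 'Gamma(E) -> 'Gamma(E)).
Hypothesis nablaP : representation L nabla.
Local Notation N := (Csect E).

Definition lnabla : G -> N -> N := nabla.

Lemma lnablaB a (e e' : N) : lnabla a (e - e') = lnabla a e - lnabla a e'.
Proof.
have [[_ lr] _ _ _] := nablaP.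
suff H (s s' : 'Gamma(E)) : nabla a (s - s') = nabla a s - nabla a s' by exact: H.
by have := lr a 1 (s - s') s'; rewrite !scale1r subrK => ->; rewrite addrK.
Qed.

Lemma lnablaM a f (e : N) : lnabla a (f *: e) = f *: lnabla a e + lrho a f *: e.
Proof. by have [_ _ + _] := nablaP; apply. Qed.

Lemma lnablal f a b (e : N) : lnabla (f *: a + b) e = f *: lnabla a e + lnabla b e.
Proof.
have [[ll _] fl _ _] := nablaP; have := ll e 1 (fscale f a) b; rewrite !scale1r.
by move=> E1; apply: etrans E1 _; rewrite fl.
Qed.

Lemma lnabla_flat a b (e : N) :
  lnabla a (lnabla b e) - lnabla b (lnabla a e) = lnabla (lbr a b) e.
Proof. by have [_ _ _ +] := nablaP; apply. Qed.

(** Tensoriality handles the value of [a], whereas the Leibniz rule in [e] calls for its germ. *)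
Lemma nabla_local x (a a' : 'Gamma(A)) (e e' : 'Gamma(E)) : a x = a' x ->
  (\forall y \near x, e y = e' y) -> nabla a e x = nabla a' e' x.
Proof.
move=> aa' ee'; transitivity (nabla a' e x).
  apply/eqP; rewrite -subr_eq0 -sectB.
  have -> : nabla a e - nabla a' e = nabla (a - a') e.
    have [[ll _] _ _ _] := nablaP.
    by have := ll e 1 (a - a') a'; rewrite !scale1r subrK => ->; rewrite addrK.
  apply/eqP; apply: (@tensorial _ _ _ _ A _ x (fun c => nabla c e x)).
    by move=> g s s'; exact: (congr1 (fun s => sect_fun s x) (lnablal g s s' e)).
  by rewrite sectB aa' subrr.
apply/eqP; rewrite -subr_eq0 -sectB -(lnablaB a' e e').
have /locally_zero[g gx ->] : \forall y \near x, (e - e') y = 0.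
  by apply: filterS ee' => y; rewrite sectB => ->; exact: subrr.
rewrite -[fscale g _]/(g *: (e - e' : N)) lnablaM sectD !CsectZE gx scale0r add0r.
by rewrite sectB (nbhs_singleton ee') subrr scaler0.
Qed.

End Representation.
End LieRinehart.

(** * The differential of a representation *)

Section ScalarForms.
Variables (R : realType) (n : nat) (M : manifold R n) (rA : nat) (A : vbundle M rA).
Local Notation G := (Csect A).
Local Notation line := (line_bundle M).

Fact sect_of_C_subproof (f : 'C^oo(M)) : (f : dfun line) \in is_section line.
Proof.
apply/asboolP => _ -> j; apply: smooth_ext (smoothC f _) => x _.
by rewrite /= mxE.
Qed.

Definition sect_of_C (f : 'C^oo(M)) : 'Gamma(line) := MkSect (sect_of_C_subproof f).

Lemma sect_of_CK f : sect_C (sect_of_C f) = f. Proof. exact: cfunP. Qed.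

(** With values in the ring as a module over itself, [d_A] is the list differential for the anchor
    in the role of the connection. *)
Definition lformC k (w : 'Omega^k(A)) : seq G -> 'C^oo(M)^o := fun s => sect_C (lform w s).

Lemma lformC_mlin k (w : 'Omega^k(A)) : mlin (lformC w).
Proof. by move=> s1 s2 f a b; rewrite /lformC lform_mlin; exact: cfunP. Qed.

Lemma lformC_altl k (w : 'Omega^k(A)) : altl (lformC w).
Proof. by move=> s1 s2 a; rewrite /lformC lform_altl; exact: cfunP. Qed.

Lemma lformC_supp k (w : 'Omega^k(A)) : supp_l k (lformC w).
Proof. by move=> s sk; rewrite /lformC lform_supp //; exact: cfunP. Qed.

Lemma formC_of_list k (F : seq G -> 'C^oo(M)^o) : mlin F -> altl F -> supp_l k F ->
  exists w : 'Omega^k(A), lformC w = F.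
Proof.
move=> mF aF sF; have [|||w wE] := @form_of_list _ _ _ _ _ A line k (fun s => sect_of_C (F s)).
- by move=> s1 s2 f a b; rewrite mF; exact: sectP.
- by move=> s1 s2 a; rewrite aF; exact: sectP.
- by move=> s sk; rewrite sF //; exact: sectP.
by exists w; apply/funext => s; rewrite /lformC wE sect_of_CK.
Qed.

Lemma lformC_argsE k (w : 'Omega^k(A)) (a : 'I_k -> 'Gamma(A)) x :
  lformC w (args a) x = w x (fun i => a i x).
Proof. by rewrite -[RHS]lform_argsE. Qed.

Variable L : lie_algebroid A.
Local Notation dC := (koszul_d (N := 'C^oo(M)^o) (lbr L) (lrho L)).

Lemma dC_supp k (w : 'Omega^k(A)) : supp_l k.+1 (dC (lformC w)).
Proof. by apply: koszul_d_supp (lformC_supp w); exact: (@lrhoB _ _ _ _ _ L). Qed.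

Lemma is_koszulP k (w : 'Omega^k(A)) (dw : 'Omega^k.+1(A)) :
  is_koszul L w dw <-> lformC dw = dC (lformC w).
Proof.
have K (a : 'I_k.+1 -> 'Gamma(A)) x : dC (lformC w) (args a) x =
    \sum_(i < k.+1) (-1) ^+ i *
         rho L (a i) (sect_C (contract w (fun l => a (lift i l)))) x +
    \sum_(i < k.+1) \sum_(j < k.+1 | (i < j)%N) (-1) ^+ (i + j) *
         contract w (koszul_args L a i j) x.
  rewrite (koszul_d_koszul _ _ _ (@lformC_mlin _ w) (@lformC_altl _ w)).
  rewrite cfunD !cfun_sum; congr (_ + _); apply: eq_bigr => i _.
    rewrite cfunM cfun_sign; congr (_ * lrho L _ _ x).
    by rewrite /lformC lform_args.
  rewrite cfun_sum; apply: eq_bigr => j _; rewrite cfunM cfun_sign; congr (_ * _).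
  exact: (@lformC_argsE _ w (koszul_args L a i j) x).
split=> [H|H a x]; last by rewrite -K -H lformC_argsE.
apply/funext => s; have [sk|sk] := eqVneq (size s) k.+1; last first.
  by rewrite lformC_supp // dC_supp.
rewrite -(argsK 0 sk); apply: cfunP => x; rewrite lformC_argsE K; exact: H.
Qed.

Lemma lformC_d_A k (w : 'Omega^k(A)) : lformC (d_A L w) = dC (lformC w).
Proof.
apply/is_koszulP; apply: definiteP.
have [dw dwE] : exists dw : 'Omega^k.+1(A), lformC dw = dC (lformC w).
  have mw := @lformC_mlin _ w; have aw := @lformC_altl _ w.
  apply: formC_of_list.
  - apply: koszul_d_mlin mw aw; 
      [exact: (@lrhoB _ _ _ _ _ L)|exact: (@lrhoM _ _ _ _ _ L)|exact: (@lrhol _ _ _ _ _ L)|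
       exact: lbrD|exact: lbrM|exact: lbrC].
  - apply: koszul_d_altl mw aw; [exact: (@lrhoB _ _ _ _ _ L)|exact: lbr_alt].
  exact: dC_supp.
by exists dw; apply/is_koszulP.
Qed.

End ScalarForms.

(** * Wedge products of forms as shuffle products *)

Section WedgeLists.
Variables (R : realType) (n : nat) (M : manifold R n) (rA rE : nat).
Variables (A : vbundle M rA) (E : vbundle M rE).
Local Notation G := (Csect A).
Local Notation N := (Csect E).

(** The normalisation p! q! in [wedge] is the factor of [perm_sum_shuffle]. *)
Lemma lform_wedge p q (w : 'Omega^p(A)) (h : 'Omega^q(A, E)) :
  lform (wedge w h) = shuffle (lformC w) (lform h).
Proof.
have Hk (a : 'I_(p + q) -> G) :
    lform (wedge w h) (args a) = shuffle (lformC w) (lform h) (args a).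
  have := perm_sum_shuffle a (@lformC_mlin _ _ _ _ _ _ w) (@lformC_altl _ _ _ _ _ _ w)
    (@lform_mlin _ _ _ _ _ _ _ _ h) (@lform_altl _ _ _ _ _ _ _ _ h) (lformC_supp w) (leq_addr q p).
  rewrite addKn => PS; apply: sectP => x; rewrite lform_argsE.
  have := congr1 (fun s => sect_fun s x) PS; rewrite CsectZE cfun_nat => PSx.
  have nz : ((p`! * q`!)%:R : R) != 0 by rewrite pnatr_eq0 -lt0n muln_gt0 !fact_gt0.
  apply: (scalerI nz); rewrite -PSx [LHS]scalerA divff // scale1r.
  rewrite /perm_sum sect_sum; apply: eq_bigr => s _.
  rewrite !CsectZE cfun_sign args_cat.
  rewrite take_size_cat ?size_args // drop_size_cat ?size_args //.
  by rewrite lformC_argsE lform_argsE.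
apply/funext => s; have [sk|sk] := eqVneq (size s) (p + q)%N.
  by rewrite -(argsK 0 sk).
rewrite lform_supp //; apply/esym.
exact: (shuffle_supp (lformC_supp w) (@lform_supp _ _ _ _ _ _ _ _ h)).
Qed.

End WedgeLists.

Lemma args_cast (T : Type) m k (e : m = k) (a : 'I_k -> T) :
  args (fun i => a (cast_ord e i)) = args a.
Proof. by case: k / e a => a; congr args; apply/funext => i; rewrite cast_ord_id. Qed.

(** * Existence and uniqueness of the differential of a representation *)

Section LformLinear.
Variables (R : realType) (n : nat) (M : manifold R n) (rA rE : nat).
Variables (A : vbundle M rA) (E : vbundle M rE).
Local Notation G := (Csect A).
Local Notation N := (Csect E).

Definition cst_cfun (c : R) : 'C^oo(M) := SmoothFun (asboolT (smooth_cst setT c)).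

Lemma lformD k (w h : 'Omega^k(A, E)) s : lform (w + h) s = lform w s + lform h s.
Proof. by rewrite /lform; case: ifP => _; [exact: sectP|rewrite addr0]. Qed.

Lemma lformZ k c (w : 'Omega^k(A, E)) s : lform (c *: w) s = cst_cfun c *: lform w s.
Proof. by rewrite /lform; case: ifP => _; [exact: sectP|rewrite scaler0]. Qed.

Lemma lform_sum k (I : Type) (q : seq I) (P : pred I) (w : I -> 'Omega^k(A, E)) s :
  lform (\sum_(i <- q | P i) w i) s = \sum_(i <- q | P i) lform (w i) s.
Proof.
elim/big_rec2: _ => [|i y z _ <-]; last exact: lformD.
by rewrite /lform; case: ifP => // _; exact: sectP.
Qed.

Variables (L : lie_algebroid A) (nabla : 'Gamma(A) -> 'Gamma(E) -> 'Gamma(E)).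
Hypothesis nablaP : representation L nabla.
Local Notation dC := (koszul_d (N := 'C^oo(M)^o) (lbr L) (lrho L)).
Local Notation dN := (koszul_d (lbr L) (lnabla nabla)).

(** Scalars act through constant functions; that their derivatives vanish makes the differential
    linear over R. *)
Lemma lrho_cst a c : lrho L a (cst_cfun c) = 0.
Proof.
apply: cfunP => x; have [lin der] := anchor_tangent L (a x).
have z0 : anchor L (a x) 0 = 0.
  by have := lin (-1) 0 0; rewrite scaler0 addr0 mulN1r addNr.
have z1 : anchor L (a x) 1 = 0.
  by apply: (@addrI _ (anchor L (a x) 1)); rewrite addr0 -[in RHS](mul1r 1) der cfun1 !mul1r.
have -> : cst_cfun c = c *: (1 : 'C^oo(M)) + 0.
  by apply: cfunP => y; rewrite addr0 cfunZ cfun1 mulr1.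
by rewrite [LHS]lin z1 z0 mulr0 addr0.
Qed.

Lemma dfw_cst c (F : seq G -> N) s : dfw (lrho L) (cst_cfun c) F s = 0.
Proof. by elim: s F => [|a s IH] F //=; rewrite IH lrho_cst scale0r subrr. Qed.

Let nB := lnablaB nablaP.
Let nM := lnablaM nablaP.
Let nl := lnablal nablaP.

Lemma ex_dnabla k (w : 'Omega^k(A, E)) : exists dw : 'Omega^k.+1(A, E),
  lform dw = dN (lform w).
Proof.
apply: form_of_list.
- by apply: koszul_d_mlin; 
    [exact: nB|exact: nM|exact: nl|exact: lbrD|exact: lbrM|exact: lbrC|exact: lform_mlin|
     exact: lform_altl].
- by apply: koszul_d_altl; [exact: nB|exact: lbr_alt|exact: lform_mlin|exact: lform_altl].
by apply: koszul_d_supp; [exact: nB|exact: lform_supp].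
Qed.

Definition koszul_dnabla k (w : 'Omega^k(A, E)) : 'Omega^k.+1(A, E) :=
  projT1 (cid (ex_dnabla w)).

Lemma koszul_dnablaE k (w : 'Omega^k(A, E)) : lform (koszul_dnabla w) = dN (lform w).
Proof. exact: projT2 (cid (ex_dnabla w)). Qed.

Fact koszul_dnabla_linear k : linear (@koszul_dnabla k).
Proof.
move=> c w h; apply: lform_inj; apply/funext => s.
rewrite lformD lformZ !koszul_dnablaE.
rewrite (_ : lform (c *: w + h) = fun t => cst_cfun c *: lform w t + lform h t); last first.
  by apply/funext => t; rewrite lformD lformZ.
by rewrite (koszul_dD _ nB) (koszul_dZ _ nM) dfw_cst addr0.
Qed.
HB.instance Definition _ k :=
  GRing.isLinear.Build R _ _ _ (@koszul_dnabla k) (@koszul_dnabla_linear k).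

Lemma lform_wedge_dnabla p q (w : 'Omega^p(A)) (h : 'Omega^q(A, E)) s :
  dN (lform (wedge w h)) s = shuffle (dC (lformC w)) (lform h) s +
    (-1) ^+ p *: shuffle (lformC w) (dN (lform h)) s.
Proof.
rewrite lform_wedge (koszul_d_shuffle _ nB nM (@lrhoB _ _ _ _ _ L)).
by rewrite (sgn_supp (lformC_supp w)) shuffleZl.
Qed.

Definition d_nabla_lists (D : forall k, {linear 'Omega^k(A, E) -> 'Omega^k.+1(A, E)}) :=
  (forall e : 'Omega^0(A, E), lform (D 0%N e) = dN (lform e)) /\
  (forall p q (w : 'Omega^p(A)) (h : 'Omega^q(A, E)) s,
     lform (D (p + q)%N (wedge w h)) s = shuffle (dC (lformC w)) (lform h) s +
       (-1) ^+ p *: shuffle (lformC w) (lform (D q h)) s).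

(** Every vector is the value of a global section, so the conditions on the fibres are identities
    between functions on lists of sections. *)
Lemma is_d_nablaP D : is_d_nabla L nabla D <-> d_nabla_lists D.
Proof.
have D0E (e : 'Omega^0(A, E)) (a : 'Gamma(A)) : dN (lform e) [:: a] = nabla a (section_of_form0 e).
  rewrite /= subr0 /lform /=; congr (nabla a (contract e _)); apply/funext => i.
  by rewrite nth_nil.
have A1 (a : G) : args (fun _ : 'I_1 => a) = [:: a].
  by rewrite argsS (size0nil (size_args _)).
have WE p q (w : 'Omega^p(A)) (h : 'Omega^q(A, E)) x (a : 'I_(p + q).+1 -> G) :
    wedge (d_A L w) h x (fun i => sect_fun (a i) x) +
    (-1) ^+ p *: wedge w (D q h) x (fun i => sect_fun (a (cast_ord (addnS p q) i)) x) =
    sect_fun (shuffle (dC (lformC w)) (lform h) (args a) +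
       (-1) ^+ p *: shuffle (lformC w) (lform (D q h)) (args a) : N) x.
  rewrite sectD CsectZE cfun_sign -lformC_d_A -!lform_wedge.
  rewrite -[X in _ + _ *: X = _](lform_argsE (wedge w (D q h))) args_cast.
  by rewrite -[X in X + _ = _](lform_argsE (wedge (d_A L w) h)).
split=> -[H0 H]; split.
- move=> e; apply/funext => s; have [ss|ss] := eqVneq (size s) 1%N; last first.
    by rewrite lform_supp // (koszul_d_supp _ nB (@lform_supp _ _ _ _ _ _ _ _ e)).
  case: s ss => [//|a [|//]] _; rewrite D0E -A1; apply: sectP => x.
  by rewrite lform_argsE H0.
- move=> p q w h s; have [ss|ss] := eqVneq (size s) (p + q).+1; last first.
    rewrite lform_supp // (shuffle_supp (p := p.+1) (q := q)) //;
      [|exact: dC_supp|exact: lform_supp].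
    rewrite (shuffle_supp (p := p) (q := q.+1)) ?scaler0 ?addr0 //;
      [exact: lformC_supp|exact: lform_supp|].
    by rewrite addnS.
  rewrite -(argsK 0 ss); apply: sectP => x; rewrite -WE lform_argsE.
  exact: H.
- move=> e a x; rewrite -D0E -H0 -A1.
  by rewrite lform_argsE.
move=> p q w h x v.
pose a i : G := projT1 (cid (sect_through (v i))).
have va : v = fun i => sect_fun (a i) x.
  by apply/funext => i; rewrite (projT2 (cid (sect_through (v i)))).
by rewrite va WE -H lform_argsE.
Qed.

Lemma koszul_is_d_nabla : is_d_nabla L nabla (fun k => @koszul_dnabla k : {linear _ -> _}).
Proof.
apply/is_d_nablaP; split=> [e|p q w h s]; first exact: koszul_dnablaE.
by rewrite !koszul_dnablaE lform_wedge_dnabla.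
Qed.

Lemma form0_of_sect (e : 'Gamma(E)) : exists h : 'Omega^0(A, E), lform h [::] = e.
Proof.
have [|||h hE] := @form_of_list _ _ _ _ _ A E 0 (fun s => if s is [::] then e else 0).
- by case=> [|? ?] s2 f a b /=; rewrite scaler0 addr0.
- by case.
- by case.
by exists h; rewrite hE.
Qed.

Lemma formC0_of_cfun (g : 'C^oo(M)) : exists h : 'Omega^0(A), lformC h [::] = g.
Proof.
have [|||h hE] := @formC_of_list _ _ _ _ A 0 (fun s => if s is [::] then g else 0).
- by case=> [|? ?] s2 f a b /=; rewrite scaler0 addr0.
- by case.
- by case.
by exists h; rewrite hE.
Qed.

(* The difference of two solutions is linear over the smooth functions and kills the
   wedge products of scalar forms with sections, which locally generate all forms. *)
Lemma d_nabla_listsE D : d_nabla_lists D -> forall k (w : 'Omega^k(A, E)),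
  lform (D k w) = dN (lform w).
Proof.
move=> [D0 DW] k w; apply/funext => s; apply: sectP => x.
have [u Bu ux] := triv_cover E x.
have [chi [e [f [[c1 _] flin fe _]]]] := local_frame Bu ux.
have f0 l : f l 0 = 0.
  have := flin l (-1) 0 0; rewrite addr0 (_ : fscale (-1) 0 = 0); last first.
    by apply: sectP => y; rewrite fscaleE scaler0.
  by rewrite mulN1r addNr.
(* The components of [w] in the global frame are scalar forms. *)
have Hw l : exists wl : 'Omega^k(A), forall s, lformC wl s = f l (lform w s).
  have [|||wl wlE] := @formC_of_list _ _ _ _ A k (fun s => f l (lform w s)).
  - by move=> s1 s2 g a b; rewrite lform_mlin [LHS]flin.
  - by move=> s1 s2 a; rewrite lform_altl [LHS]f0.
  - by move=> t tk; rewrite lform_supp // [LHS]f0.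
  by exists wl => t; rewrite wlE.
(* The wedge with a 0-form has degree [k + 0], which is not convertible to [k]. *)
have cast m (km : m = k) (h : 'Omega^m(A, E)) : exists2 h' : 'Omega^k(A, E),
    lform h' = lform h & lform (D k h') = lform (D m h).
  by case: k / km {w Hw} => //; exists h.
have Hc l : exists2 c : 'Omega^k(A, E), (forall s, lform c s = f l (lform w s) *: (e l : N)) &
    lform (D k c) = dN (lform c).
  have [wl wlE] := Hw l; have [el elE] := form0_of_sect (e l).
  have [c cE DcE] := cast _ (addn0 k) (wedge wl el).
  exists c => [t|].
    by rewrite cE lform_wedge shuffle_supp0r ?elE ?wlE //; exact: lform_supp.
  by rewrite DcE cE; apply/funext => t; rewrite DW D0 lform_wedge_dnabla.
pose c l := projT1 (cid2 (Hc l)).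
have cE l t : lform (c l) t = f l (lform w t) *: (e l : N).
  by case: (projT2 (cid2 (Hc l))) => + _; apply.
have Dc l : lform (D k (c l)) = dN (lform (c l)) by case: (projT2 (cid2 (Hc l))).
(* As a 0-form, [chi * chi] times [w] is the global sum of the products [c l], on which [D] is
   already known. *)
have [phi phiE] := formC0_of_cfun (chi * chi).
have W : (wedge phi w : 'Omega^k(A, E)) = \sum_l c l.
  apply: lform_inj; apply/funext => t.
  rewrite [LHS](congr1 (fun F => F t) (lform_wedge phi w)) shuffle_supp0l ?phiE;
    last exact: lformC_supp.
  by rewrite lform_sum [LHS]fe; apply: eq_bigr => l _; rewrite cE.
have DWE : D k (wedge phi w) = koszul_dnabla (wedge phi w).
  rewrite [in LHS]W [in RHS]W !linear_sum; apply: eq_bigr => l _.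
  by apply: lform_inj; rewrite Dc koszul_dnablaE.
have := congr1 (fun h => lform h s) DWE; rewrite /= (koszul_dnablaE (wedge phi w : 'Omega^k(A, E))).
have := lform_wedge_dnabla phi w s; rewrite /= => ->; have := DW 0%N k phi w s; rewrite /= => ->.
(* Both Leibniz rules contain the same term [d phi /\ w]; without it the two differentials of [w]
   agree up to the factor [chi * chi], which is 1 at [x]. *)
move=> /addrI; rewrite expr0 !scale1r !shuffle_supp0l; try exact: lformC_supp.
rewrite phiE => /(congr1 (fun t => sect_fun t x)).
by rewrite !CsectZE cfunM (nbhs_singleton c1) mulr1 !scale1r.
Qed.

Lemma lform_d_nabla k (w : 'Omega^k(A, E)) : lform (d_nabla L nabla k w) = dN (lform w).
Proof.
apply: d_nabla_listsE; apply/is_d_nablaP; apply: definiteP.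
by exists (fun k => @koszul_dnabla k : {linear _ -> _}); exact: koszul_is_d_nabla.
Qed.

Lemma d_nabla_d_nabla k (w : 'Omega^k(A, E)) : d_nabla L nabla k.+1 (d_nabla L nabla k w) = 0.
Proof.
apply: lform_inj; apply/funext => s; rewrite !lform_d_nabla.
rewrite (koszul_d_dK nB (@lbr_jacobi _ _ _ _ _ L) (lnabla_flat nablaP)); last exact: lform_mlin.
by apply: sectP => x; rewrite /lform; case: ifP.
Qed.

End LformLinear.

(** * Restriction to open subsets *)

Section Germs.
Variables (R : realType) (n : nat) (M : manifold R n) (W : opens M).
Local Notation MW := (open_mfd W).

Definition extends r (E : vbundle M r) (x : MW) (s : 'Gamma(E \|_ W)) (g : 'Gamma(E)) :=
  \forall y \near x, g (val y) = s y.

Definition fextends (x : MW) (f : 'C^oo(MW)) (g : 'C^oo(M)) :=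
  \forall y \near x, g (val y) = f y.

Lemma near_nearP (T : topologicalType) (x : T) (P : T -> Prop) :
  (\forall y \near x, P y) -> \forall y \near x, \forall z \near y, P z.
Proof. by move=> h; exact: nbhs_interior h. Qed.

Section Sections.
Variables (r : nat) (E : vbundle M r).
Implicit Types (s : 'Gamma(E \|_ W)) (g : 'Gamma(E)).

Definition sext (x : MW) s : 'Gamma(E) := projT1 (cid (sect_extend x s)).

Lemma sextP x s : extends x s (sext x s).
Proof. exact: projT2 (cid (sect_extend x s)). Qed.

Lemma extends_res x g : extends x (res_sect W g) g.
Proof. by apply: filterE. Qed.

Lemma extends_at x s g : extends x s g -> g (val x) = s x.
Proof. exact: nbhs_singleton. Qed.

Lemma extends_near x s g : extends x s g -> \forall y \near x, extends y s g.
Proof. exact: near_nearP. Qed.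

Lemma extends_eq x s g g' : extends x s g -> extends x s g' ->
  \forall z \near val x, g z = g' z.
Proof.
by move=> h h'; apply: near_val; apply: filterS2 h h' => y -> ->.
Qed.

Lemma extends_linear x c s g s' g' : extends x s g -> extends x s' g' ->
  extends x (c *: s + s') (c *: g + g').
Proof. by apply: filterS2 => y; rewrite !sectD !sectZ => -> ->. Qed.

Lemma extends_fscale x f h s g : fextends x f h -> extends x s g ->
  extends x (fscale f s) (fscale h g).
Proof. by apply: filterS2 => y; rewrite !fscaleE => -> ->. Qed.

Lemma sect_of_germs (F : forall x : MW, E (val x)) :
  (forall x : MW, exists g : 'Gamma(E), \forall y \near x, g (val y) = F y) ->
  exists h : 'Gamma(E \|_ W), forall x, h x = F x.
Proof.
move=> H; apply: (@is_section_local _ _ _ _ (E \|_ W)) => x; have [g gF] := H x.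
by exists (res_sect W g).
Qed.

End Sections.

Definition fext (x : MW) f : 'C^oo(M) := projT1 (cid (cfun_extend x f)).

Lemma fextP x f : fextends x f (fext x f).
Proof. exact: projT2 (cid (cfun_extend x f)). Qed.

Lemma fextends_res x g : fextends x (res_fun W g) g.
Proof. by apply: filterE. Qed.

Lemma fextends_at x f g : fextends x f g -> g (val x) = f x.
Proof. exact: nbhs_singleton. Qed.

Lemma fextends_near x f g : fextends x f g -> \forall y \near x, fextends y f g.
Proof. exact: near_nearP. Qed.

Lemma fextends_eq x f g g' : fextends x f g -> fextends x f g' ->
  \forall z \near val x, g z = g' z.
Proof.
by move=> h h'; apply: near_val; apply: filterS2 h h' => y -> ->.
Qed.

Lemma fextends_linear x c f g f' g' : fextends x f g -> fextends x f' g' ->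
  fextends x (c *: f + f') (c *: g + g').
Proof. by apply: filterS2 => y; rewrite !cfunD !cfunZ => -> ->. Qed.

Lemma fextendsM x f g f' g' : fextends x f g -> fextends x f' g' ->
  fextends x (f * f') (g * g').
Proof. by apply: filterS2 => y; rewrite !cfunM => -> ->. Qed.

End Germs.

(** * The restricted Lie algebroid *)

Section RestrictLie.
Variables (R : realType) (n : nat) (M : manifold R n) (rA : nat) (A : vbundle M rA).
Variables (L : lie_algebroid A) (W : opens M).
Local Notation MW := (open_mfd W).
Local Notation AW := (A \|_ W).

(** At each point, the bracket of global representatives is taken. Locality makes it independent of
    them, and the representatives at one point also serve nearby, which gives smoothness. *)
Lemma bracketW_exists (a b : 'Gamma(AW)) : exists c : 'Gamma(AW),
  forall x a' b', extends x a a' -> extends x b b' -> c x = bracket L a' b' (val x).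
Proof.
have [x|c cE] := @sect_of_germs _ _ _ W _ A
    (fun x => bracket L (sext x a) (sext x b) (val x)).
  exists (bracket L (sext x a) (sext x b)).
  apply: filterS2 (extends_near (sextP x a)) (extends_near (sextP x b)) => y ya yb.
  by apply: bracket_local; apply: extends_eq; try exact: sextP; eassumption.
exists c => x a' b' xa xb; apply: etrans (cE x) _.
apply: (@bracket_local _ _ _ _ _ L (val x) _ a' _ b').
  exact: extends_eq (sextP x a) xa.
exact: extends_eq (sextP x b) xb.
Qed.

Definition bracketW a b := projT1 (cid (bracketW_exists a b)).

Lemma bracketWE a b x a' b' : extends x a a' -> extends x b b' ->
  bracketW a b x = bracket L a' b' (val x).
Proof. exact: (projT2 (cid (bracketW_exists a b))). Qed.

Lemma bracketW_extends a b x a' b' : extends x a a' -> extends x b b' ->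
  extends x (bracketW a b) (bracket L a' b').
Proof.
move=> /extends_near xa /extends_near xb; apply: filterS2 xa xb => y ya yb.
by apply/esym; exact: bracketWE.
Qed.

Definition anchorW (x : MW) (v : AW x) (f : 'C^oo(MW)) : R :=
  anchor L (x := val x) v (fext x f).

Lemma anchorWE x v f g : fextends x f g -> anchorW (x := x) v f = anchor L (x := val x) v g.
Proof. by move=> fg; apply: anchor_local; exact: fextends_eq (fextP x f) fg. Qed.

Lemma restricts_lie_exists : exists K : lie_algebroid AW, restricts_lie L K.
Proof.
have tan (x : MW) (v : AW x) : is_tangent x (anchorW v).
  have [lin der] := anchor_tangent L (x := val x) v; split=> [c f g|f g].
    by rewrite (anchorWE _ (fextends_linear c (fextP x f) (fextP x g))) lin.
  by rewrite (anchorWE _ (fextendsM (fextP x f) (fextP x g))) der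
    (fextends_at (fextP x f)) (fextends_at (fextP x g)).
have lin (x : MW) c (v w : AW x) f : anchorW (c *: v + w) f = c * anchorW v f + anchorW w f.
  exact: anchor_linear.
have sm (a : 'Gamma(AW)) f : (fun x => anchorW (a x) f) \in smooth_pred MW.
  apply: cfun_local => x; exists (res_fun W (rho L (sext x a) (fext x f))).
  apply: filterS2 (extends_near (sextP x a)) (fextends_near (fextP x f)) => y ya yf /=.
  by rewrite (anchorWE _ yf) (extends_at ya).
have linl b : linear (bracketW^~ b).
  move=> c a a'; apply: sectP => x.
  rewrite (bracketWE (extends_linear c (sextP x a) (sextP x a')) (sextP x b)).
  rewrite (bracket_linearl L) sectD sectZ.
  by rewrite -!(bracketWE (sextP x _) (sextP x b)).
have linr a : linear (bracketW a).
  move=> c b b'; apply: sectP => x.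
  rewrite (bracketWE (sextP x a) (extends_linear c (sextP x b) (sextP x b'))).
  rewrite (bracket_linearr L) sectD sectZ.
  by rewrite -!(bracketWE (sextP x a) (sextP x _)).
have alt a : bracketW a a = 0.
  by apply: sectP => x; rewrite (bracketWE (sextP x a) (sextP x a)) bracket_alt.
have jac a b c : bracketW a (bracketW b c) + bracketW b (bracketW c a) +
    bracketW c (bracketW a b) = 0.
  apply: sectP => x; have xa := sextP x a; have xb := sextP x b; have xc := sextP x c.
  (* An iterated bracket needs a representative of the inner bracket near [x], not only its value at
     [x]. *)
  have H p q s p' q' s' : extends x p p' -> extends x q q' -> extends x s s' ->
      bracketW p (bracketW q s) x = bracket L p' (bracket L q' s') (val x).
    by move=> hp hq hs; apply: bracketWE => //; exact: bracketW_extends.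
  rewrite !sectD (H _ _ _ _ _ _ xa xb xc) (H _ _ _ _ _ _ xb xc xa) (H _ _ _ _ _ _ xc xa xb).
  exact: (congr1 (fun s => sect_fun s (val x)) (bracket_jacobi L (sext x a) (sext x b) (sext x c))).
have leib a b f : bracketW a (fscale f b) =
    fscale f (bracketW a b) + fscale (SmoothFun (sm a f)) b.
  apply: sectP => x; have xa := sextP x a; have xb := sextP x b; have xf := fextP x f.
  rewrite (bracketWE xa (extends_fscale xf xb)) bracket_leibniz !sectD !fscaleE.
  rewrite (bracketWE xa xb) (fextends_at xf) (extends_at xb) /=.
  by congr (_ + anchor L _ _ *: _); exact: extends_at.
exists (LieAlgebroid tan lin linl linr alt jac leib); split => /=.
  move=> a b; apply: sectP => x; apply: bracketWE; exact: extends_res.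
by move=> x v f; apply: anchorWE; exact: fextends_res.
Qed.

Lemma res_lieP : restricts_lie L (res_lie L W).
Proof. exact: definiteP restricts_lie_exists. Qed.

(** [res_lie] is known on restrictions only; the locality of its own bracket reduces other sections
    to these. *)
Lemma res_lie_bracket x a b a' b' : extends x a a' -> extends x b b' ->
  extends x (bracket (res_lie L W) a b) (bracket L a' b').
Proof.
move=> /extends_near xa /extends_near xb; apply: filterS2 xa xb => y ya yb.
have [H _] := res_lieP; transitivity (bracket (res_lie L W) (res_sect W a') (res_sect W b') y).
  by rewrite H.
by apply: (@bracket_local _ _ _ _ _ (res_lie L W) y).
Qed.

Lemma res_lie_anchor (x : MW) (v : AW x) f g : fextends x f g ->
  anchor (res_lie L W) v f = anchor L (x := val x) v g.
Proof.
move=> fg; have [_ H] := res_lieP; rewrite -(H x); apply: anchor_local.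
by apply: filterS fg => y.
Qed.

End RestrictLie.

(** * The restricted representation *)

Section RestrictRep.
Variables (R : realType) (n : nat) (M : manifold R n) (rA rE : nat).
Variables (A : vbundle M rA) (E : vbundle M rE) (L : lie_algebroid A).
Variables (nabla : 'Gamma(A) -> 'Gamma(E) -> 'Gamma(E)).
Hypothesis nablaP : representation L nabla.
Variable W : opens M.
Local Notation MW := (open_mfd W).
Local Notation AW := (A \|_ W).
Local Notation EW := (E \|_ W).

Lemma nabla_germ x (a : 'Gamma(AW)) (e : 'Gamma(EW)) a' e' a'' e'' :
  extends x a a' -> extends x e e' -> extends x a a'' -> extends x e e'' ->
  nabla a' e' (val x) = nabla a'' e'' (val x).
Proof.
move=> xa xe xa' xe'; apply: (nabla_local nablaP).
  by rewrite (extends_at xa) (extends_at xa').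
exact: extends_eq xe xe'.
Qed.

Lemma nablaW_exists (a : 'Gamma(AW)) (e : 'Gamma(EW)) : exists h : 'Gamma(EW),
  forall x a' e', extends x a a' -> extends x e e' -> h x = nabla a' e' (val x).
Proof.
have [x|c cE] := @sect_of_germs _ _ _ W _ E
    (fun x => nabla (sext x a) (sext x e) (val x)).
  exists (nabla (sext x a) (sext x e)).
  apply: filterS2 (extends_near (sextP x a)) (extends_near (sextP x e)) => y ya ye.
  exact: nabla_germ ya ye (sextP y a) (sextP y e).
exists c => x a' e' xa xe; apply: etrans (cE x) _.
exact: nabla_germ (sextP x a) (sextP x e) xa xe.
Qed.

Definition nablaW a e := projT1 (cid (nablaW_exists a e)).

Lemma nablaWE a e x a' e' : extends x a a' -> extends x e e' ->
  nablaW a e x = nabla a' e' (val x).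
Proof. exact: (projT2 (cid (nablaW_exists a e))). Qed.

Lemma nablaW_extends a e x a' e' : extends x a a' -> extends x e e' ->
  extends x (nablaW a e) (nabla a' e').
Proof.
move=> /extends_near xa /extends_near xe; apply: filterS2 xa xe => y ya ye.
by apply/esym; exact: nablaWE.
Qed.

Lemma restricts_rep_exists :
  exists D, restricts_rep (A := A) (E := E) L nabla (W := W) D.
Proof.
have [[nl nr] nf nM flat] := nablaP.
exists nablaW; split; last first.
  by move=> a e; apply: sectP => x; apply: nablaWE; exact: extends_res.
split; first split.
- move=> e c a a'; apply: sectP => x.
  rewrite (nablaWE (extends_linear c (sextP x a) (sextP x a')) (sextP x e)) nl sectD sectZ.
  by rewrite -!(nablaWE (sextP x _) (sextP x e)).
- move=> a c e e'; apply: sectP => x.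
  rewrite (nablaWE (sextP x a) (extends_linear c (sextP x e) (sextP x e'))) nr sectD sectZ.
  by rewrite -!(nablaWE (sextP x a) (sextP x _)).
- move=> f a e; apply: sectP => x; have xa := sextP x a; have xe := sextP x e; have xf := fextP x f.
  rewrite (nablaWE (extends_fscale xf xa) xe) nf !fscaleE (nablaWE xa xe).
  by rewrite (fextends_at xf).
- move=> a f e; apply: sectP => x; have xa := sextP x a; have xe := sextP x e; have xf := fextP x f.
  rewrite (nablaWE xa (extends_fscale xf xe)) nM !sectD !fscaleE (nablaWE xa xe).
  rewrite (fextends_at xf) (extends_at xe); congr (_ + _ *: _).
  by rewrite /= (res_lie_anchor L (x := x) (a x) xf) (extends_at xa).
move=> a b e; apply: sectP => x; have xa := sextP x a; have xb := sextP x b; have xe := sextP x e.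
rewrite sectB (nablaWE xa (nablaW_extends xb xe)) (nablaWE xb (nablaW_extends xa xe)).
rewrite (nablaWE (res_lie_bracket L xa xb) xe).
exact: (congr1 (fun s => sect_fun s (val x)) (flat _ _ _)).
Qed.

Lemma res_repP : restricts_rep L nabla (res_rep L nabla W).
Proof. exact: definiteP restricts_rep_exists. Qed.

Lemma res_rep_representation : representation (res_lie L W) (res_rep L nabla W).
Proof. by case: res_repP. Qed.

Local Notation dW := (d_on L nabla W).

(** The vectors at [x] are extended by restrictions of global sections, on which bracket and
    connection are restrictions too; then [koszul_d_natural] applies. *)
Lemma d_on_res k (w : 'Omega^k(A, E)) : dW k (res_form W w) = res_form W (d_nabla L nabla k w).
Proof.
apply: form_eq => a x.
pose b i : Csect A := projT1 (cid (sect_through (a i x : A (val x)))).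
have bE i : sect_fun (b i) (val x) = sect_fun (a i) x := projT2 (cid (sect_through _)).
have aE : (fun i => sect_fun (a i) x) = fun i => sect_fun (res_sect W (b i)) x.
  by apply/funext => i; rewrite -bE.
pose resA (s : Csect A) : Csect AW := res_sect W s.
pose resE (s : Csect E) : Csect EW := res_sect W s.
rewrite aE -[LHS](lform_argsE (dW k (res_form W w))) lform_d_nabla;
  last exact: res_rep_representation.
transitivity (sect_fun (lform (d_nabla L nabla k w) (args b)) (val x)); last by rewrite lform_argsE.
rewrite lform_d_nabla // (_ : args (fun i => res_sect W (b i)) =
  map resA (args b)); last by rewrite /args -map_comp.
have [H1 _] := res_lieP L W; have [_ H2] := res_repP.
rewrite (@koszul_d_natural _ _ _ _ _ _ (lbr L) (lnabla nabla) _ _ _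
  resE _ _ _ (lform w)) //.
- by move=> s s'; exact: sectP.
move=> s; apply: sectP => y; rewrite /lform size_map; case: eqP => // sk.
congr (w (val y) _); apply/funext => i.
by rewrite (nth_map 0) // sk.
Qed.

End RestrictRep.

(** * Locality of the differential *)

Section Locality.
Variables (R : realType) (n : nat) (M : manifold R n) (rA rE : nat).
Variables (A : vbundle M rA) (E : vbundle M rE) (L : lie_algebroid A).
Variables (nabla : 'Gamma(A) -> 'Gamma(E) -> 'Gamma(E)).
Hypothesis nablaP : representation L nabla.

Lemma dfw_at (rho : Csect A -> 'C^oo(M) -> 'C^oo(M)) g (F : seq (Csect A) -> Csect E) x s :
  (forall t, sect_fun (F t) x = 0) -> sect_fun (dfw rho g F s) x = 0.
Proof.
elim: s F => [|a s IH] F F0; first by [].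
transitivity (sect_fun (rho a g *: F s - dfw rho g (iota_l a F) s : Csect E) x) => //.
by rewrite sectB CsectZE F0 scaler0 IH ?subrr // => t; exact: F0.
Qed.

(** With a cutoff [chi] equal to 1 near [x], [w = (1 - chi) w]. In the Leibniz rule one term has the
    factor [1 - chi] and the other involves the values of [w], and both vanish at [x]. *)
Lemma d_nabla_local0 k (w : 'Omega^k(A, E)) x :
  (\forall y \near x, forall v, w y v = 0) -> forall v, d_nabla L nabla k w x v = 0.
Proof.
rewrite /prop_near1 nbhsE => -[N [oN Nx] w0] v.
have [chi [c1 cN _]] := @cutoff_exists _ _ _ (Opens oN) x Nx.
pose a i : Csect A := projT1 (cid (sect_through (v i))).
have -> : v = fun i => sect_fun (a i) x.
  by apply/funext => i; rewrite (projT2 (cid (sect_through (v i)))).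
have wE : lform w = fun t => (1 - chi) *: lform w t.
  apply/funext => t; apply: sectP => y; rewrite CsectZE /lform.
  case: eqP => _; last by rewrite scaler0.
  have [Ny|Ny] := pselect (N y); first by rewrite [sect_fun _ _]w0 // scaler0.
  by rewrite cfunD cfunN cfun1 cN // subr0 scale1r.
rewrite -[LHS](lform_argsE (d_nabla L nabla k w)) lform_d_nabla // wE.
rewrite (koszul_dZ _ (lnablaM nablaP)) sectD CsectZE.
rewrite cfunD cfunN cfun1 (nbhs_singleton c1) subrr scale0r add0r.
apply: dfw_at => t; rewrite /lform; case: eqP => // _; exact: w0.
Qed.

Lemma d_nabla_local k (w w' : 'Omega^k(A, E)) x :
  (\forall y \near x, forall v, w y v = w' y v) ->
  forall v, d_nabla L nabla k w x v = d_nabla L nabla k w' x v.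
Proof.
move=> ww' v; apply/eqP; rewrite -subr_eq0; apply/eqP.
transitivity (d_nabla L nabla k (w - w') x v); first by rewrite linearB.
apply: d_nabla_local0; apply: filterS ww' => y e u.
by rewrite -[LHS]/(w y u - w' y u) e subrr.
Qed.

End Locality.

Section RestrictIncl.
Variables (R : realType) (n : nat) (M : manifold R n) (rA rE : nat).
Variables (A : vbundle M rA) (E : vbundle M rE) (L : lie_algebroid A).
Variables (nabla : 'Gamma(A) -> 'Gamma(E) -> 'Gamma(E)).
Hypothesis nablaP : representation L nabla.
Variables (W' W : opens M) (sW : W' `<=` W).

(** A form on [W] need not be the restriction of a form on M, but its germ at the point is; by
    locality both sides may be computed from that germ, where [d_on_res] applies. *)
Lemma d_on_res_incl k (w : 'Omega^k(A \|_ W, E \|_ W)) :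
  d_on L nabla W' k (res_incl sW w) = res_incl sW (d_on L nabla W k w).
Proof.
apply: formP => x v; have [g gE] := form_extend (incl sW x) w.
transitivity (d_on L nabla W' k (res_form W' g) x v).
  apply: d_nabla_local; first exact: res_rep_representation.
  have : \forall y \near x, forall u, res_form W g (incl sW y) u = w (incl sW y) u.
    exact: (@incl_continuous _ _ _ _ _ sW x _ gE).
  by apply: filterS => y e u; exact: esym (e u).
rewrite d_on_res //.
transitivity (d_on L nabla W k (res_form W g) (incl sW x) v); first by rewrite d_on_res.
by apply: d_nabla_local gE v; exact: res_rep_representation.
Qed.

End RestrictIncl.

(** * Cohomology and the long exact sequence *)

Section InducedMaps.
Variable R : pzRingType.

Lemma linear_family (C D : nat -> lmodType R) (f : forall k, C k -> D k) :
  (forall k, linear (f k)) ->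
  exists g : forall k, {linear C k -> D k}, forall k x, g k x = f k x.
Proof.
move=> lf; pose g k : {linear C k -> D k} :=
  HB.pack (f k) (GRing.isLinear.Build _ _ _ _ _ (lf k)).
by exists g.
Qed.

Section Classes.
Variables (C : nat -> lmodType R) (d : forall k, {linear C k -> C k.+1}).

Lemma cls_surj q (y : cohomology d q) : exists z, y = cls z.
Proof. by exists (generic_quotient.repr y); rewrite /cls generic_quotient.reprK. Qed.

Lemma cls0 q : cls (0 : Cocycle d q) = 0.
Proof. by have := cls_linear (-1) (0 : Cocycle d q) 0; rewrite scaler0 addr0 scaleN1r addNr. Qed.

Lemma cls_eq0 q (z : Cocycle d q) : cls z = 0 <-> z \in @coboundary _ _ d q.
Proof. by rewrite -cls0 clsP subr0. Qed.

Lemma cocycleP q (z : Cocycle d q) : d q (cocycle_val z) = 0.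
Proof. by have /eqP := valP z. Qed.

Lemma mk_cocycle q (x : C q) : d q x = 0 -> exists z : Cocycle d q, cocycle_val z = x.
Proof.
move=> dx; have H : x \in @cocycle _ _ d q by apply/eqP.
by exists (MkCocycle H).
Qed.

Lemma cocycle_eq q (z z' : Cocycle d q) : cocycle_val z = cocycle_val z' -> z = z'.
Proof. exact: val_inj. Qed.

Lemma coboundary0 (z : Cocycle d 0) : z \in @coboundary _ _ d 0 <-> cocycle_val z = 0.
Proof.
split=> [/eqP->//|z0]; apply/eqP; exact: cocycle_eq.
Qed.

Lemma coboundaryS q (z : Cocycle d q.+1) :
  z \in @coboundary _ _ d q.+1 <-> exists y, d q y = cocycle_val z.
Proof. by split=> [/asboolP|?]; last exact/asboolP. Qed.

End Classes.

(** A relation is used instead of a map so that the connecting homomorphism, which depends on a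
    choice of lift at the level of cocycles, is covered together with chain maps. *)
Lemma induced_map (C C' : nat -> lmodType R) (d : forall k, {linear C k -> C k.+1})
    (d' : forall k, {linear C' k -> C' k.+1}) q q' (r : Cocycle d q -> Cocycle d' q' -> Prop) :
  (forall a w w' b b', r w b -> r w' b' -> r (a *: w + w') (a *: b + b')) ->
  (forall w, exists b, r w b) ->
  (forall w b, r w b -> w \in @coboundary _ _ d q -> b \in @coboundary _ _ d' q') ->
  exists g : {linear cohomology d q -> cohomology d' q'},
    forall w b, r w b -> g (cls w) = cls b.
Proof.
move=> lin tot cob; pose g (y : cohomology d q) : cohomology d' q' :=
  cls (projT1 (cid (tot (generic_quotient.repr y)))).
have gE w b : r w b -> g (cls w) = cls b.
  move=> rwb; apply/clsP; rewrite /g; set w' := generic_quotient.repr _.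
  have rw' := projT2 (cid (tot w')); set b' := projT1 _ in rw' *.
  apply: (cob (w' - w)).
    by have := lin (-1) _ _ _ _ rwb rw'; rewrite !scaleN1r ![- _ + _]addrC.
  by apply/clsP; rewrite /cls generic_quotient.reprK.
have lg : linear g.
  move=> a y y'; have [w ->] := cls_surj y; have [w' ->] := cls_surj y'.
  have [b wb] := tot w; have [b' wb'] := tot w'.
  by rewrite -cls_linear (gE _ _ (lin a _ _ _ _ wb wb')) (gE _ _ wb) (gE _ _ wb') cls_linear.
pose gl : {linear cohomology d q -> cohomology d' q'} :=
  HB.pack g (GRing.isLinear.Build _ _ _ _ g lg).
by exists gl.
Qed.

Lemma chain_map_induced (C C' : nat -> lmodType R) (d : forall k, {linear C k -> C k.+1})
    (d' : forall k, {linear C' k -> C' k.+1}) (f : forall k, {linear C k -> C' k}) :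
  (forall k x, d' k (f k x) = f k.+1 (d k x)) ->
  forall q, exists g : {linear cohomology d q -> cohomology d' q},
    forall z z', f q (cocycle_val z) = cocycle_val z' -> g (cls z) = cls z'.
Proof.
move=> fd q; apply: induced_map.
- by move=> a w w' b b' wb wb'; rewrite /= linearP wb wb'.
- move=> w; have [|z zE] := @mk_cocycle _ d' q (f q (cocycle_val w)); last by exists z.
  by rewrite fd cocycleP linear0.
case: q => [|q] w b wb.
  by move/coboundary0 => w0; apply/coboundary0; rewrite -wb w0 linear0.
by move/coboundaryS => [y yw]; apply/coboundaryS; exists (f q y); rewrite fd yw.
Qed.

End InducedMaps.

(** * The snake lemma *)

Section LongExactSequence.
Variables (R : pzRingType) (C U V X : nat -> lmodType R).
Variables (d : forall k, {linear C k -> C k.+1}) (dU : forall k, {linear U k -> U k.+1}).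
Variables (dV : forall k, {linear V k -> V k.+1}) (dX : forall k, {linear X k -> X k.+1}).
Variables (i : forall k, {linear C k -> (U k * V k)%type}).
Variables (j : forall k, {linear (U k * V k)%type -> X k}).
Hypothesis id : forall k w, i k.+1 (d k w) = (dU k (i k w).1, dV k (i k w).2).
Hypothesis jd : forall k w, j k.+1 (dU k w.1, dV k w.2) = dX k (j k w).
Hypothesis i_inj : forall k, injective (i k).
Hypothesis ij : forall k, exact_pair (i k) (j k).
Hypothesis j_surj : forall k w, exists p, j k p = w.
Hypothesis ddU : forall k w, dU k.+1 (dU k w) = 0.
Hypothesis ddV : forall k w, dV k.+1 (dV k w) = 0.

Lemma ji k w : j k (i k w) = 0.
Proof. by apply/ij; exists w. Qed.

Lemma i_cocycle k w : dU k (i k w).1 = 0 -> dV k (i k w).2 = 0 -> d k w = 0.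
Proof. by move=> w1 w2; apply: i_inj; rewrite id w1 w2 linear0. Qed.

Definition connects q (w : Cocycle dX q) (b : Cocycle d q.+1) :=
  exists p, j q p = cocycle_val w /\ i q.+1 (cocycle_val b) = (dU q p.1, dV q p.2).

Lemma connecting_map q : exists g : {linear cohomology dX q -> cohomology d q.+1},
  forall w b, connects w b -> g (cls w) = cls b.
Proof.
apply: induced_map.
- move=> a w w' b b' [p [pw pb]] [p' [pw' pb']]; exists (a *: p + p'); split.
    by rewrite linearP pw pw'.
  by rewrite /= !linearP pb pb'.
- move=> w; have [p pw] := j_surj (cocycle_val w).
  have : j q.+1 (dU q p.1, dV q p.2) = 0 by rewrite jd pw cocycleP.
  move/ij => [b bE]; have [|z zE] := @mk_cocycle _ _ d q.+1 b.
    by apply: i_cocycle; rewrite bE /= ?ddU ?ddV.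
  by exists z; exists p; rewrite zE.
move=> w b [p [pw pb]] wcob; apply/coboundaryS.
(* If [w] bounds [y], subtracting from [p] the differential of a lift of [y] moves it into the
   kernel of [j] without changing its differential. In degree 0 a coboundary is 0 and [p] itself
   will do. *)
suff [p' [jp' dp']] : exists p', j q p' = 0 /\ (dU q p'.1, dV q p'.2) = (dU q p.1, dV q p.2).
  by have /ij[c cE] := jp'; exists c; apply: i_inj; rewrite id cE dp' pb.
case: q w b p pw pb wcob => [|q] w b p pw pb.
  by move/coboundary0 => w0; exists p; rewrite pw w0.
move/coboundaryS => [y yw]; have [s sy] := j_surj y.
exists (p - (dU q s.1, dV q s.2)); split.
  by rewrite linearB jd pw sy yw subrr.
by rewrite /= !linearB /= ddU ddV !subr0.
Qed.

Lemma mayer_vietoris_exact :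
  exists (iH : forall q, {linear cohomology d q -> (cohomology dU q * cohomology dV q)%type})
    (jH : forall q, {linear (cohomology dU q * cohomology dV q)%type -> cohomology dX q})
    (dH : forall q, {linear cohomology dX q -> cohomology d q.+1}),
  [/\ forall q (w : Cocycle d q) (wU : Cocycle dU q) (wV : Cocycle dV q),
        i q (cocycle_val w) = (cocycle_val wU, cocycle_val wV) ->
        iH q (cls w) = (cls wU, cls wV),
      forall q (wU : Cocycle dU q) (wV : Cocycle dV q) (w : Cocycle dX q),
        j q (cocycle_val wU, cocycle_val wV) = cocycle_val w ->
        jH q (cls wU, cls wV) = cls w &
      forall q (w : Cocycle dX q) wU wV (b : Cocycle d q.+1),
        j q (wU, wV) = cocycle_val w ->
        i q.+1 (cocycle_val b) = (dU q wU, dV q wV) ->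
        dH q (cls w) = cls b] /\
  [/\ injective (iH 0%N),
      forall q, exact_pair (iH q) (jH q),
      forall q, exact_pair (jH q) (dH q) &
      forall q, exact_pair (dH q) (iH q.+1)].
Proof.
(* The middle term is a product of two cohomology modules, not the cohomology of a product complex,
   so [i] and [j] are split into components that induce maps separately. *)
have [|iU iUE] := @linear_family R _ _ (fun k w => (i k w).1).
  by move=> k a x y; rewrite linearP.
have [|iV iVE] := @linear_family R _ _ (fun k w => (i k w).2).
  by move=> k a x y; rewrite linearP.
have [|jU jUE] := @linear_family R _ _ (fun k (w : U k) => j k (w, 0)).
  move=> k a x y; rewrite -linearP; congr (j k _); congr pair.
  by rewrite /= scaler0 addr0.
have [|jV jVE] := @linear_family R _ _ (fun k (w : V k) => j k (0, w)).
  move=> k a x y; rewrite -linearP; congr (j k _); congr pair.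
  by rewrite /= scaler0 addr0.
have diU k x : dU k (iU k x) = iU k.+1 (d k x) by rewrite !iUE id.
have diV k x : dV k (iV k x) = iV k.+1 (d k x) by rewrite !iVE id.
have djU k x : dX k (jU k x) = jU k.+1 (dU k x).
  by rewrite !jUE -(jd (x, 0)) /= linear0.
have djV k x : dX k (jV k x) = jV k.+1 (dV k x).
  by rewrite !jVE -(jd (0, x)) /= linear0.
have HiH q : exists g : {linear cohomology d q -> (cohomology dU q * cohomology dV q)%type},
    forall (w : Cocycle d q) (wU : Cocycle dU q) (wV : Cocycle dV q),
    i q (cocycle_val w) = (cocycle_val wU, cocycle_val wV) -> g (cls w) = (cls wU, cls wV).
  have [gU gUE] := chain_map_induced diU q; have [gV gVE] := chain_map_induced diV q.
  have lg : linear (fun y => (gU y, gV y)) by move=> a x y; rewrite !linearP.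
  pose g : {linear cohomology d q -> (cohomology dU q * cohomology dV q)%type} :=
    HB.pack (fun y => (gU y, gV y)) (GRing.isLinear.Build _ _ _ _ _ lg).
  exists g => w wU wV E; rewrite /= (gUE _ wU) ?iUE ?E // (gVE _ wV) ?iVE ?E //.
have HjH q : exists g : {linear (cohomology dU q * cohomology dV q)%type -> cohomology dX q},
    forall (wU : Cocycle dU q) (wV : Cocycle dV q) (w : Cocycle dX q),
    j q (cocycle_val wU, cocycle_val wV) = cocycle_val w -> g (cls wU, cls wV) = cls w.
  have [gU gUE] := chain_map_induced djU q; have [gV gVE] := chain_map_induced djV q.
  have lg : linear (fun y : (cohomology dU q * cohomology dV q)%type => gU y.1 + gV y.2).
    by move=> a x y; rewrite !linearP /= scalerDr addrACA.
  pose g : {linear (cohomology dU q * cohomology dV q)%type -> cohomology dX q} :=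
    HB.pack (fun y : (cohomology dU q * cohomology dV q)%type => gU y.1 + gV y.2)
      (GRing.isLinear.Build _ _ _ _ _ lg).
  exists g => wU wV w E.
  have [|zU zUE] := @mk_cocycle _ _ dX q (jU q (cocycle_val wU)).
    by rewrite djU cocycleP linear0.
  have [|zV zVE] := @mk_cocycle _ _ dX q (jV q (cocycle_val wV)).
    by rewrite djV cocycleP linear0.
  rewrite /= (gUE _ zU) // (gVE _ zV) //.
  have := cls_linear 1 zU zV; rewrite !scale1r => <-; congr cls; apply: cocycle_eq.
  rewrite -E /= [LHS](_ : _ = cocycle_val zU + cocycle_val zV) // zUE zVE jUE jVE.
  have := linearP (j q) 1 (cocycle_val wU, 0) (0, cocycle_val wV); rewrite !scale1r => <-.
  by congr (j q _); congr pair; rewrite /= ?addr0 ?add0r.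
pose iH q := projT1 (cid (HiH q)); pose jH q := projT1 (cid (HjH q)).
pose dH q := projT1 (cid (connecting_map q)).
have iHE q := projT2 (cid (HiH q)) : forall w wU wV, _ -> iH q (cls w) = _.
have jHE q := projT2 (cid (HjH q)) : forall wU wV w, _ -> jH q (cls wU, cls wV) = _.
have dHE q := projT2 (cid (connecting_map q)) : forall w b, _ -> dH q (cls w) = cls b.
have iC q (w : Cocycle d q) : exists (wU : Cocycle dU q) (wV : Cocycle dV q),
    i q (cocycle_val w) = (cocycle_val wU, cocycle_val wV).
  have [|zU zUE] := @mk_cocycle _ _ dU q (iU q (cocycle_val w)).
    by rewrite diU cocycleP linear0.
  have [|zV zVE] := @mk_cocycle _ _ dV q (iV q (cocycle_val w)).
    by rewrite diV cocycleP linear0.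
  by exists zU, zV; rewrite zUE zVE iUE iVE; case: (i q _).
have jC q (wU : Cocycle dU q) (wV : Cocycle dV q) : exists w : Cocycle dX q,
    j q (cocycle_val wU, cocycle_val wV) = cocycle_val w.
  have [|w wE] := @mk_cocycle _ _ dX q (j q (cocycle_val wU, cocycle_val wV)).
    by rewrite -jd /= !cocycleP -(linear0 (j q.+1)).
  by exists w.
exists iH, jH, dH; split; split.
- by move=> q w wU wV /iHE.
- by move=> q wU wV w /jHE.
- by move=> q w wU wV b jw ib; apply: dHE; exists (wU, wV).
- move=> y y'; have [w ->] := cls_surj y; have [w' ->] := cls_surj y'.
  have [wU [wV E]] := iC _ w; have [wU' [wV' E']] := iC _ w'.
  (* There are no coboundaries but 0 in degree 0, so injectivity is inherited from [i]. *)
  rewrite (iHE _ _ _ _ E) (iHE _ _ _ _ E') => -[/clsP/coboundary0 hU /clsP/coboundary0 hV].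
  congr cls; apply: cocycle_eq; apply: i_inj; rewrite E E'; congr pair.
    by apply/eqP; rewrite -subr_eq0; apply/eqP.
  by apply/eqP; rewrite -subr_eq0; apply/eqP.
- move=> q [yU yV]; have [zU ->] := cls_surj yU; have [zV ->] := cls_surj yV.
  have [w E] := jC _ zU zV; rewrite (jHE _ _ _ _ E); split; last first.
    move=> [x]; have [z ->] := cls_surj x; have [uU [uV Ez]] := iC _ z.
    rewrite (iHE _ _ _ _ Ez) => -[eU eV]; rewrite -(jHE _ _ _ _ E) -eU -eV -(cls0 dX q).
    by apply: jHE; rewrite -Ez ji.
  move=> /cls_eq0 wc.
  (* A representative of the same two classes in the kernel of [j]: subtract the differential of a
     lift of a primitive of [w]. *)
  have [p [jp dp1 cp]] : exists p : U q * V q, [/\ j q p = 0, dU q p.1 = 0 /\ dV q p.2 = 0 &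
      forall (pU : Cocycle dU q) (pV : Cocycle dV q), p = (cocycle_val pU, cocycle_val pV) ->
      cls pU = cls zU /\ cls pV = cls zV].
    case: q zU zV w E wc {yU yV} => [|q] zU zV w E.
      move/coboundary0 => w0; exists (cocycle_val zU, cocycle_val zV); rewrite E w0 !cocycleP.
      split=> // pU pV [eU eV]; split; congr cls; exact: cocycle_eq.
    move/coboundaryS => [y yw]; have [s sy] := j_surj y.
    exists (cocycle_val zU - dU q s.1, cocycle_val zV - dV q s.2); split.
    + have -> : (cocycle_val zU - dU q s.1, cocycle_val zV - dV q s.2) =
        (cocycle_val zU, cocycle_val zV) - (dU q s.1, dV q s.2) by [].
      by rewrite linearB E jd sy yw subrr.
    + by rewrite /= !linearB !cocycleP ddU ddV !subr0.
    + move=> pU pV [eU eV]; split; apply/clsP/coboundaryS.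
        by exists (- s.1); rewrite linearN /=
            -[RHS]/(cocycle_val pU - cocycle_val zU) -eU addrAC subrr add0r.
      by exists (- s.2); rewrite linearN /=
          -[RHS]/(cocycle_val pV - cocycle_val zV) -eV addrAC subrr add0r.
  have /ij[c cE] := jp; have [|z zE] := @mk_cocycle _ _ d q c.
    by apply: i_cocycle; rewrite cE; case: dp1.
  have [uU [uV Ez]] := iC _ z; exists (cls z); rewrite (iHE _ _ _ _ Ez).
  by have [-> ->] := cp uU uV (etrans (etrans (esym cE) (congr1 (i q) (esym zE))) Ez).
- move=> q y; have [w ->] := cls_surj y; split; last first.
    move=> [[yU yV]]; have [zU ->] := cls_surj yU; have [zV ->] := cls_surj yV.
    have [w' E] := jC _ zU zV; rewrite (jHE _ _ _ _ E) => <-; rewrite -(cls0 d q.+1).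
    apply: dHE; exists (cocycle_val zU, cocycle_val zV); split=> //.
    by rewrite /= !cocycleP linear0.
  have [p pw] := j_surj (cocycle_val w).
  have : j q.+1 (dU q p.1, dV q p.2) = 0 by rewrite jd pw cocycleP.
  move/ij => [b0 bE]; have [|b bb] := @mk_cocycle _ _ d q.+1 b0.
    by apply: i_cocycle; rewrite bE /= ?ddU ?ddV.
  rewrite (dHE _ _ b); last by exists p; rewrite bb.
  move=> /cls_eq0/coboundaryS[c cE].
  (* When [b] bounds [c], the pair [p - i c] is closed and still lifts [w]. *)
  have dc : (dU q (i q c).1, dV q (i q c).2) = (dU q p.1, dV q p.2) by rewrite -id cE bb.
  have [|zU zUE] := @mk_cocycle _ _ dU q (p - i q c).1.
    by rewrite /= linearB (congr1 fst dc : dU q (i q c).1 = _) subrr.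
  have [|zV zVE] := @mk_cocycle _ _ dV q (p - i q c).2.
    by rewrite /= linearB (congr1 snd dc : dV q (i q c).2 = _) subrr.
  exists (cls zU, cls zV); apply: jHE; rewrite zUE zVE.
  by rewrite (_ : (_, _) = p - i q c) // linearB ji subr0.
move=> q y; have [b ->] := cls_surj y; split; last first.
  move=> [x]; have [w ->] := cls_surj x.
  have [p pw] := j_surj (cocycle_val w).
  have : j q.+1 (dU q p.1, dV q p.2) = 0 by rewrite jd pw cocycleP.
  move/ij => [b0 bE]; have [|b' bb] := @mk_cocycle _ _ d q.+1 b0.
    by apply: i_cocycle; rewrite bE /= ?ddU ?ddV.
  rewrite (dHE _ _ b'); last by exists p; rewrite bb.
  move=> <-; have [bU [bV Eb]] := iC _ b'; rewrite (iHE _ _ _ _ Eb).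
  move: Eb; rewrite bb bE => -[eU eV].
  by congr pair; apply/cls_eq0/coboundaryS; [exists p.1|exists p.2].
have [bU [bV Eb]] := iC _ b; rewrite (iHE _ _ _ _ Eb).
move=> [/cls_eq0/coboundaryS[pU pUE] /cls_eq0/coboundaryS[pV pVE]].
(* The difference of the primitives on the two pieces is closed, and [dH] sends its class to that of
   [b]. *)
have [|w wE] := @mk_cocycle _ _ dX q (j q (pU, pV)).
  by rewrite -jd /= pUE pVE -Eb ji.
exists (cls w); apply: dHE; exists (pU, pV); split=> //=.
by rewrite Eb pUE pVE.
Qed.

End LongExactSequence.

(** * The short exact sequence of forms *)

Section ShortExactSequence.
Variables (R : realType) (n : nat) (M : manifold R n) (rA rE : nat).
Variables (A : vbundle M rA) (E : vbundle M rE) (U V : opens M).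
Hypothesis UV : U `|` V = [set: M].

Lemma mv_i_injective k : injective (mv_i A E U V k).
Proof.
move=> w w' e; have eU : res_form U w = res_form U w' := congr1 fst e.
have eV : res_form V w = res_form V w' := congr1 snd e; apply: formP => x v.
have : (U `|` V) x by rewrite UV.
case=> Wx.
  by have := congr1 (fun h : 'Omega^k(A \|_ U, E \|_ U) => h (exist _ x (mem_set Wx)) v) eU.
by have := congr1 (fun h : 'Omega^k(A \|_ V, E \|_ V) => h (exist _ x (mem_set Wx)) v) eV.
Qed.

(** Forms agreeing on the overlap are glued as a family of maps over M that is smooth over [U] and
    over [V]. *)
Lemma mv_exact k : exact_pair (mv_i A E U V k) (mv_j A E U V k).
Proof.
move=> [wU wV]; split; last first.
  by move=> [w <-]; apply: formP => x v; rewrite /mv_j /= -[LHS]/(_ - _) subrr.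
move=> jw.
have agree (x : open_mfd (opensI U V)) v :
    wV (incl (j1 (V := V)) x) v = wU (incl (j0 (V := V)) x) v.
  apply/eqP; rewrite -subr_eq0; apply/eqP.
  have := congr1 (fun h : 'Omega^k(A \|_ (opensI U V), E \|_ (opensI U V)) => h x v) jw.
  exact.
pose w : form_family A E k := fun x v => if pselect (oset U x) then
  ext0 (F := alt_fiber A E k) (form_fun wU) x v else ext0 (F := alt_fiber A E k) (form_fun wV) x v.
have wUE (x : open_mfd U) v : w (val x) v = wU x v.
  rewrite /w; case: pselect => [?|[]]; last exact: set_mem (valP x).
  by rewrite (ext0_in (F := alt_fiber A E k)).
have wVE (x : open_mfd V) v : w (val x) v = wV x v.
  rewrite /w; case: pselect => [Ux|?]; last by rewrite (ext0_in (F := alt_fiber A E k)).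
  have UVx : oset (opensI U V) (val x) by split=> //; exact: set_mem (valP x).
  have [y yE] : exists y : open_mfd (opensI U V), incl (j1 (V := V)) y = x.
    by exists (exist _ (val x) (mem_set UVx)); exact: val_inj.
  subst x; rewrite agree.
  exact: (congr1 (fun F => F v)
    (ext0_in (F := alt_fiber A E k) (form_fun wU) (incl (j0 (V := V)) y))).
have fU : form_on U w.
  apply: form_on_eq (form_on_ext0 wU) => x v Ux.
  by rewrite /w; case: pselect.
have fV : form_on V w.
  apply: form_on_eq (form_on_ext0 wV) => x v Vx.
  have := wVE (exist _ x (mem_set Vx)) v; rewrite /= => ->.
  exact: (congr1 (fun F => F v)
    (ext0_in (F := alt_fiber A E k) (form_fun wV) (exist _ x (mem_set Vx)))).
have := form_on_glue fU fV; rewrite UV => /form_onT[h hE]; exists h.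
by congr pair; apply: formP => x v; [rewrite -wUE|rewrite -wVE]; exact: hE.
Qed.

Lemma zero_extension_exists (W' W : opens M) (sW : W' `<=` W) (mu : 'C^oo(M)) k
    (w : 'Omega^k(A \|_ W', E \|_ W')) :
  (forall x, oset W x -> ~ oset W' x -> \forall y \near x, mu y = 0) ->
  exists h : 'Omega^k(A \|_ W, E \|_ W), zero_extension sW mu w h.
Proof.
move=> mu0.
have := @form_on_cut _ _ _ _ _ A E k W' W mu (ext0 (F := alt_fiber A E k) (form_fun w)) sW mu0
  (form_on_ext0 w).
case=> [x v Wx|]; first by rewrite (ext0_out (F := alt_fiber A E k)).
move=> mw aw sw.
have [h hE] := form_on_res (And3 mw aw sw); exists h; split=> [x v|x v Wx].
  rewrite hE; congr (_ *: _).
  exact: (congr1 (fun F => F v) (ext0_in (F := alt_fiber A E k) (form_fun w) x)).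
by rewrite hE (ext0_out (F := alt_fiber A E k)) // scaler0.
Qed.

(** At a point of [U] outside [V] the function [muV] vanishes nearby, so [muV w] extends to [U], and
    symmetrically. On the overlap the two products add up to [w]; the minus sign turns the
    difference in [mv_j] into this sum. *)
Lemma partition_zero_extensions (muU muV : 'C^oo(M)) : partition_of_unity U V muU muV ->
  forall k (w : 'Omega^k(A \|_ (opensI U V), E \|_ (opensI U V))), exists wU wV,
    [/\ zero_extension (j0 (V := V)) muV w wU, zero_extension (j1 (V := V)) muU w wV &
        mv_j A E U V k (- wU, wV) = w].
Proof.
move=> [_ _ sum1 sU sV] k w.
have [|wU wUE] := @zero_extension_exists _ _ (j0 (V := V)) muV _ w.
  by move=> x Ux nUV; apply: support_out sV _ => Vx; apply: nUV.
have [|wV wVE] := @zero_extension_exists _ _ (j1 (V := V)) muU _ w.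
  by move=> x Vx nUV; apply: support_out sU _ => Ux; apply: nUV.
exists wU, wV; split=> //; apply: formP => x v.
rewrite /mv_j /= linearN opprK -[LHS]/(wV (incl _ x) v + wU (incl _ x) v).
by rewrite (proj1 wVE) (proj1 wUE) -scalerDl sum1 scale1r.
Qed.

Lemma mv_j_surjective k w : exists p, mv_j A E U V k p = w.
Proof.
have [muU [muV mu]] := partition_of_unity_exists UV.
by have [wU [wV [_ _ <-]]] := partition_zero_extensions mu w; exists (- wU, wV).
Qed.

End ShortExactSequence.

(** [dH] is characterised by arbitrary lifts of a cocycle, hence does not depend on a partition of
    unity; the explicit formula is its value for the lift [(- muV w, muU w)]. *)
Theorem theorem6p1 (R : realType) (n rA rE : nat) (M : manifold R n)
    (A : vbundle M rA) (L : lie_algebroid A) (E : vbundle M rE)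
    (nabla : 'Gamma(A) -> 'Gamma(E) -> 'Gamma(E))
    (nablaP : representation L nabla)
    (U V : opens M) (coverUV : U `|` V = [set: M]) :
  let d := d_nabla L nabla in
  let dU := d_on L nabla U in
  let dV := d_on L nabla V in
  let dUV := d_on L nabla (opensI U V) in
  (* the short exact sequence of complexes *)
  [/\ forall k (w : 'Omega^k(A, E)),
        mv_i A E U V k.+1 (d k w) =
          (dU k (mv_i A E U V k w).1, dV k (mv_i A E U V k w).2),
      forall k (w : 'Omega^k(A \|_ U, E \|_ U) * 'Omega^k(A \|_ V, E \|_ V)),
        mv_j A E U V k.+1 (dU k w.1, dV k w.2) = dUV k (mv_j A E U V k w) &
      forall k,
        [/\ injective (mv_i A E U V k),
            exact_pair (mv_i A E U V k) (mv_j A E U V k) &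
            forall w, exists p, mv_j A E U V k p = w]]
  /\
  (* the long exact sequence *)
  exists (iH : forall q, {linear cohomology d q ->
                                 (cohomology dU q * cohomology dV q)%type})
    (jH : forall q, {linear (cohomology dU q * cohomology dV q)%type ->
                            cohomology dUV q})
    (dH : forall q, {linear cohomology dUV q -> cohomology d q.+1}),
  [/\ (* iH, jH and dH are induced by the short exact sequence *)
      [/\ forall q (w : Cocycle d q) (wU : Cocycle dU q) (wV : Cocycle dV q),
            mv_i A E U V q (cocycle_val w) = (cocycle_val wU, cocycle_val wV) ->
            iH q (cls w) = (cls wU, cls wV),
          forall q (wU : Cocycle dU q) (wV : Cocycle dV q) (w : Cocycle dUV q),
            mv_j A E U V q (cocycle_val wU, cocycle_val wV) = cocycle_val w ->
            jH q (cls wU, cls wV) = cls w &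
          forall q (w : Cocycle dUV q) wU wV (b : Cocycle d q.+1),
            mv_j A E U V q (wU, wV) = cocycle_val w ->
            mv_i A E U V q.+1 (cocycle_val b) = (dU q wU, dV q wV) ->
            dH q (cls w) = cls b],
      [/\ injective (iH 0%N),
          forall q, exact_pair (iH q) (jH q),
          forall q, exact_pair (jH q) (dH q) &
          forall q, exact_pair (dH q) (iH q.+1)] &
      forall muU muV, partition_of_unity U V muU muV ->
      forall q (w : Cocycle dUV q),
      exists wU wV (b : Cocycle d q.+1),
        [/\ zero_extension (j0 (V := V)) muV (cocycle_val w) wU,
            zero_extension (j1 (V := V)) muU (cocycle_val w) wV,
            res_form U (cocycle_val b) = - dU q wU, res_form V (cocycle_val b) = dV q wV &
            dH q (cls w) = cls b]].
Proof.
move=> d dU dV dUV.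
have repW W := res_rep_representation nablaP W.
have id k (w : 'Omega^k(A, E)) : mv_i A E U V k.+1 (d k w) =
    (dU k (mv_i A E U V k w).1, dV k (mv_i A E U V k w).2).
  by congr pair; apply/esym; exact: d_on_res.
have jd k (w : 'Omega^k(A \|_ U, E \|_ U) * 'Omega^k(A \|_ V, E \|_ V)) :
    mv_j A E U V k.+1 (dU k w.1, dV k w.2) = dUV k (mv_j A E U V k w).
  by rewrite /mv_j /= linearB /dUV !d_on_res_incl.
have ddU k w : dU k.+1 (dU k w) = 0 by exact: d_nabla_d_nabla (repW U) _ w.
have ddV k w : dV k.+1 (dV k w) = 0 by exact: d_nabla_d_nabla (repW V) _ w.
have ii k := @mv_i_injective R n M rA rE A E U V coverUV k.
have ij k := @mv_exact R n M rA rE A E U V coverUV k.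
have js k := @mv_j_surjective R n M rA rE A E U V coverUV k.
split; first by split=> // k; split.
have [iH [jH [dH [[iHE jHE dHE] ex]]]] := @mayer_vietoris_exact R _ _ _ _ d dU dV dUV
  (fun k => mv_i A E U V k : {linear _ -> _}) (fun k => mv_j A E U V k : {linear _ -> _})
  id jd ii ij js ddU ddV.
exists iH, jH, dH; split=> // muU muV mu q w.
have [wU [wV [zU zV jw]]] := partition_zero_extensions mu (cocycle_val w).
(* The differentials of the two components agree on the overlap because [(- wU, wV)] lifts a closed
   form; so they glue. *)
have : mv_j A E U V q.+1 (dU q (- wU), dV q wV) = 0.
  by rewrite -[X in _ = X](cocycleP w) -jw -jd.
move/ij => [b0 bE].
have [|b bb] := @mk_cocycle _ _ d q.+1 b0.
  by apply: ii; rewrite id bE /= ddU ddV linear0.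
exists wU, wV, b; split=> //.
- by rewrite bb -linearN; exact: (congr1 fst bE).
- by rewrite bb; exact: (congr1 snd bE).
by apply: dHE jw _; rewrite bb.
Qed.
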